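(* Let $f\in L^2(\Omega)$ and let $z_h^*$ be obtained by the following procedure: (1) find $r_h\in A^3_{h0}$ such that $(\nabla_hr_h,\nabla_hs_h)=(f,s_h)$ for all $s_h\in A^3_{h0}$; (2) find $(\boldsymbol\varphi_h,p_h)\in\mathbf{G}^2_{ht}\times\mathbb{P}^1_{h0}$ such that $$(\nabla_h\boldsymbol\varphi_h,\nabla_h\boldsymbol\psi_h)+(p_h,\mathrm{rot}_h\boldsymbol\psi_h)=(\nabla_hr_h,\boldsymbol\psi_h)\ \ \forall\boldsymbol\psi_h\in\mathbf{G}^2_{ht},\qquad(q_h,\mathrm{rot}_h\boldsymbol\varphi_h)=0\ \ \forall q_h\in\mathbb{P}^1_{h0};$$ (3) find $z_h^*\in A^3_{h0}$ such that $(\nabla_hz_h^*,\nabla_hv_h^* )=(\boldsymbol\varphi_h,\nabla_hv_h^* )$ for all $v_h^*\in A^3_{h0}$. Let $z_h\in B^3_{ht}$ be the solution of $(\nabla_h^2z_h,\nabla_h^2v_h)=(f,v_h)$ for all $v_h\in B^3_{ht}$. Then $z_h^*=z_h$.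
   Context: $\Omega\subset\mathbb{R}^2$ is a simply connected polygonal domain and $\mathcal{T}_h$ is a shape-regular triangulation of $\Omega$. $\mathcal{E}_h^i,\mathcal{E}_h^b$ are the interior and boundary edges; $\mathcal{X}_h,\mathcal{X}_h^b$ all vertices and boundary vertices; $\mathbf{t}_e$ is a unit tangent to $e$, $\partial_{\mathbf n}$ the normal derivative on $e$ and $[\![\cdot]\!]$ the jump across $e$. A subscript $h$ on a differential operator means it is applied cell by cell; $\nabla^2$ is the Hessian; $\mathrm{rot}\,\mathbf{v}=\partial_x v^2-\partial_y v^1$; $(\cdot,\cdot)$ is the $L^2(\Omega)$ inner product. Spaces: $\mathbb{P}^k_h:=\{w\in L^2(\Omega): w|_T\in P_k(T)\ \forall T\}$, $\mathbb{P}^k_{h0}:=\{w\in\mathbb{P}^k_h:\int_\Omega w=0\}$; $A^3_{h0}:=\{w\in\mathbb{P}^3_h: w$ is continuous at every $a\in\mathcal{X}_h$, $w(a)=0\ \forall a\in\mathcal{X}_h^b\}$; $\mathbf{G}_{ht}^2:=\{\mathbf{v}\in(\mathbb{P}^2_h)^2:\int_e p_e[\![v^j]\!]=0\ \forall e\in\mathcal{E}_h^i,\ j=1,2$, and $\int_e p_e\,\mathbf{v}\cdot\mathbf{t}_e=0\ \forall e\in\mathcal{E}_h^b$, for all $p_e\in P_1(e)\}$; $B_h^3:=\{v\in\mathbb{P}^3_h: v$ is continuous at every $a\in\mathcal{X}_h$; $\int_e[\![v]\!]=0$ and $\int_e p_e[\![\partial_{\mathbf n}v]\!]=0$ for all $p_e\in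 P_1(e)$, $e\in\mathcal{E}_h^i\}$; $B_{ht}^3:=\{v\in B_h^3: v(a)=0\ \forall a\in\mathcal{X}_h^b;\ \int_e v=0\ \forall e\in\mathcal{E}_h^b\}$. *)

(* Defs.v *)
From HB Require Import structures.
From mathcomp Require Import all_boot all_order all_algebra.
From mathcomp Require Import all_classical all_reals all_analysis.

Set Implicit Arguments.
Unset Strict Implicit.
Unset Printing Implicit Defensive.

Import Order.TTheory GRing.Theory Num.Theory.
Import numFieldNormedType.Exports.

Local Open Scope classical_set_scope.
Local Open Scope ring_scope.

Section PlaneGeometry.
Variable R : realType.
Implicit Types (u v x y : R * R) (A : set (R * R)).

(* The norm carried by R * R in the library is the sup norm. *)
Definition dot u v : R := u.1 * v.1 + u.2 * v.2.
Definition enorm u : R := Num.sqrt (dot u u).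
Definition cross u v : R := u.1 * v.2 - u.2 * v.1.

Definition seg_point u v (t : R) : R * R := (1 - t) *: u + t *: v.
Definition segment u v : set (R * R) := seg_point u v @` `[0, 1].

Definition frontier A : set (R * R) := closure A `\` A°.

Definition path_connected A : Prop :=
  forall x y, A x -> A y -> exists gamma : R -> R * R,
    [/\ {within `[0, 1], continuous gamma}, gamma @` `[0, 1] `<=` A,
        gamma 0 = x & gamma 1 = y].

(* H s t : s is the deformation parameter, t the parameter along the loop. *)
Definition null_homotopic A (gamma : R -> R * R) : Prop :=
  exists H : R * R -> R * R,
    [/\ {within `[0, 1] `*` `[0, 1], continuous H},
        H @` (`[0, 1] `*` `[0, 1]) `<=` A,
        (forall t, t \in `[0, 1] -> H (0, t) = gamma t),
        (forall t, t \in `[0, 1] -> H (1, t) = gamma 0) &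
        (forall s, s \in `[0, 1] -> H (s, 0) = gamma 0 /\ H (s, 1) = gamma 0)].

Definition simply_connected A : Prop :=
  path_connected A /\
  forall gamma : R -> R * R, {within `[0, 1], continuous gamma} ->
    gamma @` `[0, 1] `<=` A -> gamma 0 = gamma 1 -> null_homotopic A gamma.

(* Regular openness excludes slits, i.e. parts of the boundary having the
   domain on both sides. *)
Definition polygonal_domain A : Prop :=
  [/\ open A, connected A, A !=set0, bounded_set A & regopen A] /\
  exists s : seq ((R * R) * (R * R)),
    frontier A = \bigcup_(ab in [set` s]) segment ab.1 ab.2.

End PlaneGeometry.

Section Mesh.
Variables (R : realType) (V : finType) (pt : V -> R * R).
Variables (Th : {set {set V}}).

Definition hull (T : {set V}) : set (R * R) :=
  [set x | exists l : V -> R,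
    [/\ forall a, a \in T -> 0 <= l a, \sum_(a in T) l a = 1
      & x = \sum_(a in T) l a *: pt a]].

(* A cell is given by its set of vertices. *)
Record triangulation (Omega : set (R * R)) : Prop := Triangulation {
  vertex_in_cell : forall a, exists2 T, T \in Th & a \in T;
  card_cell : forall T, T \in Th -> #|T| = 3%N;
  cell_nondegenerate : forall a b c, [set a; b; c]%SET \in Th ->
    cross (pt b - pt a) (pt c - pt a) != 0;
  cell_conforming : forall T T', T \in Th -> T' \in Th ->
    hull T `&` hull T' = hull (T :&: T')%SET;
  cells_cover : \bigcup_(T in [set` Th]) hull T = closure Omega }.

Definition shape_regular (sigma : R) : Prop :=
  forall T, T \in Th -> exists (c : R * R) (rho : R),
    [/\ 0 < rho, [set x | enorm (x - c) <= rho] `<=` hull T &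
        forall x y, hull T x -> hull T y -> enorm (x - y) <= sigma * rho].

Definition cell := {T : {set V} | T \in Th}.

(* Edges are given by their two (ordered) end points; every condition below is
   invariant under exchanging these. *)
Definition is_edge (a b : V) : Prop :=
  a != b /\ exists T : cell, (a \in val T) && (b \in val T).
Definition boundary_edge (Omega : set (R * R)) a b : Prop :=
  is_edge a b /\ segment (pt a) (pt b) `<=` frontier Omega.
Definition interior_edge (Omega : set (R * R)) a b : Prop :=
  is_edge a b /\ ~ (segment (pt a) (pt b) `<=` frontier Omega).
Definition boundary_vertex (Omega : set (R * R)) a : Prop :=
  frontier Omega (pt a).

Definition tangent a b : R * R := (enorm (pt b - pt a))^-1 *: (pt b - pt a).
Definition normal a b : R * R := ((tangent a b).2, - (tangent a b).1).

(* Integral over the edge with respect to arc length. *)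
Definition edge_int a b (g : R * R -> R) : R :=
  enorm (pt b - pt a) *
  \int[@lebesgue_measure R]_(t in `[0, 1]) g (seg_point (pt a) (pt b) t).

End Mesh.

Section BivariatePolynomials.
Variable R : realType.
Implicit Type p : {poly {poly R}}.

(* Conventions of polyXY: the main variable is the first coordinate, so that
   p`_i`_j is the coefficient of x^i y^j. *)
Definition eval2 p (x : R * R) : R := p.[x.1%:P].[x.2].
Definition total_degree_le (k : nat) p : Prop :=
  forall i j : nat, (k < i + j)%N -> p`_i`_j = 0.
Definition dx p : {poly {poly R}} := p^`().
Definition dy p : {poly {poly R}} := map_poly (@deriv R) p.

End BivariatePolynomials.

Section Spaces.
Variables (R : realType) (V : finType) (pt : V -> R * R).
Variables (Th : {set {set V}}) (Omega : set (R * R)).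

(* A piecewise polynomial, i.e. the family of its restrictions to the cells.
   [w T] also represents the trace of the restriction on the boundary of T. *)
Definition pwpoly := {ffun cell Th -> {poly {poly R}}}.
Definition pwvec := (pwpoly * pwpoly)%type.

Implicit Types (u v w : pwpoly) (phi psi : pwvec) (T : cell Th).

Definition dxh w : pwpoly := [ffun T => dx (w T)].
Definition dyh w : pwpoly := [ffun T => dy (w T)].
Definition gradh w : pwvec := (dxh w, dyh w).
Definition roth psi : pwpoly := dxh psi.2 - dyh psi.1.

(* The function represented by w; the interiors of the cells are disjoint, and
   the value 0 is taken on the (negligible) skeleton of the mesh. *)
Definition pwfun w (x : R * R) : R :=
  \sum_(T : cell Th | x \in ((hull pt (val T))° : set (R * R))) eval2 (w T) x.

Definition mu2 := (@lebesgue_measure R \x @lebesgue_measure R)%E.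

Definition in_L2 (f : R * R -> R) : Prop :=
  measurable_fun Omega f /\ mu2.-integrable Omega (fun x => (f x ^+ 2)%:E).

Definition ip (f g : R * R -> R) : R := \int[mu2]_(x in Omega) (f x * g x).
Definition ip_fct f v : R := ip f (pwfun v).
Definition ip_sca u v : R := ip (pwfun u) (pwfun v).
Definition ip_vec phi psi : R := ip_sca phi.1 psi.1 + ip_sca phi.2 psi.2.
Definition ip_gradvec phi psi : R :=
  ip_vec (gradh phi.1) (gradh psi.1) + ip_vec (gradh phi.2) (gradh psi.2).
Definition ip_hess u v : R := ip_gradvec (gradh u) (gradh v).

Definition P_ (k : nat) w : Prop := forall T, total_degree_le k (w T).

Definition P0_ (k : nat) w : Prop :=
  P_ k w /\ \int[mu2]_(x in Omega) pwfun w x = 0.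

Definition vertex_continuous w : Prop :=
  forall a T T', a \in val T -> a \in val T' ->
    eval2 (w T) (pt a) = eval2 (w T') (pt a).

Definition vertex_zero w : Prop :=
  forall a T, boundary_vertex pt Omega a -> a \in val T ->
    eval2 (w T) (pt a) = 0.

(* tr T is the trace on the edges of T; q is the restriction to the edge of a
   polynomial of the plane of degree at most k, which yields all of P_k(e), and
   T, T' are the two cells sharing the edge. With k = 0 this is the vanishing
   of the mean. *)
Definition jump_moments (k : nat) (tr : V -> V -> cell Th -> R * R -> R) : Prop :=
  forall a b T T' (q : {poly {poly R}}), interior_edge pt Th Omega a b ->
    T != T' -> a \in val T -> b \in val T -> a \in val T' -> b \in val T' ->
    total_degree_le k q ->
    edge_int pt a b (fun x => eval2 q x * (tr a b T x - tr a b T' x)) = 0.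

Definition boundary_moments (k : nat) (tr : V -> V -> cell Th -> R * R -> R) : Prop :=
  forall a b T (q : {poly {poly R}}), boundary_edge pt Th Omega a b ->
    a \in val T -> b \in val T -> total_degree_le k q ->
    edge_int pt a b (fun x => eval2 q x * tr a b T x) = 0.

Definition tr_val w (a b : V) T x : R := eval2 (w T) x.
Definition tr_dn w (a b : V) T x : R :=
  dot (eval2 (dx (w T)) x, eval2 (dy (w T)) x) (normal pt a b).
Definition tr_tan psi (a b : V) T x : R :=
  dot (eval2 (psi.1 T) x, eval2 (psi.2 T) x) (tangent pt a b).

Definition A3h0 w : Prop := [/\ P_ 3 w, vertex_continuous w & vertex_zero w].

Definition G2ht psi : Prop :=
  [/\ P_ 2 psi.1, P_ 2 psi.2, jump_moments 1 (tr_val psi.1),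
      jump_moments 1 (tr_val psi.2) & boundary_moments 1 (tr_tan psi)].

Definition B3h w : Prop :=
  [/\ P_ 3 w, vertex_continuous w, jump_moments 0 (tr_val w)
    & jump_moments 1 (tr_dn w)].

Definition B3ht w : Prop :=
  [/\ B3h w, vertex_zero w & boundary_moments 0 (tr_val w)].

End Spaces.

(* Main.v *)
Require Import Defs.
From mathcomp Require Import all_boot all_order all_algebra.
From mathcomp Require Import all_classical all_reals all_analysis.
From mathcomp Require Import measurable_realfun ring lra.

(* The test function [q = rot phi - mean] in the constraint of step (2) shows
   that [rot phi] is a constant, which vanishes because the circulations of
   [phi] around the cells add up to 0. Simple connectedness then yields
   [phi = grad w] with [w] in B^3_ht, and testing the first equation of step
   (2) with [grad v], [v] in B^3_ht, shows that [w] solves the problem defining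
   [z]; step (3) says that the gradients of [zstar] and [w] coincide.

   The existence of [w] is H^1(Omega, boundary) = 0 for the mesh. By the
   Fredholm alternative it is dual to the statement that antisymmetric jumps
   [y] across the interior edges with sum 0 around every interior vertex are
   the jumps of a function which is constant on each cell. Such a function
   exists near every point of Omega, and the local functions are glued along
   paths; the result is path independent because loops in Omega are
   null-homotopic. *)

Set Implicit Arguments.
Unset Strict Implicit.
Unset Printing Implicit Defensive.

Import Order.TTheory GRing.Theory Num.Theory.
Import numFieldNormedType.Exports.

Local Open Scope classical_set_scope.
Local Open Scope ring_scope.

(** * Paths and monodromy *)

Section Paths.
Variable R : realType.

(** The potential has to vanish at every boundary vertex. Integrating along mesh edges gives no
    control of the constants on different parts of the boundary, and the way cells meet around a
    boundary vertex is not prescribed. Duality removes this obstacle: the dual unknown is one number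
    per cell, without boundary condition, and every local argument takes place at a point of
    [Omega], where the cells fill a neighbourhood. Simple connectedness speaks of continuous loops;
    a path is brought to the mesh by sampling it, each sample choosing a cell that contains it, and
    in a fine sampling consecutive cells share a point of [Omega]. Integrals of piecewise
    polynomials over [Omega] enter only through linearity, positivity and definiteness. Green's
    formulas are replaced by polynomial identities on the edges of one triangle, summed with
    cancellation between neighbours. The spaces fit together because integration by parts along an
    edge trades end values and the mean of a jump for the affine moments of its tangential
    derivative. The pressure drops out, since the rot of a gradient is 0. *)

Definition clamp (t : R) : R := Num.max 0 (Num.min t 1).

Lemma clamp_itv t : clamp t \in `[0, 1].
Proof. by rewrite in_itv /= /clamp le_max lexx ge_max ler01 ge_min lexx orbT. Qed.

Lemma clamp_le0 t : t <= 0 -> clamp t = 0.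
Proof.
move=> t0; rewrite /clamp (min_idPl _) ?(max_idPl t0)//.
exact: le_trans t0 ler01.
Qed.

Lemma clamp_ge1 t : 1 <= t -> clamp t = 1.
Proof. by move=> t1; rewrite /clamp (min_idPr t1) (max_idPr ler01). Qed.

Lemma clamp_continuous : continuous clamp.
Proof.
move=> t; apply: (@continuous_max R R (cst 0) (fun t => Num.min t 1)).
  exact: cvg_cst.
by apply: (@continuous_min R R id (cst 1)); [exact: cvg_id | exact: cvg_cst].
Qed.

(** [clamp] retracts the line onto [0, 1], so a path continuous only relative to the interval
    becomes a continuous function on the line, constant beyond the ends. *)
Lemma continuous_clamp_within (g : R -> R * R) :
  {within `[0, 1], continuous g} -> continuous (g \o clamp).
Proof.
move=> /subspace_continuousP gc t.
have A u : `[0, 1]%classic (clamp u) by apply: clamp_itv.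
apply: (@cvg_comp _ _ _ clamp g _ _ _ _ (gc _ (A t))) => P /= wP.
by apply: (@filterS _ (nbhs t) _ _ _ _ (@clamp_continuous t _ wP)) => u /=; apply; exact: A.
Qed.

Lemma continuous_scale_add (a b : R) : continuous (fun t : R => a * t + b).
Proof.
move=> t; apply: cvgD; last exact: cvg_cst.
by apply: cvgM; [exact: cvg_cst|exact: cvg_id].
Qed.

Lemma continuous_affine (x v : R * R) : continuous (fun t : R => x + t *: v).
Proof.
move=> t; apply: cvgD; first exact: cvg_cst.
by apply: cvgZ; [exact: cvg_id|exact: cvg_cst].
Qed.

End Paths.

Section IPath.
Variables (R : realType) (Omega : set (R * R)).

Definition ipath (x y : R * R) (g : R -> R * R) : Prop :=
  [/\ continuous g, forall t, Omega (g t), forall t, t <= 0 -> g t = x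
    & forall t, 1 <= t -> g t = y].

Lemma ipath_rev x y g : ipath x y g -> ipath y x (fun t => g (1 - t)).
Proof.
move=> [gc gO g0 g1]; split => [t|t|t t0|t t1] //.
- apply: (@continuous_comp _ _ _ (fun t : R => 1 - t) g); last exact: gc.
  by apply: cvgB; [exact: cvg_cst | exact: cvg_id].
- by apply: g1; lra.
- by apply: g0; lra.
Qed.

(* The constant extension of paths outside [0, 1] makes the concatenation a sum
   of continuous functions: g (2 t) + h (2 t - 1) - y. *)
Lemma ipath_cat x y z g h : ipath x y g -> ipath y z h ->
  exists k, [/\ ipath x z k, forall t, t <= 1/2 -> k t = g (2 * t)
             & forall t, 1/2 <= t -> k t = h (2 * t - 1)].
Proof.
move=> [gc gO g0 g1] [hc hO h0 h1].
pose k t := g (2 * t) + h (2 * t - 1) - y.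
have kl t : t <= 1/2 -> k t = g (2 * t).
  by move=> t2; rewrite /k h0 ?addrK//; lra.
have kr t : 1/2 <= t -> k t = h (2 * t - 1).
  by move=> t2; rewrite /k g1 ?(addrC y) ?addrK//; lra.
exists k; split => //; split.
- move=> t; apply: cvgB; last exact: cvg_cst.
  apply: cvgD.
    apply: (@continuous_comp _ _ _ (fun t : R => 2 * t) g); last exact: gc.
    by apply: cvgM; [exact: cvg_cst|exact: cvg_id].
  apply: (@continuous_comp _ _ _ (fun t : R => 2 * t - 1) h); last exact: hc.
  by have := @continuous_scale_add R 2 (- 1) t.
- by move=> t; have [t2|t2] := leP t (1/2); [rewrite kl|rewrite kr// ltW].
- by move=> t t0; rewrite kl ?g0//; lra.
- by move=> t t0; rewrite kr ?h1//; lra.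
Qed.

End IPath.

Section Monodromy.
Variables (R : realType) (Omega : set (R * R)) (I : finType).
Variable S : R * R -> I -> Prop.
Hypothesis S_near : forall x, Omega x -> \forall y \near x, forall i, S y i -> S x i.

(** A Lebesgue number argument, with compactness in its near-covering form: close to [H p] only
    pieces through [H p] occur, and one mesh size serves the whole of [K]. *)
Lemma uniform_subdivision (K : set (R * R)) (H : R * R -> R * R) :
  compact K -> {within K, continuous H} -> H @` K `<=` Omega ->
  \forall n \near \oo, forall p, K p -> exists x, Omega x /\
    forall q, K q -> `|p.1 - q.1| <= n.+1%:R^-1 -> `|p.2 - q.2| <= n.+1%:R^-1 ->
    forall i, S (H q) i -> S x i.
Proof.
move=> /compact_near_coveringP Kc /subspace_continuousP Hc HO.
apply: (Kc nat \oo) => p Kp.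
have Op : Omega (H p) by apply: HO; exists p.
have /nbhs_ballP[e e0 ep] : \forall q \near p, K q -> forall i, S (H q) i -> S (H p) i.
  by have := Hc _ Kp _ (S_near Op).
(* Half of [e] is spent on the distance to the centre of the covering ball, half on the mesh
   size. *)
have e20 : 0 < e / 2 by rewrite divr_gt0.
exists (ball p (e / 2), [set n | n.+1%:R^-1 < e / 2]).
  split; first exact: nbhsx_ballx.
  exact: (near_infty_natSinv_lt (PosNum e20)).
move=> [q n] /= [[q1 q2] ne].
exists (H p); split => // q' Kq' d1 d2; apply: ep => //.
split; move: q1 q2; rewrite -!ball_normE /= => q1 q2.
- by rewrite -(subrKA q.1) (le_lt_trans (ler_normD _ _))// (splitr e) ltrD// (le_lt_trans d1).
- by rewrite -(subrKA q.2) (le_lt_trans (ler_normD _ _))// (splitr e) ltrD// (le_lt_trans d2).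
Qed.

End Monodromy.

Section Monodromy.
Variables (R : realType) (Omega : set (R * R)) (I : finType).
(* S x i means that the piece i contains x, and D i j is the difference between
   the values on i and j of any potential near a common point of i and j. *)
Variables (S : R * R -> I -> Prop) (D : I -> I -> R).
Hypothesis S_near : forall x, Omega x -> \forall y \near x, forall i, S y i -> S x i.
Hypothesis S_ex : forall x, Omega x -> exists i, S x i.
Hypothesis D_anti : forall i j, D i j = - D j i.
Hypothesis D_pot : forall x, Omega x ->
  exists u : I -> R, forall i j, S x i -> S x j -> D i j = u i - u j.

Lemma D_refl i : D i i = 0.
Proof. by have := D_anti i i; lra. Qed.

(** All the pieces contain [x], where [D] is the difference of a single local potential, so the sum
    telescopes. *)
Lemma sum_D_local x (t : nat -> I) m n : (m <= n)%N -> Omega x ->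
  (forall l, (m <= l <= n)%N -> S x (t l)) ->
  \sum_(m <= l < n) D (t l) (t l.+1) = D (t m) (t n).
Proof.
move=> mn /D_pot[u uP] St.
rewrite (@eq_big_nat _ _ _ _ _ _ (fun l => (- u (t l.+1)) - (- u (t l)))).
  rewrite telescope_sumr// uP; first by ring.
    by apply: St; rewrite leqnn.
  by apply: St; rewrite mn /=.
move=> l /andP[ml ln]; rewrite uP; first by ring.
  by apply: St; rewrite ml ltnW.
by apply: St; rewrite leqW.
Qed.

Lemma grid_itv n l : (0 < n)%N -> (l <= n)%N -> (l%:R / n%:R : R) \in `[0, 1].
Proof.
move=> n0 ln; rewrite in_itv /= divr_ge0//= ler_pdivrMr ?ltr0n// mul1r.
by rewrite ler_nat.
Qed.

Lemma grid_step n l : (0 < n)%N -> `|l%:R / n%:R - l.+1%:R / n%:R| <= n%:R^-1 :> R.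
Proof.
move=> n0; rewrite -mulrBl -addn1 natrD opprD addrA subrr sub0r mulN1r normrN.
by rewrite ger0_norm// invr_ge0.
Qed.

Lemma selection (g : R -> R * R) n i j : (forall t, t \in `[0, 1] -> Omega (g t)) ->
  (0 < n)%N -> S (g 0) i -> S (g 1) j ->
  exists t : nat -> I, [/\ forall l, (l <= n)%N -> S (g (l%:R / n%:R)) (t l),
    t 0%N = i & t n = j].
Proof.
move=> gO n0 Si Sj.
have [c cP] : exists c : R * R -> I, forall x, Omega x -> S x (c x).
  have Pex x : exists i, Omega x -> S x i.
    by have [/S_ex[k Sk]|nO] := pselect (Omega x); [exists k|exists i].
  by exists (fun x => sval (cid (Pex x))) => x; case: cid.
exists (fun l => if l == 0%N then i else if l == n then j else c (g (l%:R / n%:R))).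
split=> [l ln||]; rewrite ?eqxx//.
  case: eqP => [->|_]; first by rewrite mul0r.
  case: eqP => [->|_]; first by rewrite divff ?pnatr_eq0 -?lt0n.
  by apply: cP; apply: gO; exact: grid_itv.
by rewrite eqn0Ngt n0.
Qed.

(* Summing over a fine grid on the domain of the homotopy, each small square
   lies in the domain of one local potential and contributes 0. *)
Lemma null_homotopic_sum0 (g : R -> R * R) : null_homotopic Omega g ->
  \forall n \near \oo, forall t : nat -> I,
    (forall l, (l <= n.+1)%N -> S (g (l%:R / n.+1%:R)) (t l)) -> t n.+1 = t 0%N ->
    \sum_(0 <= l < n.+1) D (t l) (t l.+1) = 0.
Proof.
move=> [H [Hc HO H0 H1 Hs]].
have Kc : compact (`[(0 : R), 1] `*` `[(0 : R), 1]).
  by apply: compact_setX; exact: segment_compact.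
have := uniform_subdivision S_near Kc Hc HO.
apply: filterS => n sub t St tn.
have Kp l m : (l <= n.+1)%N -> (m <= n.+1)%N ->
    (`[(0 : R), 1] `*` `[(0 : R), 1]) (l%:R / n.+1%:R, m%:R / n.+1%:R).
  by move=> ln mn; split; apply: grid_itv.
have [c cP] : exists c : R * R -> I, forall x, Omega x -> S x (c x).
  have Pex x : exists i, Omega x -> S x i.
    by have [/S_ex[k Sk]|nO] := pselect (Omega x); [exists k|exists (t 0%N)].
  by exists (fun x => sval (cid (Pex x))) => x; case: cid.
(* Pieces at the grid points. The row [l = 0] carries the given selection; on the other three sides
   [H] is constantly [g 0], so [t 0] is admissible there and the last row contributes 0. *)
pose s l m := if l == 0%N then t m else
  if [|| l == n.+1, m == 0%N | m == n.+1] then t 0%N else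
  c (H (l%:R / n.+1%:R, m%:R / n.+1%:R)).
have n10 : n.+1%:R != 0 :> R by rewrite pnatr_eq0.
have sP l m : (l <= n.+1)%N -> (m <= n.+1)%N ->
    S (H (l%:R / n.+1%:R, m%:R / n.+1%:R)) (s l m).
  move=> ln mn; rewrite /s.
  case: eqP => [->|_]; first by rewrite mul0r H0 ?grid_itv//; exact: St.
  have S0 : S (g 0) (t 0%N) by have := St 0%N (leq0n _); rewrite mul0r.
  case: eqP => [->|_]; first by rewrite divff// H1 ?grid_itv.
  case: eqP => [->|_]; first by rewrite mul0r (Hs _ (grid_itv _ _)).1.
  case: eqP => [->|_]; first by rewrite divff// (Hs _ (grid_itv _ _)).2.
  by apply: cP; apply: HO; exists (l%:R / n.+1%:R, m%:R / n.+1%:R) => //; exact: Kp.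
have row l : (l <= n)%N -> \sum_(0 <= m < n.+1) D (s l m) (s l m.+1) =
    \sum_(0 <= m < n.+1) D (s l.+1 m) (s l.+1 m.+1).
  move=> ln; apply/eqP; rewrite -subr_eq0 -sumrB.
  (* [D] sums to 0 around each small square, so two adjacent rows differ by a telescoping sum of
     transversal terms, whose two end terms are both [D (t 0) (t 0)]. *)
  rewrite (@eq_big_nat _ _ _ _ _ _
    (fun m => (- D (s l m.+1) (s l.+1 m.+1)) - (- D (s l m) (s l.+1 m)))).
    rewrite telescope_sumr//.
    have -> : s l.+1 n.+1 = t 0%N by rewrite /s !eqxx !orbT.
    have -> : s l.+1 0%N = t 0%N by rewrite /s eqxx !orbT.
    have -> : s l n.+1 = t 0%N by rewrite /s eqxx !orbT; case: ifP.
    have -> : s l 0%N = t 0%N by rewrite /s eqxx !orbT; case: ifP.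
    by rewrite subrr.
  move=> m /= mn.
  have [x [Ox xP]] := sub _ (Kp l m (leqW ln) (ltnW mn)).
  have step a : `|a%:R / n.+1%:R - a.+1%:R / n.+1%:R| <= n.+1%:R^-1 :> R.
    exact: grid_step.
  have stay (a : R) : `|a - a| <= n.+1%:R^-1 :> R.
    by rewrite subrr normr0 invr_ge0.
  have [u uP] := D_pot Ox.
  have S00 : S x (s l m).
    by apply: xP (Kp l m _ _) _ _ _ (sP _ _ _ _); rewrite ?(leqW ln) ?(ltnW mn).
  have S01 : S x (s l m.+1).
    by apply: xP (Kp l m.+1 _ _) _ _ _ (sP _ _ _ _); rewrite ?(leqW ln) ?mn//; exact: step.
  have S10 : S x (s l.+1 m).
    by apply: xP (Kp l.+1 m _ _) _ _ _ (sP _ _ _ _); rewrite ?ltnS ?ln ?(ltnW mn)//; exact: step.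
  have S11 : S x (s l.+1 m.+1).
    by apply: xP (Kp l.+1 m.+1 _ _) _ _ _ (sP _ _ _ _); rewrite ?ltnS ?ln ?mn//; exact: step.
  by rewrite !uP//; ring.
have rows l : (l <= n.+1)%N -> \sum_(0 <= m < n.+1) D (s 0 m) (s 0 m.+1) =
    \sum_(0 <= m < n.+1) D (s l m) (s l m.+1).
  by elim: l => [//|l IH] ln; rewrite IH ?(ltnW ln)// row.
have -> : \sum_(0 <= l < n.+1) D (t l) (t l.+1) = \sum_(0 <= m < n.+1) D (s 0 m) (s 0 m.+1).
  by [].
rewrite (rows n.+1)// big1// => m _; rewrite /s eqxx /=; exact: D_refl.
Qed.

End Monodromy.

Section Monodromy.
Variables (R : realType) (Omega : set (R * R)) (I : finType).
Variables (S : R * R -> I -> Prop) (D : I -> I -> R).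
Hypothesis S_near : forall x, Omega x -> \forall y \near x, forall i, S y i -> S x i.
Hypothesis S_ex : forall x, Omega x -> exists i, S x i.
Hypothesis D_anti : forall i j, D i j = - D j i.
Hypothesis D_pot : forall x, Omega x ->
  exists u : I -> R, forall i j, S x i -> S x j -> D i j = u i - u j.

(* s is the total difference along a path from x to y, whatever the refinement
   k * N of its subdivision; the common refinements make joined transitive. *)
Definition joined (x : R * R) (i : I) (y : R * R) (j : I) (s : R) : Prop :=
  exists (g : R -> R * R) (N : nat), [/\ ipath Omega x y g, (0 < N)%N &
    forall k, (0 < k)%N -> exists t : nat -> I,
      [/\ forall l, (l <= k * N)%N -> S (g (l%:R / (k * N)%:R)) (t l),
          t 0%N = i, t (k * N)%N = j &
          \sum_(0 <= l < k * N) D (t l) (t l.+1) = s]].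

Lemma joined_sym x i y j s : joined x i y j s -> joined y j x i (- s).
Proof.
move=> [g [N [gp N0 H]]]; exists (fun t => g (1 - t)), N; split => //.
  exact: ipath_rev.
move=> k k0; have [t [St t0 tn ts]] := H k k0.
have kN0 : (k * N)%:R != 0 :> R by rewrite pnatr_eq0 -lt0n muln_gt0 k0.
exists (fun l => t (k * N - l)%N); split => [l ln||//|].
- have -> : 1 - l%:R / (k * N)%:R = (k * N - l)%:R / (k * N)%:R :> R.
    by rewrite natrB// mulrBl divff.
  by apply: St; rewrite leq_subr.
- by rewrite subn0.
- by rewrite subnn.
- rewrite -ts big_nat_rev /= add0n -sumrN; apply: eq_big_nat => l /= ln.
  by rewrite subnSK// !subKn// 1?ltnW// D_anti.
Qed.

Lemma joined_trans x i y j z k s s' :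
  joined x i y j s -> joined y j z k s' -> joined x i z k (s + s').
Proof.
move=> [g1 [N1 [gp1 N10 H1]]] [g2 [N2 [gp2 N20 H2]]].
have [g [gp gl gr]] := ipath_cat gp1 gp2.
(* Each half of the path is then cut into a multiple of both [N1] and [N2] intervals. *)
exists g, (2 * (N1 * N2))%N; split => //; first by rewrite !muln_gt0 N10 N20.
move=> m m0.
have [|t1 [St1 t10 t1n t1s]] := H1 (m * N2)%N; first by rewrite muln_gt0 m0.
have [|t2 [St2 t20 t2n t2s]] := H2 (m * N1)%N; first by rewrite muln_gt0 m0.
set M := (m * (N1 * N2))%N.
have E1 : (m * N2 * N1 = M)%N by rewrite -mulnA (mulnC N2).
have E2 : (m * N1 * N2 = M)%N by rewrite -mulnA.
have E : (m * (2 * (N1 * N2)) = M + M)%N by rewrite mulnCA mul2n addnn.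
rewrite E; rewrite E1 in t1n t1s St1; rewrite E2 in t2n t2s St2.
have M0 : (0 < M)%N by rewrite !muln_gt0 m0 N10 N20.
have M0' : M%:R != 0 :> R by rewrite pnatr_eq0 -lt0n.
have M0'' : 0 < M%:R :> R by rewrite ltr0n.
(* At the junction [l = M] both selections give the piece [j], so it does not matter that [t1] is
   used there. *)
exists (fun l => if (l <= M)%N then t1 l else t2 (l - M)%N); split => [l lM||/=|].
- case: leqP => lM'.
    rewrite gl.
      have -> : 2 * (l%:R / (M + M)%:R) = l%:R / M%:R :> R.
        by rewrite natrD; field; rewrite M0' -natrD pnatr_eq0 -lt0n addn_gt0 M0.
      exact: St1.
    by rewrite natrD ler_pdivrMr ?addr_gt0//; move: lM'; rewrite -(ler_nat R); lra.
  rewrite gr.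
    have -> : 2 * (l%:R / (M + M)%:R) - 1 = (l - M)%:R / M%:R :> R.
      rewrite natrD natrB 1?ltnW//; field.
      by rewrite M0' -natrD pnatr_eq0 -lt0n addn_gt0 M0.
    by apply: St2; rewrite leq_subLR.
  by rewrite natrD ler_pdivlMr ?addr_gt0//; move: lM'; rewrite -(ltr_nat R); lra.
- by rewrite leq0n.
- by rewrite -[X in (_ <= X)%N]addn0 leq_add2l leqNgt M0 /= addnK.
- rewrite (@big_cat_nat _ _ _ M)//= ?leq_addr//; congr (_ + _).
    rewrite -t1s; apply: eq_big_nat => l /= lM.
    by rewrite lM ltnW.
  rewrite -{1}(add0n M) big_addn addnK -t2s; apply: eq_big_nat => l /= lM.
  rewrite -addSn [(l.+1 + M <= M)%N]leqNgt ltnS leq_addl /=.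
  case: ifP => [|_]; last by rewrite !addnK.
  rewrite -[X in (_ <= X)%N]add0n leq_add2r leqn0 => /eqP ->.
  by rewrite add0n t1n t20 addnK.
Qed.

Lemma joined_loop (Osc : simply_connected Omega) x i s : joined x i x i s -> s = 0.
Proof.
move=> [g [N [[gc gO g0 g1] N0 H]]].
have [_ /(_ g)[]] := Osc.
- by apply: continuous_subspaceT.
- by move=> _ [t _ <-].
- by rewrite g0// g1.
move=> h hP; have : null_homotopic Omega g by exists h.
move=> /(null_homotopic_sum0 S_near S_ex D_anti D_pot)[n _ nP].
(* The factor [n.+1] makes the subdivision finer than the threshold [n] of the homotopy, without
   changing the sum [s]. *)
have [t [St t0 tn ts]] := H n.+1 isT.
have kN : ((n.+1 * N).-1.+1 = n.+1 * N)%N by rewrite prednK// muln_gt0 N0.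
have := nP (n.+1 * N).-1; rewrite kN.
move=> /(_ _ t St); rewrite ts; apply; last by rewrite tn t0.
by rewrite /= -ltnS kN leq_pmulr.
Qed.

Lemma joined_const x y i : (exists g, ipath Omega x y g /\ forall t, S (g t) i) ->
  joined x i y i 0.
Proof.
move=> [g [gp gS]]; exists g, 1%N; split => // k k0; exists (fun=> i); split => //.
by rewrite big1// => l _; exact: D_refl.
Qed.

Lemma joined_point x i j : Omega x -> S x i -> S x j -> joined x i x j (D i j).
Proof.
move=> Ox Si Sj; exists (fun=> x), 1%N; split => //.
  by split => // t; exact: cvg_cst.
move=> k k0; exists (fun l => if l == 0%N then i else j); split => //.
- by move=> l _; case: ifP.
- by rewrite muln1 eqn0Ngt k0.
rewrite muln1 (sum_D_local D_pot (leq0n k) Ox)/= ?eqn0Ngt ?k0//.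
by move=> l _; case: ifP.
Qed.

(** A sum on one fine enough subdivision is unchanged by refinement: over a coarse interval all the
    pieces share a point, so the refined sum differs from the coarse term only by terms at the two
    ends of the interval, and these telescope. *)
Lemma joined_ex (Osc : simply_connected Omega) x y i j :
  Omega x -> Omega y -> S x i -> S y j -> exists s, joined x i y j s.
Proof.
move=> Ox Oy Si Sj; have [/(_ _ _ Ox Oy)[g0 [gc0 gO0 gx gy]] _] := Osc.
pose g := g0 \o @clamp R.
have gO t : Omega (g t) by apply: gO0; exists (clamp t) => //; exact: clamp_itv.
have gc : continuous g by exact: continuous_clamp_within.
have gp : ipath Omega x y g.
  split => // t t01; rewrite /g /=; first by rewrite clamp_le0.
  by rewrite clamp_ge1.
have Kc : compact (`[(0 : R), 1] `*` `[(0 : R), 1]).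
  by apply: compact_setX; exact: segment_compact.
(* The path is regarded as a map of the square that ignores the first coordinate, so that
   [uniform_subdivision] applies to it. *)
have Hc : {within `[(0 : R), 1] `*` `[(0 : R), 1], continuous (fun p : R * R => g p.2)}.
  apply: continuous_subspaceT => p.
  by apply: (@continuous_comp _ _ _ snd g); [exact: cvg_snd | exact: gc].
have HO : (fun p : R * R => g p.2) @` (`[(0 : R), 1] `*` `[(0 : R), 1]) `<=` Omega.
  by move=> _ [p _ <-]; exact: gO.
have [n _ /(_ n (leqnn n)) sub] := uniform_subdivision S_near Kc Hc HO.
set N := n.+1 in sub.
have N0 : N%:R != 0 :> R by rewrite pnatr_eq0.
have sel k (k0 : (0 < k)%N) : exists t : nat -> I,
    [/\ forall l, (l <= k)%N -> S (g (l%:R / k%:R)) (t l), t 0%N = i & t k = j].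
  apply: (selection S_ex) => //.
    by rewrite /g /= clamp_le0 ?gx.
  by rewrite /g /= clamp_ge1 ?gy.
have [t [St t0 tn]] := sel N isT.
exists (\sum_(0 <= l < N) D (t l) (t l.+1)), g, N; split => // k k0.
have [|r [Sr r0 rn]] := sel (k * N)%N; first by rewrite muln_gt0 k0.
exists r; split => //.
have k0' : k%:R != 0 :> R by rewrite pnatr_eq0 -lt0n.
have -> : \sum_(0 <= l < k * N) D (r l) (r l.+1) =
    \sum_(0 <= l < N) \sum_(l * k <= m < l.+1 * k) D (r m) (r m.+1).
  by rewrite mulnC big_nat_mul big_mkord.
apply/eqP; rewrite -subr_eq0 -sumrB.
rewrite (@eq_big_nat _ _ _ _ _ _
    (fun l => (- D (r (l.+1 * k)%N) (t l.+1)) - (- D (r (l * k)%N) (t l)))).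
  rewrite telescope_sumr// mul0n t0 r0 mulnC rn tn !(D_refl D_anti).
  by rewrite subrr.
move=> l /= lN.
have [|z [Oz zP]] := sub (0, l%:R / N%:R).
  by split => /=; [rewrite in_itv /= lexx ler01 | apply: grid_itv => //; exact: ltnW].
have Sz a b : (0 < b)%N -> (l * b <= a <= l.+1 * b)%N -> (a%:R / (b * N)%:R : R) \in `[0, 1]
   /\ `|l%:R / N%:R - a%:R / (b * N)%:R| <= N%:R^-1 :> R.
  move=> b0 /andP[la al]; split.
    apply: grid_itv; first by rewrite muln_gt0 b0.
    by rewrite (leq_trans al)// mulnC leq_pmul2l.
  have b0' : b%:R != 0 :> R by rewrite pnatr_eq0 -lt0n.
  have -> : l%:R / N%:R - a%:R / (b * N)%:R = - ((a%:R - l%:R * b%:R) / (b * N)%:R) :> R.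
    by rewrite natrM; field; rewrite N0 b0'.
  rewrite normrN ger0_norm; last first.
    by rewrite divr_ge0// subr_ge0 -natrM ler_nat.
  rewrite ler_pdivrMr ?ltr0n ?muln_gt0 ?b0// natrM mulrCA mulVf// mulr1.
  by move: al; rewrite mulSn -(ler_nat R) natrD natrM; lra.
have inz a b (b0 : (0 < b)%N) (lab : (l * b <= a <= l.+1 * b)%N) c :
    S (g (a%:R / (b * N)%:R)) c -> S z c.
  have [ab1 ab2] := Sz a b b0 lab.
  apply: (zP (0, a%:R / (b * N)%:R)) => //=; first by split => //=; rewrite in_itv /= lexx ler01.
  by rewrite subrr normr0 invr_ge0.
have zr a : (l * k <= a <= l.+1 * k)%N -> S z (r a).
  move=> la; apply: (inz a k) => //; apply: Sr.
  by case/andP: la => _ al; rewrite (leq_trans al)// mulnC leq_pmul2l.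
have zt a : (l <= a <= l.+1)%N -> S z (t a).
  move=> la; apply: (inz a 1%N) => //; rewrite ?muln1// mul1n; apply: St.
  by case/andP: la => _ al; rewrite (leq_trans al).
rewrite (sum_D_local D_pot _ Oz zr) ?leq_mul2r ?leqnSn ?orbT//.
have lkS : (l * k <= l.+1 * k)%N by rewrite leq_mul2r leqnSn orbT.
have S1 : S z (r (l * k)%N) by apply: zr; rewrite leqnn.
have S2 : S z (r (l.+1 * k)%N) by apply: zr; rewrite lkS leqnn.
have S3 : S z (t l) by apply: zt; rewrite leqnn leqnSn.
have S4 : S z (t l.+1) by apply: zt; rewrite leqnn leqnSn.
by have [u uP] := D_pot Oz; rewrite !uP//; ring.
Qed.

(** Loops have sum 0, so the total difference from a base piece to [i] is independent of the path.
    Paths inside one piece contribute 0; the base points [m] thus make this difference a number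
    attached to the whole piece. *)
Theorem monodromy (Osc : simply_connected Omega) :
  (forall i, exists m, [/\ Omega m, S m i & forall x, Omega x -> S x i ->
     exists g, ipath Omega m x g /\ forall t, S (g t) i]) ->
  exists U : I -> R, forall x i j, Omega x -> S x i -> S x j -> D i j = U i - U j.
Proof.
move=> star.
have [i0 _|noI] := pickP (fun _ : I => true); last first.
  by exists (fun=> 0) => x i; have := noI i.
have [m mP] : exists m : I -> R * R, forall i, [/\ Omega (m i), S (m i) i &
    forall x, Omega x -> S x i -> exists g, ipath Omega (m i) x g /\ forall t, S (g t) i].
  by exists (fun i => sval (cid (star i))) => i; case: cid.
have [u uP] : exists u : I -> R, forall i, joined (m i0) i0 (m i) i (u i).
  have ex i : exists s, joined (m i0) i0 (m i) i s.
    by have [? ? _] := mP i; have [? ? _] := mP i0; exact: joined_ex.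
  by exists (fun i => sval (cid (ex i))) => i; case: cid.
(* A path sum is the initial minus the final value of the potential, whence the sign. The loop used
   below runs through [m i], [x] and [m j] and gives [u i + D i j - u j = 0]. *)
exists (fun i => - u i) => x i j Ox Si Sj.
have ix l : S x l -> joined (m l) l x l 0.
  by move=> Sl; apply: joined_const; have [_ _] := mP l; apply.
have := joined_loop Osc (joined_trans (joined_trans (uP i) (ix _ Si))
  (joined_trans (joined_point Ox Si Sj)
     (joined_trans (joined_sym (ix _ Sj)) (joined_sym (uP j))))).
lra.
Qed.

End Monodromy.

(** * Geometry of the mesh *)

Section Cells.
Variables (R : realType) (V : finType) (pt : V -> R * R).
Variables (Th : {set {set V}}) (Omega : set (R * R)).
Hypothesis tri : triangulation pt Th Omega.
Implicit Types (T : cell Th) (a b c : V) (x y v : R * R).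

(** Twice the signed area of the triangle [a], [b], [x]: positive exactly on the left of the line
    oriented from [a] to [b]. *)
Definition lin a b x : R := cross (pt b - pt a) (x - pt a).

(* T has vertices a, b, c in counterclockwise order, i.e. T lies on the left of
   the oriented edge (a, b). *)
Definition tric T a b c : bool :=
  (val T == [set a; b; c]%SET) && (0 < lin a b (pt c)).

Lemma lin_affine a b x v t : lin a b (x + t *: v) =
  (1 - t) * lin a b x + t * lin a b (x + v).
Proof.
rewrite /lin /cross /= (_ : t *: v.1 = t * v.1)// (_ : t *: v.2 = t * v.2)//.
ring.
Qed.

Lemma lin_rot a b c : lin b c (pt a) = lin a b (pt c).
Proof. by rewrite /lin /cross /=; ring. Qed.

Lemma lin_flip a b x : lin b a x = - lin a b x.
Proof. by rewrite /lin /cross /=; ring. Qed.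

Lemma lin_l a b : lin a b (pt a) = 0.
Proof. by rewrite /lin /cross /=; ring. Qed.

Lemma lin_r a b : lin a b (pt b) = 0.
Proof. by rewrite /lin /cross /=; ring. Qed.

Lemma tric_rot T a b c : tric T a b c -> tric T b c a.
Proof.
by case/andP => /eqP E ab; rewrite /tric lin_rot ab E; apply/andP; split => //;
  apply/eqP/setP => x; rewrite !inE -orbA orbC.
Qed.

Lemma tric_gt0 T a b c : tric T a b c -> 0 < lin a b (pt c).
Proof. by case/andP. Qed.

Lemma tric_neq T a b c : tric T a b c -> [/\ a != b, b != c & c != a].
Proof.
move=> /tric_gt0; rewrite /lin /cross /= => h.
by split; apply/eqP => E; move: h; rewrite E ltNge; apply/negP; rewrite negbK; lra.
Qed.

Lemma tric_mem T a b c : tric T a b c -> [/\ a \in val T, b \in val T & c \in val T].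
Proof. by case/andP => /eqP ->; rewrite !inE !eqxx !orbT. Qed.

Lemma tric_inv T a b c d : tric T a b c -> d \in val T -> [\/ d = a, d = b | d = c].
Proof.
case/andP => /eqP -> _; rewrite !inE => /orP[/orP[]|] /eqP ->.
- exact: Or31.
- exact: Or32.
- exact: Or33.
Qed.

Lemma cell_enum T a b : a \in val T -> b \in val T -> a != b ->
  exists c, val T = [set a; b; c]%SET.
Proof.
move=> aT bT ab; have T3 := card_cell tri (valP T).
have abT : [set a; b]%SET \subset val T by apply/fintype.subsetP => x; rewrite !inE => /orP[]/eqP->.
have : #|val T :\: [set a; b]%SET| == 1%N.
  by rewrite cardsD (finset.setIidPr abT) T3 cards2 ab.
move=> /cards1P[c cE]; exists c; apply/setP => x.
have := erefl (x \in val T :\: [set a; b]%SET); rewrite {2}cE !inE.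
have [/eqP->|_ /=] := boolP (x == a); first by rewrite aT.
have [/eqP->|_ /=] := boolP (x == b); first by rewrite bT.
by [].
Qed.

Lemma tric_edge T a b : a \in val T -> b \in val T -> a != b ->
  exists c, tric T a b c \/ tric T b a c.
Proof.
move=> aT bT ab; have [c cE] := cell_enum aT bT ab; exists c.
have /(cell_nondegenerate tri) : [set a; b; c]%SET \in Th by rewrite -cE; exact: valP.
rewrite -/(lin a b (pt c)) neq_lt => /orP[h|h].
  right; rewrite /tric lin_flip oppr_gt0 h andbT cE.
  by apply/eqP/setP => x; rewrite !inE (orbC (x == a)).
by left; rewrite /tric cE eqxx.
Qed.

Lemma tric_at T a : a \in val T -> exists b c, tric T a b c.
Proof.
move=> aT; have /card_gt0P[b] : (0 < #|val T :\ a|)%N.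
  by have := card_cell tri (valP T); rewrite (cardsD1 a) aT add1n => -[->].
rewrite !inE => /andP[ba bT].
have [|c [|/tric_rot]] := @tric_edge T a b aT bT; first by rewrite eq_sym.
  by exists b, c.
by exists c, b.
Qed.

Lemma tric_ex T : exists a b c, tric T a b c.
Proof.
have /card_gt0P[a /tric_at] : (0 < #|val T|)%N by rewrite (card_cell tri (valP T)).
by exists a.
Qed.

Lemma tric_third T a b c d : tric T a b c -> tric T a b d -> c = d.
Proof.
move=> t1 t2; have [ab bc ca] := tric_neq t1; have [_ bd da] := tric_neq t2.
have [_ _ /(tric_inv t1)[E|E|//]] := tric_mem t2.
  by rewrite E eqxx in da.
by rewrite E eqxx in bd.
Qed.

Lemma tric_noflip T a b c d : tric T a b c -> tric T b a d -> False.
Proof.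
move=> t1 t2; have [ab bc ca] := tric_neq t1; have [_ bd da] := tric_neq t2.
have [_ _ /(tric_inv t1)[E|E|E]] := tric_mem t2.
- by rewrite E eqxx in bd.
- by rewrite E eqxx in da.
have := tric_gt0 t1; have := tric_gt0 t2; rewrite E lin_flip; lra.
Qed.

Lemma tric_uniq T a b c b' c' : tric T a b c -> tric T a b' c' -> b = b' /\ c = c'.
Proof.
move=> t1 t2; suff E : b = b' by split=> //; apply: tric_third t1 _; rewrite E.
have [_ /(tric_inv t1)[E|//|E] _] := tric_mem t2.
  by have [] := tric_neq t2; rewrite E eqxx.
by subst b'; have := tric_noflip (tric_rot (tric_rot t1)) t2.
Qed.

Lemma big_tric (Z : zmodType) T (F : V -> Z) a b c : tric T a b c ->
  \sum_(d in val T) F d = F a + F b + F c.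
Proof.
move=> t; have [ab bc ca] := tric_neq t; case/andP: t => /eqP -> _.
rewrite finset.setUC big_setU1 ?inE ?(negPf ca) 1?eq_sym ?(negPf bc)//=.
by rewrite big_setU1 ?inE//= big_set1 addrC.
Qed.

(** Barycentric coordinate. The sum has exactly one term when [a] is a vertex of [T] and none
    otherwise, which makes the coordinate total in [a], with value 0 off [T]. *)
Definition bary T a x : R :=
  \sum_(bc | tric T a bc.1 bc.2) lin bc.1 bc.2 x / lin bc.1 bc.2 (pt a).

Lemma baryE T a b c x : tric T a b c -> bary T a x = lin b c x / lin b c (pt a).
Proof.
move=> t; rewrite /bary (big_pred1 (b, c))// => -[b' c'] /=.
apply/idP/eqP => [t'|[-> ->]//].
by have [-> ->] := tric_uniq t t'.
Qed.

Lemma bary_out T a x : a \notin val T -> bary T a x = 0.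
Proof.
by move=> aT; rewrite /bary big_pred0// => -[b c]; apply/negP => /tric_mem[]; rewrite (negPf aT).
Qed.

Lemma bary_affine T a x v t : bary T a (x + t *: v) =
  (1 - t) * bary T a x + t * bary T a (x + v).
Proof.
rewrite /bary !mulr_sumr -big_split /=; apply: eq_bigr => -[b c] _ /=.
by rewrite !mulrA -mulrDl; congr (_ / _); exact: lin_affine.
Qed.

#[local] Opaque bary.

Lemma bary_seg T a x y t : bary T a (seg_point x y t) =
  (1 - t) * bary T a x + t * bary T a y.
Proof.
have -> : seg_point x y t = x + t *: (y - x).
  by rewrite /seg_point scalerBl scale1r scalerBr -addrA (addrC (- _)) addrA.
by rewrite bary_affine (addrC x (y - x)) subrK.
Qed.

Lemma bary_sum1 T x : \sum_(a in val T) bary T a x = 1.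
Proof.
have [a [b [c t]]] := tric_ex T; rewrite (big_tric _ t).
have n0 : lin a b (pt c) != 0 by rewrite gt_eqF// (tric_gt0 t).
have -> := baryE x t; have -> := baryE x (tric_rot t).
have -> := baryE x (tric_rot (tric_rot t)).
have -> : lin c a (pt b) = lin a b (pt c) by rewrite -lin_rot.
have -> : lin b c (pt a) = lin a b (pt c) by exact: lin_rot.
rewrite -!mulrDl; apply: (canLR (mulfK n0)); rewrite mul1r.
by rewrite /lin /cross /=; ring.
Qed.

End Cells.

#[local] Opaque bary.

Section Cells.
Variables (R : realType) (V : finType) (pt : V -> R * R).
Variables (Th : {set {set V}}) (Omega : set (R * R)).
Hypothesis tri : triangulation pt Th Omega.
Implicit Types (T : cell Th) (a b c : V) (x y v : R * R).
Notation tric := (tric pt).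
Notation lin := (lin pt).
Notation bary := (bary pt).
Notation hull := (hull pt).

Lemma bary_sumx T x : \sum_(a in val T) bary T a x *: pt a = x.
Proof.
have [a [b [c t]]] := tric_ex tri T; rewrite (big_tric _ t).
have n0 : lin a b (pt c) != 0 by rewrite gt_eqF// (tric_gt0 t).
have -> := baryE x t; have -> := baryE x (tric_rot t).
have -> := baryE x (tric_rot (tric_rot t)).
have -> : lin c a (pt b) = lin a b (pt c) by rewrite -lin_rot.
have -> : lin b c (pt a) = lin a b (pt c) by exact: lin_rot.
move: n0; rewrite /lin /cross /= => n0.
case: x => x1 x2; apply/eqP; rewrite xpair_eqE; apply/andP.
by split; apply/eqP; rewrite /= /GRing.scale /=; field; exact: n0.
Qed.

Lemma bary_uniq T (l : V -> R) x : \sum_(a in val T) l a = 1 ->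
  \sum_(a in val T) l a *: pt a = x -> forall a, a \in val T -> l a = bary T a x.
Proof.
move=> l1 lx a /(tric_at tri)[b [c t]].
have n0 : lin b c (pt a) != 0 by rewrite lin_rot gt_eqF// (tric_gt0 t).
rewrite (baryE _ t); apply: (canRL (mulfK n0)).
move: l1 lx; rewrite !(big_tric _ t) => l1 <-.
have -> : l a = 1 - l b - l c by rewrite -l1; ring.
have e (r : R) (v : R * R) : (r *: v.1 = r * v.1) * (r *: v.2 = r * v.2) by [].
rewrite /lin /cross /= !e; ring.
Qed.

Lemma hullP T x : hull (val T) x <-> forall a, 0 <= bary T a x.
Proof.
split => [[l [l0 l1 lx]] a|h].
  have [aT|aT] := boolP (a \in val T); last by rewrite bary_out.
  by rewrite -(bary_uniq l1 (esym lx) aT) l0.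
exists (bary T ^~ x); split; [by move=> a _|exact: (bary_sum1 tri)|].
by rewrite bary_sumx.
Qed.

Lemma hull_support T (A : {set V}) x : hull (val T) x ->
  (forall a, 0 < bary T a x -> a \in A) -> hull A x.
Proof.
move=> /hullP Tx xA.
have z a : a \notin A -> bary T a x = 0.
  by move=> aA; apply/eqP; move: (Tx a); rewrite le_eqVlt => /predU1P[->//|/xA]; rewrite (negPf aA).
have sw (Z : nmodType) (F : V -> Z) : (forall a, bary T a x = 0 -> F a = 0) ->
    \sum_(a in A) F a = \sum_(a in val T) F a.
  move=> F0; rewrite big_mkcond [RHS]big_mkcond; apply: eq_bigr => a _.
  have [aA|aA] := boolP (a \in A); have [aT|aT] := boolP (a \in val T) => //.
    by rewrite F0// bary_out.
  by rewrite F0// z.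
exists (bary T ^~ x); split; first by move=> a _.
  by rewrite sw// (bary_sum1 tri).
by rewrite sw ?bary_sumx// => a ->; rewrite scale0r.
Qed.

Lemma hull_inter T T' x : hull (val T) x -> hull (val T') x ->
  hull (val T :&: val T')%SET x.
Proof. by move=> h h'; rewrite -(cell_conforming tri (valP T) (valP T')). Qed.

(** By conformity [x] is a convex combination of the common vertices; its coefficients, extended by
    0, are the barycentric coordinates in both cells. *)
Lemma bary_eq T T' x : hull (val T) x -> hull (val T') x ->
  forall a, bary T a x = bary T' a x.
Proof.
move=> h h' a; have [l [l0 l1 lx]] := hull_inter h h'.
pose m a := if a \in (val T :&: val T')%SET then l a else 0.
have mE T1 : (val T :&: val T')%SET \subset val T1 -> forall a, bary T1 a x = m a.
  move=> /fintype.subsetP sub b.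
  have [bT|bT] := boolP (b \in val T1); last first.
    by rewrite bary_out// /m; case: ifP => // /sub; rewrite (negPf bT).
  have sw (Z : nmodType) (F : V -> Z) : (forall b, b \notin (val T :&: val T')%SET -> F b = 0) ->
    \sum_(a in val T1) F a = \sum_(a in (val T :&: val T')%SET) F a.
    move=> F0; rewrite big_mkcond [RHS]big_mkcond; apply: eq_bigr => c _ /=.
    have [cT|cT] := boolP (c \in (val T :&: val T')%SET); first by rewrite (sub _ cT).
    by rewrite F0// if_same.
  rewrite -(@bary_uniq T1 m x)//.
    rewrite sw => [|c /negPf cT]; last by rewrite /m cT.
    by rewrite -l1; apply: eq_bigr => c cT; rewrite /m cT.
  rewrite sw => [|c /negPf cT]; last by rewrite /m cT scale0r.
  by rewrite lx; apply: eq_bigr => c cT; rewrite /m cT.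
by rewrite (mE T) ?(mE T') ?finset.subsetIl ?finset.subsetIr.
Qed.

(** The vertices spanning the face that carries [x] belong to every cell through [x]. Incidences are
    deduced from positive coordinates in this way throughout. *)
Lemma conform_mem T T' x a : hull (val T) x -> hull (val T') x ->
  0 < bary T a x -> a \in val T'.
Proof.
move=> h h'; rewrite (bary_eq h h'); apply: contraLR => aT.
by rewrite bary_out// ltxx.
Qed.

Lemma cell_sub_eq T T' : (forall a, a \in val T -> a \in val T') -> T = T'.
Proof.
move=> sub; apply/val_inj/eqP; rewrite eqEcard (card_cell tri (valP T)).
by rewrite (card_cell tri (valP T')) leqnn andbT; apply/fintype.subsetP.
Qed.

Lemma interior_cell_eq T T' x : (forall a, a \in val T -> 0 < bary T a x) ->
  hull (val T') x -> T = T'.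
Proof.
move=> Tx T'x; apply: cell_sub_eq => a aT; apply: conform_mem T'x (Tx _ aT).
apply/hullP => b; have [/Tx/ltW//|bT] := boolP (b \in val T).
by rewrite bary_out.
Qed.

Lemma bary_pt T a : a \in val T -> bary T a (pt a) = 1.
Proof.
move=> /(tric_at tri)[b [c t]]; rewrite (baryE _ t) divff//.
by rewrite lin_rot gt_eqF// (tric_gt0 t).
Qed.

Lemma bary_pt0 T a b : a \in val T -> b \in val T -> a != b -> bary T b (pt a) = 0.
Proof.
move=> aT bT ab; have [c [t|t]] := tric_edge tri aT bT ab.
  by rewrite (baryE _ (tric_rot t)) lin_r mul0r.
by rewrite (baryE _ t) lin_l mul0r.
Qed.

Lemma hull_pt T a : a \in val T -> hull (val T) (pt a).
Proof.
move=> aT; apply/hullP => b.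
have [bT|bT] := boolP (b \in val T); last by rewrite bary_out.
by have [<-|ab] := eqVneq a b; [rewrite bary_pt|rewrite bary_pt0].
Qed.

Lemma hull_seg T x y t : t \in `[0, 1] -> hull (val T) x -> hull (val T) y ->
  hull (val T) (seg_point x y t).
Proof.
rewrite in_itv /= => /andP[t0 t1] /hullP hx /hullP hy; apply/hullP => a.
by rewrite bary_seg addr_ge0// mulr_ge0// subr_ge0.
Qed.

Lemma hull_pt_mem T a : hull (val T) (pt a) -> a \in val T.
Proof.
move=> h; have [T' T'h aT'] := vertex_in_cell tri a.
have := @bary_pt (exist _ T' T'h) a aT'; move=> ba.
by apply: (@conform_mem (exist _ T' T'h) T (pt a)) => //; [exact: hull_pt|rewrite ba].
Qed.

Lemma continuous_lin a b : continuous (lin a b).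
Proof.
move=> x; rewrite /lin /cross.
have c1 : (fun y : R * R => (y - pt a).1) y @[y --> x] --> (x - pt a).1.
  by apply: cvgB; [exact: cvg_fst|exact: cvg_cst].
have c2 : (fun y : R * R => (y - pt a).2) y @[y --> x] --> (x - pt a).2.
  by apply: cvgB; [exact: cvg_snd|exact: cvg_cst].
by apply: cvgB; apply: cvgM => //; exact: cvg_cst.
Qed.

Lemma continuous_bary T a : continuous (bary T a).
Proof.
move=> x; have [aT|aT] := boolP (a \in val T); last first.
  rewrite (_ : bary T a = fun=> 0); first exact: cvg_cst.
  by apply/funext => y; rewrite bary_out.
have [b [c t]] := tric_at tri aT.
rewrite (_ : bary T a = fun y => lin b c y / lin b c (pt a)); last first.
  by apply/funext => y; rewrite (baryE _ t).
by apply: cvgM; [exact: continuous_lin|exact: cvg_cst].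
Qed.

Lemma bary_gt0_near T a x : 0 < bary T a x -> \forall y \near x, 0 < bary T a y.
Proof. by move=> h; exact: (@continuous_bary T a x _ (lt_nbhsr h)). Qed.

(** There are finitely many cells, and a negative barycentric coordinate stays negative nearby. *)
Lemma hull_near x : \forall y \near x, forall T, hull (val T) y -> hull (val T) x.
Proof.
apply: (@filter_forall _ _ (fun T y => hull (val T) y -> hull (val T) x) (nbhs x)) => T.
have [h|] := pselect (hull (val T) x); first by near=> y.
move=> /hullP /existsNP[a /negP]; rewrite -ltNge => ax.
have : \forall y \near x, bary T a y < 0.
  exact: (@continuous_bary T a x _ (lt_nbhsl ax)).
by apply: filterS => y ay /hullP /(_ a); rewrite leNgt ay.
Unshelve. all: by end_near. Qed.

Lemma near_ray (P : set (R * R)) x v : (\forall y \near x, P y) ->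
  \forall e \near 0^'+, P (x + e *: v).
Proof.
move=> xP.
have c : (x + e *: v) @[e --> (0 : R)] --> x.
  by have := @continuous_affine R x v 0; rewrite /continuous_at scale0r addr0.
have c' : (x + e *: v) @[e --> (0 : R)^'+] --> x by exact: cvg_at_right_filter.
exact: c' _ xP.
Qed.

Lemma germ T a x v : 0 <= bary T a x ->
  (bary T a x = 0 -> 0 < bary T a (x + v)) ->
  \forall e \near 0^'+, 0 < bary T a (x + e *: v).
Proof.
rewrite le_eqVlt => /predU1P[/esym h0 /(_ h0) h|h _].
  have := nbhs_right_gt (0 : R); apply: filterS => e e0.
  by rewrite bary_affine h0 mulr0 add0r mulr_gt0.
exact: (near_ray v (bary_gt0_near h)).
Qed.

End Cells.

Section Generic.
Variable R : realType.

Lemma right_ex (P Q S : R -> Prop) :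
  (\forall e \near 0^'+, P e) -> (\forall e \near 0^'+, Q e) ->
  (\forall e \near 0^'+, S e) -> exists e, [/\ 0 < e, P e, Q e & S e].
Proof.
move=> p q s; have : \forall e \near 0^'+, [/\ 0 < e, P e, Q e & S e].
  near=> e; split; near: e => //; exact: nbhs_right_gt.
by move=> /filter_ex.
Unshelve. all: by end_near. Qed.

Lemma affine_neq0_near (k0 k1 : R) : ~ (k0 = 0 /\ k1 = 0) ->
  \forall s \near 0^'+, k0 + s * k1 != 0.
Proof.
move=> k01; have [k00|k00] := eqVneq k0 0.
  have := nbhs_right_gt (0 : R); apply: filterS => s s0.
  rewrite k00 add0r mulf_neq0//; first by rewrite gt_eqF.
  by apply/eqP => k10; apply: k01.
have c : (k0 + s * k1) @[s --> (0 : R)^'+] --> k0.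
  apply: cvg_at_right_filter.
  have := @continuous_scale_add R k1 k0 0; rewrite /continuous_at mulr0 add0r.
  by rewrite (_ : (fun t => k1 * t + k0) = fun s => k0 + s * k1)//; apply/funext => t; ring.
have nk : \forall y \near k0, y != 0.
  by apply: open_nbhs_nbhs; split => //; exact: open_neq.
exact: c _ nk.
Qed.

Lemma cross_affine (u v x : R * R) s : cross (u + s *: v) x = cross u x + s * cross v x.
Proof.
by rewrite /cross /= (_ : s *: v.1 = s * v.1)// (_ : s *: v.2 = s * v.2)//; ring.
Qed.

(* With [u = pt b - pt a] and [v = pt c - pt a] consecutive counterclockwise,
   minus the cotangent of the angle from [d] increases from [u] to [v]. *)
Lemma cotangent_lt (d u v : R * R) : 0 < cross u v -> 0 < cross d u * cross d v ->
  - (dot d u / cross d u) < - (dot d v / cross d v).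
Proof.
move=> uv duv.
have u0 : cross d u != 0 by apply/eqP => e; rewrite e mul0r ltxx in duv.
have v0 : cross d v != 0 by apply/eqP => e; rewrite e mulr0 ltxx in duv.
rewrite -subr_gt0.
have -> : - (dot d v / cross d v) - - (dot d u / cross d u) =
    dot d d * cross u v / (cross d u * cross d v).
  move: u0 v0; rewrite /dot /cross => u0 v0; field; by rewrite u0 v0.
rewrite divr_gt0// mulr_gt0// /dot.
have : d.1 != 0 \/ d.2 != 0.
  have [d1|] := eqVneq d.1 0; last by left.
  have [d2|] := eqVneq d.2 0; last by right.
  by move: u0; rewrite /cross d1 d2 !mul0r subrr eqxx.
by case=> d0; [rewrite ltr_pwDl// -?expr2 ?sqr_ge0// lt_neqAle sqr_ge0 eq_sym expf_neq0
  |rewrite ltr_wpDl// -?expr2 ?sqr_ge0// lt_neqAle sqr_ge0 eq_sym expf_neq0].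
Qed.

End Generic.

(** * Neighbouring cells and the cells around a vertex *)

Section Cells.
Variables (R : realType) (V : finType) (pt : V -> R * R).
Variables (Th : {set {set V}}) (Omega : set (R * R)).
Hypothesis tri : triangulation pt Th Omega.
Hypotheses (Oopen : open Omega) (Oreg : regopen Omega).
Implicit Types (T : cell Th) (a b c : V) (x y v : R * R).
Notation tric := (tric pt).
Notation lin := (lin pt).
Notation bary := (bary pt).
Notation hull := (hull pt).

Lemma hull_closure T x : hull (val T) x -> closure Omega x.
Proof. by move=> h; rewrite -(cells_cover tri); exists (val T) => //; exact: valP. Qed.

Lemma cell_cover x : Omega x -> exists T, hull (val T) x.
Proof.
move=> /subset_closure; rewrite -(cells_cover tri) => -[T Th_T h].
by exists (exist _ T Th_T).
Qed.

Lemma positive_bary_near T x : (forall a, a \in val T -> 0 < bary T a x) ->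
  \forall y \near x, forall a, a \in val T -> 0 < bary T a y.
Proof.
move=> h; apply: (@filter_forall _ _ (fun a y => a \in val T -> 0 < bary T a y) (nbhs x)) => a.
have [aT|aT] := boolP (a \in val T); last by near=> y.
have := bary_gt0_near tri (h _ aT); exact: filterS.
Unshelve. all: by end_near. Qed.

Lemma hull_positive T x : (forall a, a \in val T -> 0 < bary T a x) -> hull (val T) x.
Proof.
move=> h; apply/(hullP tri) => a.
by have [/h/ltW//|aT] := boolP (a \in val T); rewrite bary_out.
Qed.

Lemma interior_hullP T x : (hull (val T))° x <-> forall a, a \in val T -> 0 < bary T a x.
Proof.
split => [h a aT|h]; last first.
  by have := positive_bary_near h; apply: filterS => y; exact: hull_positive.
have hx : hull (val T) x by exact: nbhs_singleton h.
rewrite lt_neqAle ((hullP tri _ _).1 hx a) andbT eq_sym; apply/negP => /eqP a0.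
(* If the coordinate of [a] vanished at [x], moving away from the vertex [a] would make it negative
   at once. *)
have := near_ray (x - pt a) h.
move=> g; have [e [e0 he _ _]] := right_ex g g g.
have := (hullP tri T _).1 he a; rewrite bary_affine a0.
have -> : x + (x - pt a) = seg_point (pt a) x 2.
  rewrite /seg_point (_ : 1 - 2 = -1 :> R); last by ring.
  by rewrite scaleN1r scaler_nat mulr2n addrA addrC.
rewrite bary_seg a0 (bary_pt tri aT); lra.
Qed.

(** A cell is only known to lie in the closure of [Omega]; regular openness puts its interior into
    [Omega]. *)
Lemma positive_bary_Omega T x : (forall a, a \in val T -> 0 < bary T a x) -> Omega x.
Proof.
have O : (closure Omega)° = Omega := Oreg.
move=> /positive_bary_near h; rewrite -O.
by apply: filterS h => y /hull_positive; exact: hull_closure.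
Qed.

Lemma not_frontier T x : hull (val T) x -> ~ frontier Omega x -> Omega x.
Proof.
move=> /hull_closure cx fx; apply: contrapT => nO; apply: fx; split => //.
by rewrite (interior_id _).1.
Qed.

Lemma Omega_not_frontier x : Omega x -> ~ frontier Omega x.
Proof. by move=> Ox [_]; apply; rewrite (interior_id _).1. Qed.

Lemma germ_cell T x v : hull (val T) x ->
  (forall a, a \in val T -> bary T a x = 0 -> 0 < bary T a (x + v)) ->
  \forall e \near 0^'+, forall a, a \in val T -> 0 < bary T a (x + e *: v).
Proof.
move=> /(hullP tri) h hv.
apply: (@filter_forall _ _ (fun a e => a \in val T -> 0 < bary T a (x + e *: v)) (0^'+)) => a.
have [aT|aT] := boolP (a \in val T); last by near=> y.
have := germ tri (h a) (hv _ aT); exact: filterS.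
Unshelve. all: by end_near. Qed.

(** Starting at the midpoint of the edge towards [c], one enters the interior of both cells, and
    cells with a common interior point coincide. *)
Lemma tric_same_side T T' a b c c' : tric T a b c -> tric T' a b c' -> T = T'.
Proof.
move=> t t'; pose m := seg_point (pt a) (pt b) (1/2).
have [aT bT cT] := tric_mem t; have [aT' bT' cT'] := tric_mem t'.
have [ab bc ca] := tric_neq t; have [_ bc' ca'] := tric_neq t'.
have ht : (1/2 : R) \in `[0, 1] by rewrite in_itv /=; apply/andP; split; lra.
have h : hull (val T) m by apply: (hull_seg tri) => //; exact: (hull_pt tri).
have h' : hull (val T') m by apply: (hull_seg tri) => //; exact: (hull_pt tri).
pose v := pt c - m.
have mv : m + v = pt c by rewrite addrC subrK.
have b1 T1 : a \in val T1 -> b \in val T1 -> bary T1 a m = 1/2.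
  move=> a1 b1; rewrite bary_seg (bary_pt tri a1) (bary_pt0 tri b1 a1) 1?eq_sym//; lra.
have b2 T1 : a \in val T1 -> b \in val T1 -> bary T1 b m = 1/2.
  move=> a1 b2; rewrite bary_seg (bary_pt tri b2) (bary_pt0 tri a1 b2)//; lra.
have g : \forall e \near 0^'+, forall a, a \in val T -> 0 < bary T a (m + e *: v).
  apply: germ_cell => // d /(tric_inv t)[]->.
  - by rewrite (b1 _ aT bT); lra.
  - by rewrite (b2 _ aT bT); lra.
  - by rewrite mv (bary_pt tri cT) => _; exact: ltr01.
have g' : \forall e \near 0^'+, forall a, a \in val T' -> 0 < bary T' a (m + e *: v).
  apply: germ_cell => // d /(tric_inv t')[]->.
  - by rewrite (b1 _ aT' bT'); lra.
  - by rewrite (b2 _ aT' bT'); lra.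
  - have -> := baryE (m + v) (tric_rot (tric_rot t')).
    by rewrite mv divr_gt0 ?(tric_gt0 t)// (tric_gt0 t').
have [e [_ pe pe' _]] := right_ex g g' g'.
exact: (interior_cell_eq tri pe (hull_positive pe')).
Qed.

(* A point of Omega just beyond the edge belongs to a cell, which is the other
   cell of the edge. *)
Lemma edge_opposite T a b c : tric T a b c ->
  ~ (segment (pt a) (pt b) `<=` frontier Omega) -> exists T' c', tric T' b a c'.
Proof.
move=> t /existsNP[x /not_implyP[[s s01 sx] nf]].
have [aT bT cT] := tric_mem t; have [ab bc ca] := tric_neq t.
have hab r : r \in `[0, 1] -> hull (val T) (seg_point (pt a) (pt b) r).
  by move=> r01; apply: (hull_seg tri) => //; exact: (hull_pt tri).
have hx : hull (val T) x by rewrite -sx; exact: hab.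
have Ox : Omega x := not_frontier hx nf.
(* [x] may be an end of the edge. A small move towards the midpoint stays in [Omega] and makes the
   coordinates of both [a] and [b] positive. *)
pose m := seg_point (pt a) (pt b) (1/2); pose v := m - x.
have mv : x + v = m by rewrite addrC subrK.
have ba : bary T a m = 1/2.
  rewrite bary_seg (bary_pt tri aT) (bary_pt0 tri bT aT) 1?eq_sym//; lra.
have bb : bary T b m = 1/2.
  rewrite bary_seg (bary_pt tri bT) (bary_pt0 tri aT bT)//; lra.
have bc0 r : bary T c (seg_point (pt a) (pt b) r) = 0.
  rewrite bary_seg (bary_pt0 tri bT cT)// (bary_pt0 tri aT cT) 1?eq_sym//; lra.
have ga : \forall e \near 0^'+, 0 < bary T a (x + e *: v).
  by apply: (germ tri) => [|]; [exact: (hullP tri _ _).1|rewrite mv ba => _; lra].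
have gb : \forall e \near 0^'+, 0 < bary T b (x + e *: v).
  by apply: (germ tri) => [|]; [exact: (hullP tri _ _).1|rewrite mv bb => _; lra].
have gO : \forall e \near 0^'+, Omega (x + e *: v).
  have nO : nbhs x Omega by exact: open_nbhs_nbhs.
  exact: (near_ray v nO).
have [e [_ pa pb pO]] := right_ex ga gb gO.
set x' := x + e *: v in pa pb pO.
have pc : bary T c x' = 0 by rewrite bary_affine mv -sx !bc0; lra.
have hx' : hull (val T) x'.
  apply/(hullP tri) => d; have [dT|dT] := boolP (d \in val T); last by rewrite bary_out.
  by case: (tric_inv t dT) => ->; rewrite ?pc// ltW.
(* Moving away from [c] leaves [T] through the edge. A cell met there contains [x'], hence [a] and
   [b]; on the left of the edge it could only be [T]. *)
pose v' := x' - pt c.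
have gO' : \forall e \near 0^'+, Omega (x' + e *: v').
  have nO : nbhs x' Omega by exact: open_nbhs_nbhs.
  exact: (near_ray v' nO).
have gS : \forall e \near 0^'+, forall T, hull (val T) (x' + e *: v') -> hull (val T) x'.
  exact: (near_ray v' (hull_near tri x')).
have [e' [e'0 qO qS _]] := right_ex gO' gS gS.
have [T' hT'] := cell_cover qO.
have h' := qS _ hT'.
have aT' : a \in val T' by exact: (conform_mem tri hx' h' pa).
have bT' : b \in val T' by exact: (conform_mem tri hx' h' pb).
have [c' [t'|t']] := tric_edge tri aT' bT' ab; last by exists T', c'.
have TT' := tric_same_side t t'; subst T'.
have := (hullP tri T _).1 hT' c; rewrite bary_affine pc.
have -> : x' + v' = seg_point (pt c) x' 2.
  rewrite /v' /seg_point (_ : 1 - 2 = -1 :> R); last by ring.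
  by rewrite scaleN1r scaler_nat mulr2n addrA addrC.
rewrite bary_seg pc (bary_pt tri cT); lra.
Qed.

Lemma interior_edge_sides a b : interior_edge pt Th Omega a b ->
  (exists T c, tric T a b c) /\ (exists T c, tric T b a c).
Proof.
move=> [[ab [T /andP[aT bT]]] nf].
have [c [t|t]] := tric_edge tri aT bT ab.
  by split; [exists T, c|exact: edge_opposite t nf].
split; last by exists T, c.
apply: edge_opposite t _ => h; apply: nf => _ [s s01 <-].
apply: h; exists (1 - s).
  by move: s01; rewrite /= !in_itv /= => /andP[s0 s1]; apply/andP; split; lra.
by rewrite /seg_point subKr addrC.
Qed.

Lemma interior_edge_vertex a T b : Omega (pt a) -> a \in val T -> b \in val T ->
  a != b -> interior_edge pt Th Omega a b.
Proof.
move=> Oa aT bT ab; split; first by split => //; exists T; rewrite aT bT.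
move=> /(_ (pt a))[|_]; last by apply; rewrite (interior_id _).1.
exists 0; first by rewrite /= in_itv /= lexx ler01.
by rewrite /seg_point subr0 scale1r scale0r addr0.
Qed.

(* Choose a generic direction d in the cone of the target cell and turn around
   a within Z: the angle from d increases at each step, so the cone of some cell
   visited contains d, and this cell overlaps the target cell. *)
Lemma link_connected a (Z : V -> Prop) : Omega (pt a) ->
  (exists T b c, tric T a b c /\ Z b) ->
  (forall T b c, tric T a b c -> Z b -> Z c) ->
  forall T b c, tric T a b c -> Z b.
Proof.
move=> Oa [T1 [b1 [c1 [t1 Zb1]]]] Znext T0 b0 c0 t0.
pose w b := pt b - pt a.
have linw b c : lin a b (pt c) = cross (w b) (w c) by [].
pose Q b := `[< Z b /\ exists T c, tric T a b c >].
have Qnext T b c : tric T a b c -> Q b -> Q c.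
  move=> t /asboolP[Zb _]; apply/asboolP; split; first exact: Znext t Zb.
  have [aT bT cT] := tric_mem t; have [_ _ ca] := tric_neq t.
  rewrite eq_sym in ca.
  by have [] := interior_edge_sides (interior_edge_vertex Oa aT cT ca).
(* Every positive [s] puts [d] into the open cone of the target cell; a small one also avoids the
   finitely many directions of edges at [a]. *)
have [s [s0 sgen]] : exists s : R, 0 < s /\
    forall b T c, tric T a b c -> cross (w b0 + s *: w c0) (w b) != 0.
  have e1 b (s : R) : cross (w b0 + s *: w c0) (w b) = cross (w b0) (w b) + s * cross (w c0) (w b).
    exact: cross_affine.
  have g : \forall s \near 0^'+, forall b,
      (exists T c, tric T a b c) -> cross (w b0 + s *: w c0) (w b) != 0.
    apply: (@filter_forall _ _ (fun b s => (exists T c, tric T a b c) ->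
      cross (w b0 + s *: w c0) (w b) != 0) (0^'+)) => b.
    have [[T [c t]]|nt] := pselect (exists T c, tric T a b c); last by near=> s.
    have : ~ (cross (w b0) (w b) = 0 /\ cross (w c0) (w b) = 0).
      move=> [k0 k1]; have := tric_gt0 t; have := tric_gt0 t0; rewrite !linw => D0.
      rewrite lt_neqAle eq_sym => /andP[/eqP bc0 _]; apply: bc0.
      have : cross (w b0) (w c0) * cross (w b) (w c) = 0.
        have -> : cross (w b0) (w c0) * cross (w b) (w c) =
           cross (w b0) (w b) * cross (w c0) (w c) - cross (w c0) (w b) * cross (w b0) (w c).
          by rewrite /cross; ring.
        by rewrite k0 k1; ring.
      by move=> /eqP; rewrite mulf_eq0 (gt_eqF D0) => /eqP.
    move=> /affine_neq0_near; apply: filterS => s sn _.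
    by rewrite e1.
  have [s [s0 sP _ _]] := right_ex g g g.
  by exists s; split => // b T c t; apply: sP; exists T, c.
set d := w b0 + s *: w c0 in sgen.
have Qgen b : Q b -> cross d (w b) != 0.
  by move=> /asboolP[_ [T [c t]]]; exact: sgen t.
pose kappa b : R := - (dot d (w b) / cross d (w b)).
have lower_or_upper b : Q b -> cross d (w b) < 0 \/ 0 < cross d (w b).
  by move=> /Qgen; rewrite neq_lt => /orP[]; [left|right].
have Qb1 : Q b1 by apply/asboolP; split => //; exists T1, c1.
(* If some visited direction is clockwise from [d], take one with the largest [kappa]: its successor
   cannot be clockwise from [d] as well, so [d] lies between the two. If there is none, the
   successor of a maximum of [kappa] over all of [Q] would exceed that maximum. *)
have [b [Qb [T [c [t [dc bd]]]]]] : exists b, Q b /\ exists T c,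
    [/\ tric T a b c, 0 < cross d (w c) & 0 < cross (w b) d].
  have antis u v : cross u v = - cross v u by rewrite /cross; ring.
  have [[b2 /andP[Qb2 low2]]|nlow] := pselect (exists b, Q b && (cross d (w b) < 0)).
    case: (@Order.TotalTheory.arg_maxP _ _ _ b2 (fun b => Q b && (cross d (w b) < 0)) kappa).
      by rewrite Qb2 low2.
    move=> b /andP[Qb low] bmax; exists b; split => //.
    have [_ [T [c t]]] := asboolP _ Qb; exists T, c.
    have Qc := Qnext _ _ _ t Qb.
    split => //; last by rewrite antis oppr_gt0.
    have [lowc|//] := lower_or_upper _ Qc.
    have := bmax c; rewrite Qc lowc => /(_ isT) /=; rewrite leNgt cotangent_lt//.
      by rewrite -linw (tric_gt0 t).
    by rewrite nmulr_rgt0.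
  have up b : Q b -> 0 < cross d (w b).
    move=> Qb; have [low|//] := lower_or_upper _ Qb.
    by exfalso; apply: nlow; exists b; rewrite Qb low.
  case: (@Order.TotalTheory.arg_maxP _ _ _ b1 Q kappa) => // b Qb bmax.
  have [_ [T [c t]]] := asboolP _ Qb.
  have Qc := Qnext _ _ _ t Qb.
  have := bmax c Qc; rewrite /= leNgt cotangent_lt//.
    by rewrite -linw (tric_gt0 t).
  by rewrite mulr_gt0// up.
have cone T' b' c' : tric T' a b' c' -> 0 < cross d (w c') -> 0 < cross (w b') d ->
    \forall e \near 0^'+, forall a', a' \in val T' -> 0 < bary T' a' (pt a + e *: d).
  move=> t' dc' bd'; have [aT bT cT] := tric_mem t'; have [ab bc'' ca] := tric_neq t'.
  have D0 := tric_gt0 t'.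
  apply: germ_cell; first exact: (hull_pt tri aT).
  move=> f /(tric_inv t')[]->.
  - by rewrite (bary_pt tri aT) => /eqP; rewrite oner_eq0.
  - move=> _; have -> := baryE (pt a + d) (tric_rot t').
    rewrite (_ : lin c' a (pt b') = lin a b' (pt c')); last by rewrite -lin_rot.
    rewrite divr_gt0// (_ : lin c' a (pt a + d) = cross d (w c'))//.
    by rewrite /lin /w /cross /=; ring.
  - move=> _; have -> := baryE (pt a + d) (tric_rot (tric_rot t')).
    rewrite divr_gt0// (_ : lin a b' (pt a + d) = cross (w b') d)//.
    by rewrite /lin /w /cross /=; ring.
have D0 : 0 < cross (w b0) (w c0) by rewrite -linw (tric_gt0 t0).
have dc0 : 0 < cross d (w c0).
  have self : cross (w c0) (w c0) = 0 by rewrite /cross; ring.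
  by rewrite /d cross_affine self mulr0 addr0.
have bd0 : 0 < cross (w b0) d.
  have -> : cross (w b0) d = s * cross (w b0) (w c0).
    have -> : cross (w b0) d = - cross d (w b0) by rewrite /cross; ring.
    by rewrite /d cross_affine /cross; ring.
  exact: mulr_gt0.
have g := cone _ _ _ t dc bd; have g0 := cone _ _ _ t0 dc0 bd0.
have [e [_ pe pe0 _]] := right_ex g g0 g0.
have TT0 := interior_cell_eq tri pe (hull_positive pe0); subst T0.
have [<- _] := tric_uniq t t0.
by have [] := asboolP _ Qb.
Unshelve. all: by end_near. Qed.

End Cells.

(** * Cochains and local potentials *)

(** Membership of [c] in the row space is tested on the columns of [cokermx M], which are vectors
    [y] annihilated by all rows of [A]. *)
Lemma fredholm_alternative (F : fieldType) (I J : finType) (A : I -> J -> F) (c : J -> F) :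
  (forall y : J -> F, (forall i, \sum_j A i j * y j = 0) -> \sum_j c j * y j = 0) ->
  exists W : I -> F, forall j, c j = \sum_i W i * A i j.
Proof.
move=> H; pose M := \matrix_(i < #|I|, j < #|J|) A (enum_val i) (enum_val j).
pose r := \row_(j < #|J|) c (enum_val j).
have sub : (r <= M)%MS.
  rewrite submxE; apply/eqP/rowP => k; rewrite !mxE.
  have := H (fun j => cokermx M (enum_rank j) k).
  rewrite (reindex _ (onW_bij _ (enum_val_bij J))) /=.
  under eq_bigr do rewrite enum_valK.
  move=> Hk; under eq_bigr do rewrite [r _ _]mxE; apply: Hk => i.
  have := mulmx_coker M => /matrixP/(_ (enum_rank i) k); rewrite !mxE.
  move=> hM; apply: etrans hM; rewrite (reindex _ (onW_bij _ (enum_val_bij J))) /=.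
  by apply: eq_bigr => j _; rewrite enum_valK [M _ _]mxE enum_rankK.
have /submxP[E /rowP rE] := sub.
exists (fun i => E 0 (enum_rank i)) => j.
have := rE (enum_rank j); rewrite !mxE enum_rankK => ->.
rewrite [RHS](reindex _ (onW_bij _ (enum_val_bij I))) /=.
by apply: eq_bigr => i _; rewrite !mxE enum_rankK enum_valK.
Qed.

Section Cells.
Variables (R : realType) (V : finType) (pt : V -> R * R).
Variables (Th : {set {set V}}) (Omega : set (R * R)).
Hypothesis tri : triangulation pt Th Omega.
Hypotheses (Oopen : open Omega) (Oreg : regopen Omega).
Implicit Types (T : cell Th) (a b c : V) (x v : R * R).
Notation tric := (tric pt).
Notation bary := (bary pt).
Notation hull := (hull pt).
Notation iedge := (interior_edge pt Th Omega).

Lemma interior_edgeC a b : iedge a b -> iedge b a.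
Proof.
move=> [[ab [T abT]] nf]; split.
  by split; [rewrite eq_sym|exists T; rewrite andbC].
move=> h; apply: nf => _ [s s01 <-]; apply: h; exists (1 - s).
  by move: s01; rewrite /= !in_itv /= => /andP[s0 s1]; apply/andP; split; lra.
by rewrite /seg_point subKr addrC.
Qed.

(** At most one cell lies on the left of an oriented edge. The double sum names the value of [F]
    there without choosing the cell, and it is 0 if there is none. *)
Lemma sum_left_cell (F : cell Th -> R) T a b c : tric T a b c ->
  \sum_T' \sum_(c' | tric T' a b c') F T' = F T.
Proof.
move=> t; rewrite (bigD1 T)//= (big_pred1 c) => [|c']; last first.
  by apply/idP/eqP => [t'|->//]; exact: tric_third t' t.
rewrite big1 ?addr0// => T' TT'; rewrite big_pred0// => c'.
apply/negP => t'; move/eqP: TT'; apply.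
exact: (tric_same_side tri t' t).
Qed.

Lemma sum_cell_edges (F : V -> V -> R) T a b c : tric T a b c ->
  \sum_p \sum_q \sum_(r | tric T p q r) F p q = F a b + F b c + F c a.
Proof.
move=> t.
have E p q r : tric T p q r -> \sum_q \sum_(r | tric T p q r) F p q = F p q.
  move=> t'; rewrite (bigD1 q)//= (big_pred1 r) => [|r']; last first.
    by apply/idP/eqP => [t''|->//]; exact: tric_third t'' t'.
  rewrite big1 ?addr0// => q' qq'; rewrite big_pred0// => r'.
  by apply/negP => t''; move/eqP: qq'; apply; have [] := tric_uniq t'' t'.
transitivity (\sum_(p in val T) \sum_q \sum_(r | tric T p q r) F p q).
  rewrite [RHS]big_mkcond; apply: eq_bigr => p _; case: ifP => // /negP pT.
  by apply: big1 => q _; rewrite big_pred0// => r; apply/negP => /tric_mem[/pT].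
rewrite (big_tric _ t) (E _ _ _ t) (E _ _ _ (tric_rot t)).
by rewrite (E _ _ _ (tric_rot (tric_rot t))).
Qed.

(** A discrete Stokes theorem. Regrouped by oriented edges, the sum pairs the contribution of ([a],
    [b]) with that of ([b], [a]), so twice the sum is 0. *)
Lemma sum_cells_cancel (G : cell Th -> V -> V -> R) :
  (forall T T' a b c c', iedge a b -> tric T a b c -> tric T' b a c' ->
     G T a b + G T' b a = 0) ->
  (forall T a b c, tric T a b c -> ~ iedge a b -> G T a b = 0) ->
  \sum_T \sum_a \sum_b \sum_(c | tric T a b c) G T a b = 0.
Proof.
move=> Gi Gb; rewrite exchange_big /=; under eq_bigr do rewrite exchange_big /=.
pose L a b := \sum_T \sum_(c | tric T a b c) G T a b.
have LL a b : L a b + L b a = 0.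
  have [ie|ne] := pselect (iedge a b).
    have [[T [c t]] [T' [c' t']]] := interior_edge_sides tri Oopen ie.
    rewrite /L (sum_left_cell (fun T => G T a b) t) (sum_left_cell (fun T => G T b a) t').
    exact: (Gi _ _ _ _ _ _ ie t t').
  rewrite /L !big1 ?addr0// => T _; apply: big1 => c t; apply: Gb t _ => //.
  by move=> /interior_edgeC.
suff : \sum_a \sum_b L a b + \sum_a \sum_b L a b = 0.
  by rewrite /L; lra.
rewrite {2}exchange_big /= -big_split big1// => a _ /=.
by rewrite -big_split big1// => b _ /=.
Qed.

(** Only the vertices, the relative interiors of edges between two cells, and points in a single
    cell have to be told apart: two different cells through a point that is not a vertex share the
    edge carrying it. *)
Lemma star_cases x : [\/ exists a, x = pt a,
  forall T T', hull (val T) x -> hull (val T') x -> T = T' |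
  exists T1 T2 a b c c', [/\ hull (val T1) x, hull (val T2) x, tric T1 a b c,
    tric T2 b a c' & forall T, hull (val T) x -> T = T1 \/ T = T2]].
Proof.
have [vx|nv] := pselect (exists a, x = pt a); first exact: Or31.
have [u|] := pselect (forall T T', hull (val T) x -> hull (val T') x -> T = T').
  exact: Or32.
move=> /existsNP[T1 /existsNP[T2 /not_implyP[h1 /not_implyP[h2 T12]]]].
apply: Or33.
have [d dT1 dT2] : exists2 d, d \in val T1 & d \notin val T2.
  apply: contrapT => nd; apply: T12; apply: (cell_sub_eq tri) => d dT1.
  by apply/negPn/negP => dT2; apply: nd; exists d.
have [a [b t]] : exists a b, tric T1 a b d.
  by have [a [b t]] := tric_at tri dT1; exists a, b; exact: tric_rot.
have [aT bT _] := tric_mem t; have [ab bd da] := tric_neq t.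
have bd0 : bary T1 d x = 0 by rewrite (bary_eq tri h1 h2) bary_out.
(* The coordinate of [d] vanishes already; if that of [f] did too, [x] would be the vertex [e]. *)
have pos e f : e \in val T1 -> (forall g, g \in val T1 -> [\/ g = e, g = f | g = d]) ->
    0 < bary T1 f x.
  move=> eT ef; rewrite lt_neqAle ((hullP tri T1 x).1 h1) andbT eq_sym.
  apply/negP => /eqP f0; apply: nv; exists e.
  have s0 g : g \in val T1 -> g != e -> bary T1 g x = 0.
    by move=> /ef[]->//; rewrite eqxx.
  have e1 : bary T1 e x = 1.
    rewrite -(bary_sum1 tri T1 x) (bigD1 e)//= big1 ?addr0// => g /andP[].
    exact: s0.
  rewrite -[LHS](bary_sumx tri T1 x) (bigD1 e)//= e1 scale1r big1 ?addr0//.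
  by move=> g /andP[gT ge]; rewrite s0// scale0r.
have pb : 0 < bary T1 b x by apply: pos aT _ => g /(tric_inv t).
have pa : 0 < bary T1 a x.
  by apply: pos bT _ => g /(tric_inv t)[] ->; [exact: Or32|exact: Or31|exact: Or33].
have ab_in T : hull (val T) x -> a \in val T /\ b \in val T.
  move=> h; split; first exact: (conform_mem tri h1 h pa).
  exact: (conform_mem tri h1 h pb).
have [aT2 bT2] := ab_in _ h2.
have [c' [t'|t']] := tric_edge tri aT2 bT2 ab.
  by case: T12; exact: (tric_same_side tri t t').
exists T1, T2, a, b, d, c'; split => // T h; have [aT3 bT3] := ab_in _ h.
have [r [t3|t3]] := tric_edge tri aT3 bT3 ab.
  by left; exact: (tric_same_side tri t3 t).
by right; exact: (tric_same_side tri t3 t').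
Qed.

Section Jumps.
Variable y : V -> V -> R.
Hypothesis y_anti : forall a b, y a b = - y b a.
Hypothesis y_edge : forall a b, ~ iedge a b -> y a b = 0.
Hypothesis y_div : forall a, Omega (pt a) -> \sum_b y a b = 0.

(* y a b is the jump from the cell on the right of the oriented edge (a, b) to
   the cell on its left. *)
Definition jump_potential x (u : cell Th -> R) : Prop :=
  forall T T' a b c c', hull (val T) x -> hull (val T') x ->
    tric T a b c -> tric T' b a c' -> u T - u T' = y a b.

(** A linear system with one unknown per cell and one equation per vertex [b]; [A T b] is 1 or -1 as
    [T] lies to the left or to the right of ([a], [b]). The transposed equations make [z] equal at
    the two neighbours of [a] in each cell, hence constant around [a], so that compatibility reduces
    to [y_div]. *)
Lemma jump_potential_vertex a : Omega (pt a) -> exists u, jump_potential (pt a) u.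
Proof.
move=> Oa.
pose A T b : R := \sum_(c | tric T a b c) 1 - \sum_(c | tric T b a c) 1.
have [z Az|u uP] := @fredholm_alternative R _ _ A (y a).
  have [T0 Th0 aT0] := vertex_in_cell tri a.
  have [b0 [c0 t0]] := @tric_at _ _ pt _ _ tri (exist _ T0 Th0) a aT0.
  have zlink T b c : tric T a b c -> z b = z b0.
    apply: (link_connected tri Oopen (Z := fun b => z b = z b0) Oa).
      by exists (exist _ T0 Th0), b0, c0.
    move=> T1 b1 c1 t1 <-; have := Az T1.
    rewrite (eq_bigr (fun d => \sum_(c | tric T1 a d c) z d - \sum_(c | tric T1 d a c) z d)); last first.
      by move=> d _; rewrite /A mulrBl !mulr_suml; congr (_ - _); apply: eq_bigr => ? _; rewrite mul1r.
    rewrite sumrB (bigD1 b1)//= (big_pred1 c1) => [|c']; last first.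
      by apply/idP/eqP => [t'|->//]; exact: tric_third t' t1.
    rewrite big1 ?addr0 => [|d db]; last first.
      rewrite big_pred0// => r; apply/negP => t2; move/eqP: db; apply.
      by have [] := tric_uniq t2 t1.
    have t1' := tric_rot (tric_rot t1).
    rewrite (bigD1 c1)//= (big_pred1 b1) => [|c']; last first.
      by apply/idP/eqP => [t'|->//]; exact: tric_third t' t1'.
    rewrite big1 ?addr0 => [/eqP|d db]; last first.
      rewrite big_pred0// => r; apply/negP => t2; move/eqP: db; apply.
      by have [] := tric_uniq (tric_rot t2) t1.
    by rewrite subr_eq0 => /eqP.
  rewrite (eq_bigr (fun b => z b0 * y a b)) => [|b _]; last first.
    rewrite mulrC; have [ie|ne] := pselect (iedge a b); last by rewrite y_edge// !mulr0.
    by have [[T [c t]] _] := interior_edge_sides tri Oopen ie; rewrite (zlink _ _ _ t).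
  by rewrite -mulr_sumr y_div// mulr0.
have ua T T' b c c' : tric T a b c -> tric T' b a c' -> u T - u T' = y a b.
  move=> t t'; rewrite uP -(sum_left_cell u t) -(sum_left_cell u t') -sumrB.
  apply: eq_bigr => T1 _; rewrite /A mulrBr !mulr_sumr.
  by congr (_ - _); apply: eq_bigr => ? _; rewrite mulr1.
exists u => T T' p q r r' /(hull_pt_mem tri) aT /(hull_pt_mem tri) aT' t t'.
have [E|E|E] := tric_inv t aT.
- by subst p; exact: ua t t'.
- by subst q; rewrite y_anti -(ua _ _ _ _ _ t' t) opprB.
subst r; have [E|E|E] := tric_inv t' aT'.
- by subst q; rewrite y_anti -(ua _ _ _ _ _ t' t) opprB.
- by subst p; exact: ua t t'.
subst r'; have TT' : T = T'.
  by apply: (cell_sub_eq tri) => d /(tric_inv t)[]->; have [] := tric_mem t'.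
by subst T'; have := tric_noflip t t'.
Qed.

Lemma jump_potential_ex x : Omega x -> exists u, jump_potential x u.
Proof.
move=> Ox; have [[a E]|u|[T1 [T2 [a [b [c [c' [h1 h2 t1 t2 T12]]]]]]]] := star_cases x.
- by rewrite E; apply: jump_potential_vertex; rewrite -E.
- exists (fun=> 0) => T T' p q r r' h h' t t'; have E := u _ _ h h'; subst T'.
  by have := tric_noflip t t'.
have nT : T1 <> T2 by move=> E; subst T2; have := tric_noflip t1 t2.
have cT2 : c \notin val T2.
  apply/negP => cT2; apply: nT; apply: (cell_sub_eq tri) => d.
  by have [aT bT _] := tric_mem t2; move=> /(tric_inv t1)[]->.
have com p : p \in val T1 -> p \in val T2 -> p = a \/ p = b.
  move=> /(tric_inv t1)[]->; [by left|by right|by rewrite (negPf cT2)].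
have ori p q r r' : tric T1 p q r -> tric T2 q p r' -> p = a /\ q = b.
  move=> t t'; have [pT qT _] := tric_mem t; have [qT' pT' _] := tric_mem t'.
  have [pq _ _] := tric_neq t.
  have [Ep|Ep] := com _ pT pT'; have [Eq|Eq] := com _ qT qT'; subst p q => //.
  - by rewrite eqxx in pq.
  - by have := tric_noflip t1 t.
  - by rewrite eqxx in pq.
exists (fun T => if T == T1 then y a b else 0) => T T' p q r r' h h' t t'.
have nTT' : T <> T' by move=> E; subst T'; have := tric_noflip t t'.
have [E|E] := T12 _ h; have [E'|E'] := T12 _ h'; subst T T' => //.
  have [-> ->] := ori _ _ _ _ t t'.
  by rewrite eqxx (_ : T2 == T1 = false) ?subr0//; apply/negbTE/eqP => E; exact: nT.
have [-> ->] := ori _ _ _ _ t' t.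
by rewrite eqxx (_ : T2 == T1 = false) ?sub0r -?y_anti//; apply/negbTE/eqP => E; exact: nT.
Qed.

(** At a vertex, [u - u'] has no jump across the edges through it, hence takes one value on the
    cells around it by [link_connected]; at other points at most one edge is involved. *)
Lemma jump_potential_uniq x u u' T T' : Omega x -> jump_potential x u ->
  jump_potential x u' -> hull (val T) x -> hull (val T') x ->
  u T - u T' = u' T - u' T'.
Proof.
move=> Ox pu pu' hT hT'.
have [[a E]|uni|[T1 [T2 [a [b [c [c' [h1 h2 t1 t2 T12]]]]]]]] := star_cases x.
- subst x; move: hT hT' => /(hull_pt_mem tri) aT /(hull_pt_mem tri) aT'.
  have [b0 [c0 t0]] := tric_at tri aT.
  suff H T1 : a \in val T1 -> u T1 - u' T1 = u T - u' T by have := H _ aT'; lra.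
  move=> aT1; have [b1 [c1 t1]] := tric_at tri aT1.
  pose Z b := forall T1 c, tric T1 a b c -> u T1 - u' T1 = u T - u' T.
  suff Zb1 : Z b1 by exact: Zb1 t1.
  apply: (link_connected tri Oopen (Z := Z) Ox _ _ t1).
    exists T, b0, c0; split => // T2 c2 t2.
    by rewrite (tric_same_side tri t2 t0).
  move=> T2 b2 c2 t2 Zb T3 c3 t3; rewrite -(Zb _ _ t2).
  have t2' := tric_rot (tric_rot t2).
  have [aT2 _ _] := tric_mem t2; have [aT3 _ _] := tric_mem t3.
  have h2 := hull_pt tri aT2; have h3 := hull_pt tri aT3.
  have := pu _ _ _ _ _ _ h3 h2 t3 t2'; have := pu' _ _ _ _ _ _ h3 h2 t3 t2'; lra.
- by rewrite (uni _ _ hT hT') !subrr.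
have e := pu _ _ _ _ _ _ h1 h2 t1 t2; have e' := pu' _ _ _ _ _ _ h1 h2 t1 t2.
by have [->|->] := T12 _ hT; have [->|->] := T12 _ hT'; lra.
Qed.

End Jumps.
End Cells.

(** * Exactness *)

Section Exactness.
Variables (R : realType) (V : finType) (pt : V -> R * R).
Variables (Th : {set {set V}}) (Omega : set (R * R)).
Hypothesis tri : triangulation pt Th Omega.
Hypotheses (Oopen : open Omega) (Oreg : regopen Omega).
Hypothesis Osc : simply_connected Omega.
Implicit Types (T : cell Th) (a b c v : V) (x : R * R).
Notation tric := (tric pt).
Notation bary := (bary pt).
Notation hull := (hull pt).
Notation iedge := (interior_edge pt Th Omega).
Notation jump_potential := (jump_potential pt).

Lemma centroid T : exists m, forall a, a \in val T -> 0 < bary T a m.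
Proof.
exists (\sum_(a in val T) 3^-1 *: pt a) => a aT.
rewrite -(@bary_uniq _ _ pt Th Omega tri T (fun=> 3^-1) _ _ (erefl _) _ aT) ?invr_gt0 ?ltr0n//.
by rewrite sumr_const (card_cell tri (valP T)) -[_ *+ _]mulr_natr mulVf ?pnatr_eq0.
Qed.

(** Seen from an interior point [m], the segment to [x] is interior to the cell except possibly at
    [x], hence stays in [Omega]. This supplies the base points required by [monodromy]. *)
Lemma cell_star T : exists m, [/\ Omega m, hull (val T) m & forall x, Omega x ->
  hull (val T) x -> exists g, ipath Omega m x g /\ forall t, hull (val T) (g t)].
Proof.
have [m mT] := centroid T; have hm := hull_positive tri mT.
exists m; split => [||x Ox hx] //; first exact: (positive_bary_Omega tri Oreg mT).
pose g t := m + clamp t *: (x - m).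
have gE t : g t = seg_point m x (clamp t).
  by rewrite /g /seg_point scalerBl scale1r scalerBr -addrA (addrC (- _)) addrA.
exists g; split; last by move=> t; rewrite gE; apply: (hull_seg tri) => //; exact: clamp_itv.
split => [t|t|t t0|t t1].
- apply: (@continuous_comp _ _ _ (@clamp R) (fun s => m + s *: (x - m))).
    exact: clamp_continuous.
  exact: continuous_affine.
- rewrite gE; have := clamp_itv t; rewrite in_itv /= => /andP[c0 c1].
  have [c1'|c1'] := eqVneq (clamp t) 1.
    by rewrite c1' /seg_point subrr scale0r scale1r add0r.
  apply: (positive_bary_Omega tri Oreg (T := T)) => a aT; rewrite bary_seg.
  rewrite ltr_pwDl//; last by rewrite mulr_ge0// (hullP tri T x).1.
  by rewrite mulr_gt0 ?mT// subr_gt0 lt_neqAle c1' c1.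
- by rewrite gE clamp_le0// /seg_point subr0 scale1r scale0r addr0.
- by rewrite gE clamp_ge1// /seg_point subrr scale0r scale1r add0r.
Qed.

(* A point x + e (x' - x) with e small lies in Omega, and the cells that contain
   it are those that contain both x and x'. *)
Lemma jump_potential_consistent y x x' u u' T T' : Omega x -> Omega x' ->
  jump_potential y x u -> jump_potential y x' u' ->
  hull (val T) x -> hull (val T') x -> hull (val T) x' -> hull (val T') x' ->
  u T - u T' = u' T - u' T'.
Proof.
move=> Ox Ox' pu pu' hT hT' hTx' hTx''.
have nO : nbhs x Omega by exact: open_nbhs_nbhs.
have lt1 := nbhs_right_lt (ltr01 : 0 < 1 :> R).
have [e [e0 Oe e1 _]] := right_ex (near_ray (x' - x) nO) lt1 lt1.
have xE : x + e *: (x' - x) = seg_point x x' e.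
  by rewrite /seg_point scalerBl scale1r scalerBr -addrA (addrC (- _)) addrA.
rewrite xE in Oe; set w := seg_point x x' e in Oe.
have eI : e \in `[0, 1] by rewrite in_itv /= ltW//= ltW.
have hw T1 : hull (val T1) x -> hull (val T1) x' -> hull (val T1) w.
  by move=> h h'; exact: (hull_seg tri).
have sub T1 : hull (val T1) w -> hull (val T1) x /\ hull (val T1) x'.
  move=> h1; split; apply: (hull_support tri (T := T)) => // a ax.
    apply: (conform_mem tri (hw _ hT hTx') h1); rewrite bary_seg ltr_pwDl//.
      by rewrite mulr_gt0// subr_gt0.
    by rewrite mulr_ge0 ?(ltW e0)// (hullP tri T x').1.
  apply: (conform_mem tri (hw _ hT hTx') h1); rewrite bary_seg ltr_wpDl//.
    by rewrite mulr_ge0 ?subr_ge0 ?(ltW e1)// (hullP tri T x).1.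
  exact: mulr_gt0.
apply: (jump_potential_uniq tri Oopen Oe (y := y)); [| |exact: hw|exact: hw].
- move=> T1 T2 a b c c' h1 h2 t1 t2; apply: pu t1 t2.
    by have [] := sub _ h1.
  by have [] := sub _ h2.
- move=> T1 T2 a b c c' h1 h2 t1 t2; apply: pu' t1 t2.
    by have [] := sub _ h1.
  by have [] := sub _ h2.
Qed.

(** [D T T'] compares two cells at a chosen point of [Omega] that they share;
    [jump_potential_consistent] makes the choice harmless, and [monodromy] applies with the cells as
    pieces. *)
Lemma jumps_potential (y : V -> V -> R) :
  (forall a b, y a b = - y b a) -> (forall a b, ~ iedge a b -> y a b = 0) ->
  (forall a, Omega (pt a) -> \sum_b y a b = 0) ->
  exists U : cell Th -> R, forall T T' a b c c', iedge a b ->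
    tric T a b c -> tric T' b a c' -> U T - U T' = y a b.
Proof.
move=> y_anti y_edge y_div.
have [P PP] : exists P : R * R -> cell Th -> R, forall x, Omega x -> jump_potential y x (P x).
  have ex x : exists u : cell Th -> R, Omega x -> jump_potential y x u.
    have [/(jump_potential_ex tri Oopen y_anti y_edge y_div)[u pu]|] := pselect (Omega x).
      by exists u.
    by exists (fun=> 0).
  by exists (fun x => sval (cid (ex x))) => x; case: cid.
pose common T T' := exists x, [/\ Omega x, hull (val T) x & hull (val T') x].
pose D T T' := if pselect (common T T') is left h
  then P (sval (cid h)) T - P (sval (cid h)) T' else 0.
have DE x T T' : Omega x -> hull (val T) x -> hull (val T') x -> D T T' = P x T - P x T'.
  move=> Ox hT hT'; rewrite /D; case: pselect => [h|]; last by case; exists x.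
  case: cid => x' [Ox' h1 h2] /=.
  exact: (jump_potential_consistent Ox' Ox (PP _ Ox') (PP _ Ox)).
have Danti T T' : D T T' = - D T' T.
  have [[x [Ox h h']]|nc] := pselect (common T T').
    by rewrite (DE x)// (DE x T')// opprB.
  have nc' : ~ common T' T by move=> [x [Ox h h']]; apply: nc; exists x.
  by rewrite /D; case: pselect => // _; case: pselect => // _; rewrite oppr0.
have [|x Ox|//|x Ox|||U UP] := @monodromy R Omega (cell Th) (fun x T => hull (val T) x) D.
- by move=> x _; exact: (hull_near tri).
- exact: (cell_cover tri Ox).
- by exists (P x) => T T'; exact: DE.
- exact: Osc.
- exact: cell_star.
exists U => T T' a b c c' [_ /existsNP[x /not_implyP[[s s01 sx] nf]]] t t'.
have [aT bT _] := tric_mem t; have [bT' aT' _] := tric_mem t'.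
have hx T1 : a \in val T1 -> b \in val T1 -> hull (val T1) x.
  by move=> a1 b1; rewrite -sx; apply: (hull_seg tri) => //; exact: (hull_pt tri).
have Ox := not_frontier tri Oopen (hx _ aT bT) nf.
have hT := hx _ aT bT; have hT' := hx _ aT' bT'.
by rewrite -(UP x)// (DE x)//; exact: (PP _ Ox _ _ _ _ _ _ hT hT' t t').
Qed.

(** [A] is the coboundary restricted to vertices in [Omega] and to interior edges, so that a
    solution carries the boundary condition. A kernel vector yields the jumps of a cell function
    [U]; its pairing with [c], collected by cells, is [U T] times the sum of [c] around [T]. *)
Theorem relative_cocycle_exact (c : V -> V -> R) :
  (forall a b, c a b = - c b a) -> (forall a b, ~ iedge a b -> c a b = 0) ->
  (forall T p q r, tric T p q r -> c p q + c q r + c r p = 0) ->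
  exists W : V -> R, (forall a, boundary_vertex pt Omega a -> W a = 0) /\
    forall T a b, a \in val T -> b \in val T -> c a b = W b - W a.
Proof.
move=> c_anti c_edge c_closed.
pose E a b : R := (`[< iedge a b >])%:R.
have EC a b : E a b = E b a.
  by rewrite /E; congr (nat_of_bool _)%:R; apply/asboolP/asboolP => /interior_edgeC.
have Ec a b : E a b * c a b = c a b.
  by rewrite /E; case: asboolP => [_|/c_edge->]; rewrite ?mul1r ?mulr0.
have pairE (F : V * V -> R) : \sum_j F j = \sum_p \sum_q F (p, q).
  by rewrite pair_bigA; apply: eq_bigr => -[].
pose O (v : V) : R := (`[< Omega (pt v) >])%:R.
pose A (v : V) (j : V * V) : R := O v * (E j.1 j.2 * ((j.2 == v)%:R - (j.1 == v)%:R)).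
have [z Az|W WP] := @fredholm_alternative R _ _ A (fun j => c j.1 j.2).
  (* Only the antisymmetric part of [z] pairs with [c]. It is an admissible family of jumps, and its
     pairing with [c] is twice that of [z]. *)
  pose y a b := E a b * (z (a, b) - z (b, a)).
  have y_anti a b : y a b = - y b a by rewrite /y EC; ring.
  have y_edge a b : ~ iedge a b -> y a b = 0.
    by move=> ne; rewrite /y /E; case: asboolP => // _; rewrite mul0r.
  have y_div a : Omega (pt a) -> \sum_b y a b = 0.
    move=> Oa; have := Az a; rewrite pairE.
    have O1 : O a = 1 by rewrite /O; case: asboolP.
    have -> : \sum_p \sum_q A a (p, q) * z (p, q) =
       \sum_p (E p a * z (p, a)) - \sum_q E a q * z (a, q).
      transitivity (\sum_p \sum_q (E p q * (q == a)%:R * z (p, q)) -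
          \sum_p \sum_q (E p q * (p == a)%:R * z (p, q))).
        rewrite -sumrB; apply: eq_bigr => p _; rewrite -sumrB; apply: eq_bigr => q _.
        by rewrite /A /= O1; ring.
      congr (_ - _).
        apply: eq_bigr => p _; rewrite (bigD1 a)//= eqxx mulr1 big1 ?addr0//.
        by move=> q /negPf->; rewrite mulr0 mul0r.
      rewrite (bigD1 a)//= [X in _ + X]big1 ?addr0//.
        by apply: eq_bigr => q _; rewrite eqxx mulr1.
      by move=> p /negPf pa; apply: big1 => q _; rewrite pa mulr0 mul0r.
    move=> h; rewrite -[LHS]opprK -sumrN; apply/eqP; rewrite oppr_eq0; apply/eqP.
    apply: etrans h; rewrite -sumrB.
    by apply: eq_bigr => b _; rewrite /y (EC b a); ring.
  have [U UP] := jumps_potential y_anti y_edge y_div.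
  pose L a b := \sum_T \sum_(r | tric T a b r) U T.
  have cL a b : c a b * y a b = c a b * (L a b - L b a).
    have [ie|ne] := pselect (iedge a b); last by rewrite c_edge// !mul0r.
    have [[T [r t]] [T' [r' t']]] := interior_edge_sides tri Oopen ie.
    by rewrite /L (sum_left_cell tri U t) (sum_left_cell tri U t') (UP _ _ _ _ _ _ ie t t').
  have cL0 : \sum_a \sum_b c a b * L a b = 0.
    transitivity (\sum_T \sum_a \sum_b \sum_(r | tric T a b r) U T * c a b).
      rewrite [RHS]exchange_big; apply: eq_bigr => a _; rewrite [RHS]exchange_big.
      apply: eq_bigr => b _; rewrite /L mulr_sumr; apply: eq_bigr => T _.
      by rewrite mulr_sumr; apply: eq_bigr => r _; rewrite mulrC.
    apply: big1 => T _; have [a [b [r t]]] := tric_ex tri T.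
    by rewrite (sum_cell_edges (fun a b => U T * c a b) t) -!mulrDr (c_closed T)// mulr0.
  have cL0' : \sum_a \sum_b c a b * L b a = 0.
    rewrite exchange_big /= -[RHS]oppr0 -[in RHS]cL0 -sumrN; apply: eq_bigr => a _.
    by rewrite -sumrN; apply: eq_bigr => b _; rewrite c_anti mulNr.
  have cy : \sum_a \sum_b c a b * y a b = 0.
    have -> : \sum_a \sum_b c a b * y a b =
        \sum_a \sum_b c a b * L a b - \sum_a \sum_b c a b * L b a.
      rewrite -sumrB; apply: eq_bigr => a _; rewrite -sumrB; apply: eq_bigr => b _.
      by rewrite cL mulrBr.
    by rewrite cL0 cL0' subrr.
  have cz : \sum_a \sum_b c a b * y a b =
      \sum_a \sum_b c a b * z (a, b) + \sum_a \sum_b c a b * z (a, b).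
    rewrite [X in _ = _ + X]exchange_big /= -big_split; apply: eq_bigr => a _ /=.
    rewrite -big_split; apply: eq_bigr => b _ /=.
    by rewrite [c b a]c_anti -[c a b in RHS]Ec /y; ring.
  by rewrite pairE /=; move: cz; rewrite cy; lra.
exists (fun v => O v * W v).
have Ofr a : frontier Omega (pt a) -> O a = 0.
  by rewrite /O; case: asboolP => // Oa /(Omega_not_frontier Oopen Oa).
split; first by move=> a /Ofr->; rewrite mul0r.
have cE a b : c a b = E a b * (O b * W b - O a * W a).
  rewrite (WP (a, b)) /A /=.
  transitivity (E a b * (\sum_v (O v * W v) * (b == v)%:R - \sum_v (O v * W v) * (a == v)%:R)).
    by rewrite -sumrB mulr_sumr; apply: eq_bigr => v _; ring.
  have d (F : V -> R) e : \sum_v F v * (e == v)%:R = F e.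
    rewrite (bigD1 e)//= eqxx mulr1 big1 ?addr0// => v.
    by rewrite eq_sym => /negPf->; rewrite mulr0.
  by rewrite !d.
move=> T a b aT bT; have [<-|ab] := eqVneq a b.
  by have := c_anti a a; rewrite subrr; lra.
have [ie|ne] := pselect (iedge a b).
  by rewrite cE /E; case: asboolP => // _; rewrite mul1r.
(* An edge that is not interior lies in the frontier, so both its ends carry the value 0, in
   accordance with [c a b = 0]. *)
have sub : segment (pt a) (pt b) `<=` frontier Omega.
  apply: contrapT => nf; apply: ne; split => //; split => //.
  by exists T; rewrite aT bT.
have ends (s : R) : s \in `[0, 1] -> frontier Omega (seg_point (pt a) (pt b) s).
  by move=> s01; apply: sub; exists s.
have a0 : frontier Omega (pt a).
  have := ends 0; rewrite /seg_point subr0 scale1r scale0r addr0.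
  by apply; rewrite in_itv /= lexx ler01.
have b0 : frontier Omega (pt b).
  have := ends 1; rewrite /seg_point subrr scale0r scale1r add0r.
  by apply; rewrite in_itv /= lexx ler01.
by rewrite c_edge// !Ofr// !mul0r subrr.
Qed.

End Exactness.

(** * Bivariate polynomials *)

Section BivariatePolynomials.
Variable R : realType.
Implicit Types (P Q : {poly {poly R}}) (x u v : R * R) (c : R).

Definition cst2 c : {poly {poly R}} := c%:P%:P.

Lemma eval2D P Q x : eval2 (P + Q) x = eval2 P x + eval2 Q x.
Proof. by rewrite /eval2 !hornerD. Qed.

Lemma eval2N P x : eval2 (- P) x = - eval2 P x.
Proof. by rewrite /eval2 !hornerN. Qed.

Lemma eval2B P Q x : eval2 (P - Q) x = eval2 P x - eval2 Q x.
Proof. by rewrite eval2D eval2N. Qed.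

Lemma eval2M P Q x : eval2 (P * Q) x = eval2 P x * eval2 Q x.
Proof. by rewrite /eval2 !hornerM. Qed.

Lemma eval2_cst c x : eval2 (cst2 c) x = c.
Proof. by rewrite /eval2 /cst2 !hornerC. Qed.

Lemma eval2_0 x : eval2 0 x = 0.
Proof. by rewrite /eval2 !horner0. Qed.

Lemma eval2_ind P (q : {poly R}) x : eval2 (P * 'X + q%:P) x = eval2 P x * x.1 + q.[x.2].
Proof. by rewrite /eval2 hornerMXaddC hornerD hornerM hornerC. Qed.

Lemma dxE P i j : (dx P)`_i`_j = P`_i.+1`_j *+ i.+1.
Proof. by rewrite /dx coef_deriv coefMn. Qed.

Lemma dyE P i j : (dy P)`_i`_j = P`_i`_j.+1 *+ j.+1.
Proof. by rewrite /dy coef_map_id0 ?deriv0// coef_deriv. Qed.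

Lemma eq_poly2 P Q : (forall i j, P`_i`_j = Q`_i`_j) -> P = Q.
Proof. by move=> h; apply/polyP => i; apply/polyP => j. Qed.

Lemma dxB P Q : dx (P - Q) = dx P - dx Q.
Proof. exact: derivB. Qed.

Lemma dyB P Q : dy (P - Q) = dy P - dy Q.
Proof. by apply: eq_poly2 => i j; rewrite !(dyE, coefB) mulrnBl. Qed.

Lemma dxM P Q : dx (P * Q) = dx P * Q + P * dx Q.
Proof. exact: derivM. Qed.

Lemma dyM P Q : dy (P * Q) = dy P * Q + P * dy Q.
Proof.
apply/polyP => i; rewrite /dy coef_map_id0 ?deriv0// coefD !coefM raddf_sum -big_split.
by apply: eq_bigr => j _ /=; rewrite derivM !coef_map_id0 ?deriv0.
Qed.

Lemma dxdy P : dx (dy P) = dy (dx P).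
Proof. by apply: eq_poly2 => i j; rewrite !(dxE, dyE) -!mulrnA mulnC. Qed.

Lemma degree_dx k P : total_degree_le k.+1 P -> total_degree_le k (dx P).
Proof. by move=> h i j kij; rewrite dxE h ?mul0rn// addSn ltnS. Qed.

Lemma degree_dy k P : total_degree_le k.+1 P -> total_degree_le k (dy P).
Proof. by move=> h i j kij; rewrite dyE h ?mul0rn// addnS ltnS. Qed.

Lemma degreeB k P Q : total_degree_le k P -> total_degree_le k Q -> total_degree_le k (P - Q).
Proof. by move=> h h' i j kij; rewrite !coefB h// h'// subrr. Qed.

Lemma cst2E c i j : (cst2 c)`_i`_j = c *+ ((i == 0%N) && (j == 0%N)).
Proof. by rewrite /cst2 coefC; case: eqP => _; rewrite ?coef0// coefC; case: eqP. Qed.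

Lemma degree_cst k c : total_degree_le k (cst2 c).
Proof. by move=> [|i] [|j] // _; rewrite cst2E. Qed.

Lemma degree0 P : total_degree_le 0 P -> P = cst2 P`_0`_0.
Proof.
by move=> h; apply: eq_poly2 => -[|i] [|j]; rewrite cst2E ?mulr1n ?mulr0n //; apply: h.
Qed.

Lemma degree1_dx P : total_degree_le 1 P -> dx P = cst2 P`_1`_0.
Proof. by move=> /degree_dx/degree0->; rewrite dxE. Qed.

Lemma degree1_dy P : total_degree_le 1 P -> dy P = cst2 P`_0`_1.
Proof. by move=> /degree_dy/degree0->; rewrite dyE. Qed.

Lemma grad0_cst P : dx P = 0 -> dy P = 0 -> P = cst2 P`_0`_0.
Proof.
move=> Px Py; apply: degree0 => -[|i] [|j] // _.
  by have := dyE P 0 j; rewrite Py !coef0 => /esym/eqP; rewrite mulrn_eq0 => /eqP.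
by have := dxE P i 0; rewrite Px !coef0 => /esym/eqP; rewrite mulrn_eq0 => /eqP.
by have := dxE P i j.+1; rewrite Px !coef0 => /esym/eqP; rewrite mulrn_eq0 => /eqP.
Qed.

Lemma hess0_affine P : dx (dx P) = 0 -> dy (dx P) = 0 -> dy (dy P) = 0 ->
  total_degree_le 1 P.
Proof.
move=> h1 h2 h3 i j ij.
have nz n (r : R) : r *+ n.+1 = 0 -> r = 0 by move/eqP; rewrite mulrn_eq0 => /eqP.
case: i j ij => [|[|i]] [|[|j]] // _.
- by have := dyE (dy P) 0 j; rewrite h3 !coef0 dyE => /esym/nz/nz.
- by have := dyE (dx P) 0 0; rewrite h2 !coef0 dxE => /esym/nz/nz.
- by have := dyE (dx P) 0 j.+1; rewrite h2 !coef0 dxE => /esym/nz/nz.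
- by have := dxE (dx P) i 0; rewrite h1 !coef0 dxE => /esym/nz/nz.
- by have := dxE (dx P) i 1; rewrite h1 !coef0 dxE => /esym/nz/nz.
- by have := dxE (dx P) i j.+2; rewrite h1 !coef0 dxE => /esym/nz/nz.
Qed.

Lemma eval2_affine P x : total_degree_le 1 P ->
  eval2 P x = P`_0`_0 + P`_1`_0 * x.1 + P`_0`_1 * x.2.
Proof.
move=> h; have {1}-> : P = cst2 P`_1`_0 * 'X + (P`_0`_1 *: 'X + (P`_0`_0)%:P)%:P.
  apply: eq_poly2 => i j; rewrite coefD coefD coefMX [(_ + _)%:P`_i]coefC.
  case: i => [|[|i]] /=; rewrite ?coef0 ?add0r ?addr0.
  - rewrite coefD coefZ coefX coefC; case: j => [|[|j]] /=.
    + by rewrite mulr0 add0r.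
    + by rewrite mulr1 addr0.
    + by rewrite mulr0 addr0; apply: h.
  - by rewrite cst2E; case: j => [|j] //=; apply: h.
  - by rewrite cst2E /=; apply: h.
by rewrite eval2_ind eval2_cst hornerD hornerZ hornerX hornerC; ring.
Qed.

(** The Poincare lemma on coefficients: monomials containing the first variable come from
    integrating [P], the others from [Q]. The bound [k.+2] leaves room for degree [k.+1] in each
    variable. *)
Lemma gradient_potential k P Q : total_degree_le k P -> total_degree_le k Q ->
  dy P = dx Q -> exists W, [/\ total_degree_le k.+1 W, dx W = P & dy W = Q].
Proof.
move=> hP hQ PQ.
pose W : {poly {poly R}} := \poly_(i < k.+2) \poly_(j < k.+2)
  (if i is i'.+1 then P`_i'`_j / i%:R else if j is j'.+1 then Q`_0`_j' / j%:R else 0).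
have nz n : n.+1%:R != 0 :> R by rewrite pnatr_eq0.
have WE i j : W`_i`_j = if i is i'.+1 then P`_i'`_j / i%:R else
    if j is j'.+1 then Q`_0`_j' / j%:R else 0.
  rewrite /W coef_poly; have [ik|ik] := ltnP i k.+2.
    rewrite coef_poly; have [jk|jk] := ltnP j k.+2 => //.
    case: i ik => [|i] ik; last by rewrite hP ?mul0r// ltn_addl// ltnW.
    by case: j jk => // j jk; rewrite hQ ?mul0r.
  rewrite coef0; case: i ik => // i ik; rewrite hP ?mul0r//.
  by rewrite ltn_addr.
exists W; split.
- move=> [|i] [|j] // ij; rewrite WE.
  + by rewrite hQ ?mul0r.
  + by rewrite hP ?mul0r.
  + by rewrite hP ?mul0r.
- by apply: eq_poly2 => i j; rewrite dxE WE -[LHS]mulr_natr divfK.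
- apply: eq_poly2 => i j; rewrite dyE WE -[LHS]mulr_natr.
  case: i => [|i]; first by rewrite divfK.
  have := congr1 (fun p : {poly {poly R}} => p`_i`_j) PQ.
  rewrite dyE dxE => /(congr1 (fun r => r / i.+1%:R)).
  by rewrite -[X in X / _ = _ -> _]mulr_natr -[X in _ = X / _ -> _]mulr_natr mulfK// => <-; ring.
Qed.

(** The pullback of [P] by [seg_point u v], kept as a polynomial so that formal derivatives and ring
    identities remain available. *)
Definition restr u v P : {poly R} :=
  (map_poly (comp_poly (u.2%:P + (v.2 - u.2) *: 'X)) P).[u.1%:P + (v.1 - u.1) *: 'X].

Lemma restrD u v P Q : restr u v (P + Q) = restr u v P + restr u v Q.
Proof. by rewrite /restr rmorphD hornerD. Qed.

Lemma restrB u v P Q : restr u v (P - Q) = restr u v P - restr u v Q.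
Proof. by rewrite /restr rmorphB hornerD hornerN. Qed.

Lemma restrM u v P Q : restr u v (P * Q) = restr u v P * restr u v Q.
Proof. by rewrite /restr rmorphM hornerM. Qed.

Lemma restr_cst u v c : restr u v (cst2 c) = c%:P.
Proof. by rewrite /restr /cst2 map_polyC hornerC /= comp_polyC. Qed.

Lemma restr0 u v : restr u v 0 = 0.
Proof. by rewrite /restr rmorph0 horner0. Qed.

Lemma restr_ind u v P (q : {poly R}) : restr u v (P * 'X + q%:P) =
  restr u v P * (u.1%:P + (v.1 - u.1) *: 'X) + (q \Po (u.2%:P + (v.2 - u.2) *: 'X)).
Proof. by rewrite /restr rmorphD rmorphM /= map_polyX map_polyC hornerMXaddC. Qed.

Lemma seg_pointE u v t : seg_point u v t =
  (u.1 + (v.1 - u.1) * t, u.2 + (v.2 - u.2) * t).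
Proof.
rewrite /seg_point; apply/eqP; rewrite xpair_eqE; apply/andP.
by split; apply/eqP; rewrite /= /GRing.scale /=; ring.
Qed.

Lemma restrE u v P t : (restr u v P).[t] = eval2 P (seg_point u v t).
Proof.
elim/poly_ind: P => [|P q IH]; first by rewrite restr0 horner0 eval2_0.
rewrite restr_ind eval2_ind hornerD hornerM IH horner_comp seg_pointE /=.
by rewrite !hornerE.
Qed.

Lemma restr_deriv u v P : (restr u v P)^`() =
  (v.1 - u.1) *: restr u v (dx P) + (v.2 - u.2) *: restr u v (dy P).
Proof.
elim/poly_ind: P => [|P q IH].
  have -> : dx (0 : {poly {poly R}}) = 0 by exact: linear0.
  have -> : dy (0 : {poly {poly R}}) = 0 by rewrite /dy map_poly0.
  by rewrite restr0 deriv0 !scaler0 addr0.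
have -> : dx (P * 'X + q%:P) = dx P * 'X + P by rewrite /dx derivMXaddC addrC.
have -> : dy (P * 'X + q%:P) = dy P * 'X + q^`()%:P.
  apply/polyP => i; rewrite /dy coef_map_id0 ?deriv0// !coefD !coefMX !coefC.
  by case: i => [|i] /=; rewrite ?add0r ?addr0// coef_map_id0 ?deriv0.
rewrite [in LHS]restr_ind derivD derivM IH deriv_comp restrD [in RHS]restr_ind.
have -> : restr u v (dx P * 'X) = restr u v (dx P) * (u.1%:P + (v.1 - u.1) *: 'X).
  by rewrite -[dx P * 'X]addr0 -polyC0 restr_ind comp_polyC addr0.
rewrite !derivD !derivC !derivZ !derivX -!mul_polyC; ring.
Qed.

End BivariatePolynomials.

(** * Moments on an edge *)

Section IntervalIntegral.
Variable R : realType.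
Implicit Types p q : {poly R}.

Definition poly_int p : R := \int[@lebesgue_measure R]_(t in `[0, 1]) p.[t].

Lemma poly_int_deriv p : poly_int p^`() = p.[1] - p.[0].
Proof.
rewrite /poly_int /Rintegral (@continuous_FTC2 _ _ (horner p))//.
- by apply: continuous_subspaceT => x; exact: continuous_horner.
- split => [x _||].
  + exact: ex_derive.
  + by apply: cvg_at_right_filter; exact: continuous_horner.
  + by apply: cvg_at_left_filter; exact: continuous_horner.
- by move=> x _; rewrite derive1E derive_val.
Qed.

(** Writing integrands as derivatives reduces the linearity of [poly_int] to end values, with no
    discussion of integrability. *)
Lemma poly_primitive p : exists P, P^`() = p.
Proof.
exists (\poly_(i < (size p).+1) (p`_i.-1 / i%:R)); apply/polyP => i.
rewrite coef_deriv coef_poly ltnS /=; case: ltnP => ip.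
  by rewrite -[LHS]mulr_natr divfK ?pnatr_eq0.
by rewrite mul0rn nth_default.
Qed.

Lemma poly_intD p q : poly_int (p + q) = poly_int p + poly_int q.
Proof.
have [P <-] := poly_primitive p; have [Q <-] := poly_primitive q.
by rewrite -derivD !poly_int_deriv !hornerD; ring.
Qed.

Lemma poly_intZ c p : poly_int (c *: p) = c * poly_int p.
Proof.
have [P <-] := poly_primitive p.
by rewrite -derivZ !poly_int_deriv !hornerZ; ring.
Qed.

Lemma poly_intB p q : poly_int (p - q) = poly_int p - poly_int q.
Proof. by rewrite poly_intD -scaleN1r poly_intZ mulN1r. Qed.

Lemma poly_intC c : poly_int c%:P = c.
Proof. by rewrite -[c%:P]mulr1 mul_polyC -derivX poly_intZ poly_int_deriv !hornerX subr0 mulr1. Qed.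

End IntervalIntegral.

Section EdgeMoments.
Variables (R : realType) (u v : R * R).
Implicit Types (P Q d q : {poly {poly R}}).

Definition edge_moment P : R := poly_int (restr u v P).

Lemma edge_momentD P Q : edge_moment (P + Q) = edge_moment P + edge_moment Q.
Proof. by rewrite /edge_moment restrD poly_intD. Qed.

Lemma edge_momentB P Q : edge_moment (P - Q) = edge_moment P - edge_moment Q.
Proof. by rewrite /edge_moment restrB poly_intB. Qed.

Lemma edge_momentZ c P : edge_moment (cst2 c * P) = c * edge_moment P.
Proof. by rewrite /edge_moment restrM restr_cst mul_polyC poly_intZ. Qed.

Lemma edge_moment_cst c : edge_moment (cst2 c) = c.
Proof. by rewrite /edge_moment restr_cst poly_intC. Qed.

Lemma seg_point0 : seg_point u v 0 = u.
Proof. by rewrite /seg_point subr0 scale1r scale0r addr0. Qed.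

Lemma seg_point1 : seg_point u v 1 = v.
Proof. by rewrite /seg_point subrr scale0r scale1r add0r. Qed.

Lemma edge_moment_grad P :
  (v.1 - u.1) * edge_moment (dx P) + (v.2 - u.2) * edge_moment (dy P) =
  eval2 P v - eval2 P u.
Proof.
rewrite /edge_moment -!poly_intZ -poly_intD -restr_deriv poly_int_deriv.
by rewrite !restrE seg_point0 seg_point1.
Qed.

(** Integration by parts along the edge. The tangential derivative of [q] is constant, so only the
    mean of [d] survives. *)
Lemma edge_moment_parts q d : total_degree_le 1 q ->
  (v.1 - u.1) * edge_moment (q * dx d) + (v.2 - u.2) * edge_moment (q * dy d) =
  eval2 q v * eval2 d v - eval2 q u * eval2 d u -
  ((v.1 - u.1) * q`_1`_0 + (v.2 - u.2) * q`_0`_1) * edge_moment d.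
Proof.
move=> q1; rewrite -!eval2M -edge_moment_grad dxM dyM !edge_momentD.
by rewrite (degree1_dx q1) (degree1_dy q1) !edge_momentZ; ring.
Qed.

(* Testing with the linear polynomial of gradient [v - u] isolates the mean. *)
Lemma edge_mean_eq0 d : u != v -> eval2 d u = 0 -> eval2 d v = 0 ->
  (forall q, total_degree_le 1 q ->
    (v.1 - u.1) * edge_moment (q * dx d) + (v.2 - u.2) * edge_moment (q * dy d) = 0) ->
  edge_moment d = 0.
Proof.
move=> uv du dv h.
pose q : {poly {poly R}} := cst2 (v.1 - u.1) * 'X + ((v.2 - u.2) *: 'X)%:P.
have qE i j : q`_i`_j = if (i == 1%N) && (j == 0%N) then v.1 - u.1 else
    if (i == 0%N) && (j == 1%N) then v.2 - u.2 else 0.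
  rewrite /q coefD coefD coefMX [(_ *: 'X)%:P`_i]coefC.
  case: i => [|[|i]] /=; rewrite ?coef0 ?add0r ?addr0.
  - by rewrite coefZ coefX; case: eqP => _; rewrite ?mulr1 ?mulr0.
  - by rewrite cst2E /=; case: eqP.
  - by rewrite cst2E.
have q1 : total_degree_le 1 q by move=> [|[|i]] [|[|j]] // _; rewrite qE.
have := h _ q1; rewrite edge_moment_parts// du dv !qE /= !mulr0 subrr sub0r => /eqP.
rewrite oppr_eq0 mulf_eq0 => /orP[|/eqP//].
rewrite -!expr2 paddr_eq0 ?sqr_ge0// !sqrf_eq0 !subr_eq0 => /andP[/eqP e1 /eqP e2].
by case/negP: uv; apply/eqP; rewrite (surjective_pairing u) (surjective_pairing v) e1 e2.
Qed.

(** Converse to [edge_mean_eq0]; the two lemmas together translate between conditions on a function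
    and on its tangential derivative. *)
Lemma edge_tangential_eq0 q d : total_degree_le 1 q ->
  eval2 d u = 0 -> eval2 d v = 0 -> edge_moment d = 0 ->
  (v.1 - u.1) * edge_moment (q * dx d) + (v.2 - u.2) * edge_moment (q * dy d) = 0.
Proof. by move=> q1 du dv dm; rewrite edge_moment_parts// du dv dm; ring. Qed.

(* The tangential and the normal component determine a vector. *)
Lemma rotated_system_eq0 (A B : R) : u != v ->
  (v.1 - u.1) * A + (v.2 - u.2) * B = 0 ->
  (v.2 - u.2) * A - (v.1 - u.1) * B = 0 -> A = 0 /\ B = 0.
Proof.
move=> uv e1 e2; set s := v.1 - u.1 in e1 e2; set t := v.2 - u.2 in e1 e2.
have n0 : s ^+ 2 + t ^+ 2 != 0.
  rewrite paddr_eq0 ?sqr_ge0// !sqrf_eq0 !subr_eq0.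
  apply: contra uv => /andP[/eqP e /eqP f].
  by rewrite (surjective_pairing u) (surjective_pairing v) e f.
split; apply: (mulfI n0); rewrite mulr0.
  have -> : (s ^+ 2 + t ^+ 2) * A = s * (s * A + t * B) + t * (t * A - s * B) by ring.
  by rewrite e1 e2; ring.
have -> : (s ^+ 2 + t ^+ 2) * B = t * (s * A + t * B) - s * (t * A - s * B) by ring.
by rewrite e1 e2; ring.
Qed.

End EdgeMoments.

Section PolynomialIdentity.
Variable R : realType.

Lemma many_roots (D : idomainType) (p : {poly D}) (s : nat -> D) :
  injective s -> (forall n, root p (s n)) -> p = 0.
Proof.
move=> s_inj ps; apply/eqP/negPn/negP => p0.
have := max_poly_roots p0 (rs := map s (iota 0 (size p))).
rewrite size_map size_iota ltnn => h; suff : false by []; apply: h.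
  by apply/allP => _ /mapP[n _ ->].
by rewrite map_inj_uniq ?iota_uniq.
Qed.

Lemma eval2_eq0 (P : {poly {poly R}}) (x : R * R) :
  (\forall y \near x, eval2 P y = 0) -> P = 0.
Proof.
move=> /nbhs_ballP[e /= e0 he].
(* Infinitely many distinct points; the shift by 2 keeps them strictly within distance [e] already
   for [n = 0]. *)
pose s (a : R) n := a + e / n.+2%:R.
have s_inj a : injective (s a).
  move=> n m /addrI /(mulfI (lt0r_neq0 e0)) /invr_inj /eqP.
  by rewrite eqr_nat => /eqP[].
have sb a n : `|a - s a n| < e.
  rewrite /s opprD addrA subrr sub0r normrN gtr0_norm ?divr_gt0//.
  by rewrite ltr_pdivrMr// ltr_pMr// ltr1n.
have P0 n : P.[(s x.1 n)%:P] = 0.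
  apply: (many_roots (s := s x.2)) => // m; apply/rootP.
  by apply: (he (s x.1 n, s x.2 m)); split; rewrite -ball_normE /=; exact: sb.
apply: (many_roots (s := fun n => (s x.1 n)%:P)) => [n m|n]; last exact/rootP.
by move=> /polyC_inj/s_inj.
Qed.

End PolynomialIdentity.

(** * The inner products *)

Section Eval.
Variable R : realType.
Implicit Types P : {poly {poly R}}.

Lemma continuous_eval2 P : continuous (eval2 P).
Proof.
elim/poly_ind: P => [|P q IH] x.
  rewrite (_ : eval2 0 = cst 0); first exact: cvg_cst.
  by apply/funext => y; rewrite eval2_0.
rewrite (_ : eval2 (P * 'X + q%:P) = fun y => eval2 P y * y.1 + q.[y.2]); last first.
  by apply/funext => y; rewrite eval2_ind.
apply: cvgD; first by apply: cvgM; [exact: IH|exact: cvg_fst].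
apply: (@continuous_comp _ _ _ snd (horner q)); first exact: cvg_snd.
exact: continuous_horner.
Qed.

Lemma measurable_eval2 P : measurable_fun [set: R * R] (eval2 P).
Proof.
elim/poly_ind: P => [|P q IH].
  rewrite (_ : eval2 0 = cst 0); first exact: measurable_cst.
  by apply/funext => y; rewrite eval2_0.
rewrite (_ : eval2 (P * 'X + q%:P) = fun y => eval2 P y * y.1 + q.[y.2]); last first.
  by apply/funext => y; rewrite eval2_ind.
apply: measurable_funD; first by apply: measurable_funM => //; exact: measurable_fst.
by apply: (measurableT_comp (f := horner q)); [exact: measurable_poly|exact: measurable_snd].
Qed.

Lemma bounded_horner (q : {poly R}) (M : R) : exists K, forall t, `|t| <= M -> `|q.[t]| <= K.
Proof.
elim/poly_ind: q => [|q c [K IH]]; first by exists 0 => t _; rewrite horner0 normr0.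
exists (K * M + `|c|) => t tM; rewrite hornerMXaddC (le_trans (ler_normD _ _))//.
by rewrite lerD// normrM ler_pM// IH.
Qed.

Lemma bounded_eval2 P (M : R) :
  exists K, forall x, `|x.1| <= M -> `|x.2| <= M -> `|eval2 P x| <= K.
Proof.
elim/poly_ind: P => [|P q [K IH]]; first by exists 0 => t _ _; rewrite eval2_0 normr0.
have [L hL] := bounded_horner q M.
exists (K * M + L) => x x1 x2; rewrite eval2_ind (le_trans (ler_normD _ _))//.
by rewrite lerD ?hL// normrM ler_pM// IH.
Qed.

End Eval.

Section Integrals.
Variables (R : realType) (V : finType) (pt : V -> R * R).
Variables (Th : {set {set V}}) (Omega : set (R * R)).
Hypothesis tri : triangulation pt Th Omega.
Hypotheses (Oreg : regopen Omega) (Obd : bounded_set Omega).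
Implicit Types (T : cell Th) (u v w : pwpoly R Th) (x : R * R).
Notation tric := (tric pt).
Notation lin := (lin pt).
Notation bary := (bary pt).
Notation inner T := (hull pt (val T))°.

Lemma inner_uniq T T' x : inner T x -> inner T' x -> T = T'.
Proof.
move=> /(interior_hullP tri) h h'; apply: (interior_cell_eq tri h).
exact: nbhs_singleton h'.
Qed.

Lemma inner_Omega T x : inner T x -> Omega x.
Proof. by move=> /(interior_hullP tri)/(positive_bary_Omega tri Oreg). Qed.

Lemma inner_ex T : exists x, inner T x.
Proof. by have [m /(interior_hullP tri)] := centroid tri T; exists m. Qed.

Lemma pwfun_inner w T x : inner T x -> pwfun pt w x = eval2 (w T) x.
Proof.
move=> Tx; rewrite /pwfun (big_pred1 T)// => T'.
apply/idP/eqP => [/set_mem Tx'|->]; first exact: inner_uniq Tx' Tx.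
by rewrite inE.
Qed.

Lemma pwfun_skeleton w x : (forall T, ~ inner T x) -> pwfun pt w x = 0.
Proof. by move=> h; rewrite /pwfun big_pred0// => T; apply/negP => /set_mem; exact: h. Qed.

Lemma pwfun_out w x : ~ Omega x -> pwfun pt w x = 0.
Proof. by move=> nO; apply: pwfun_skeleton => T /inner_Omega. Qed.

Definition pwmul u v : pwpoly R Th := [ffun T => u T * v T].
Definition pwcst (c : R) : pwpoly R Th := [ffun=> cst2 c].

Lemma pwfunD u v x : pwfun pt (u + v) x = pwfun pt u x + pwfun pt v x.
Proof. by rewrite /pwfun -big_split; apply: eq_bigr => T _; rewrite ffunE eval2D. Qed.

Lemma pwfun_mul u v x : pwfun pt (pwmul u v) x = pwfun pt u x * pwfun pt v x.
Proof.
have [[T Tx]|n] := pselect (exists T, inner T x).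
  by rewrite !(pwfun_inner _ Tx) ffunE eval2M.
by rewrite !pwfun_skeleton ?mulr0// => T Tx; apply: n; exists T.
Qed.

Lemma pwfunZ c u x : pwfun pt (pwmul (pwcst c) u) x = c * pwfun pt u x.
Proof.
by rewrite /pwfun mulr_sumr; apply: eq_bigr => T _; rewrite !ffunE eval2M eval2_cst.
Qed.

Lemma measurable_lin a b : measurable_fun [set: R * R] (lin a b).
Proof.
rewrite (_ : lin a b = fun x => (pt b - pt a).1 * (x.2 - (pt a).2) -
  (pt b - pt a).2 * (x.1 - (pt a).1))//.
apply: measurable_funB; apply: measurable_funM => //; exact: measurable_funB.
Qed.

Lemma measurable_inner T : measurable (inner T).
Proof.
have [a [b [c t]]] := tric_ex tri T.
have pos p q : measurable [set x | 0 < lin p q x].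
  rewrite (_ : [set x | _] = lin p q @^-1` `]0, +oo[%classic).
    by rewrite -[X in measurable X]setTI; exact: measurable_lin.
  by apply/seteqP; split => x /=; rewrite in_itv /= andbT.
rewrite (_ : inner T = [set x | 0 < lin a b x] `&` [set x | 0 < lin b c x] `&`
  [set x | 0 < lin c a x]); first by do 2?apply: measurableI; exact: pos.
have D := tric_gt0 t; have D' : 0 < lin b c (pt a) by rewrite lin_rot.
have D'' : 0 < lin c a (pt b) by rewrite lin_rot.
have [aT bT cT] := tric_mem t.
have e x := baryE x t; have e' x := baryE x (tric_rot t).
have e'' x := baryE x (tric_rot (tric_rot t)).
apply/seteqP; split => x.
  move=> /(interior_hullP tri) h; have := h _ aT; have := h _ bT; have := h _ cT.
  by rewrite e e' e'' !pmulr_lgt0 ?invr_gt0.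
move=> [[h1 h2] h3]; apply/(interior_hullP tri) => d /(tric_inv t)[]->.
- by rewrite e divr_gt0.
- by rewrite e' divr_gt0.
- by rewrite e'' divr_gt0.
Qed.

Lemma measurable_pwfun w : measurable_fun [set: R * R] (pwfun pt w).
Proof.
rewrite (_ : pwfun pt w = fun x => \sum_T eval2 (w T) x * \1_(inner T) x).
  apply: measurable_sum => T; apply: measurable_funM; first exact: measurable_eval2.
  by apply: measurable_indic; exact: measurable_inner.
apply/funext => x; rewrite /pwfun big_mkcond; apply: eq_bigr => T _.
by rewrite indicE; case: ifP => _; rewrite ?mulr1 ?mulr0.
Qed.

(** The function is bounded, being polynomial on each of finitely many cells, and vanishes outside a
    square of finite measure. *)
Lemma integrable_pwfun w : (@mu2 R).-integrable [set: R * R] (EFin \o pwfun pt w).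
Proof.
have [M hM] : exists M : R, forall x, Omega x -> `|x.1| <= M /\ `|x.2| <= M.
  (* [bounded_set] gives a bound by every number above [M], whence [M + 1]; the sup norm then bounds
     both coordinates. *)
  have [M [_ hM]] := Obd; exists (M + 1) => x Ox.
  have MM : M < M + 1 by rewrite ltrDl ltr01.
  have h : `|x| <= M + 1 := hM _ MM x Ox.
  by split; apply: le_trans h; rewrite prod_normE le_max lexx ?orbT.
pose B : set (R * R) := `[- M, M] `*` `[- M, M].
have mB : measurable B by apply: measurableX; exact: measurable_itv.
have BP x : B x <-> `|x.1| <= M /\ `|x.2| <= M.
  by rewrite /B /= !in_itv /= -!ler_norml; split => [[]|[]].
have fin : (@mu2 R B < +oo)%E.
  rewrite /mu2 product_measure1E//; try exact: measurable_itv.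
  have [r hr] : exists r, @lebesgue_measure R `[- M, M]%classic = r%:E.
    rewrite lebesgue_measure_itv /=; case: ifP => _; last by exists 0.
    by exists (M - - M); rewrite EFinB.
  by rewrite [X in (X * _)%E]hr [X in (_ * X)%E]hr -EFinM ltry.
have [K hK] : exists K, forall x, `|pwfun pt w x| <= K.
  have [k hk] : exists k : cell Th -> R, forall T x, B x -> `|eval2 (w T) x| <= k T.
    have ex T : exists k, forall x, B x -> `|eval2 (w T) x| <= k.
      have [k hk] := bounded_eval2 (w T) M; exists k => x /BP[]; exact: hk.
    by exists (fun T => sval (cid (ex T))) => T; case: cid.
  exists (\sum_T `|k T|) => x.
  have [[T Tx]|n] := pselect (exists T, inner T x); last first.
    by rewrite pwfun_skeleton ?normr0 ?sumr_ge0// => T Tx; apply: n; exists T.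
  rewrite (pwfun_inner _ Tx) (bigD1 T)//= ler_wpDr ?sumr_ge0//.
  rewrite (le_trans (hk _ _ _)) ?ler_norm//; apply/BP; apply: hM.
  exact: inner_Omega Tx.
have : (@mu2 R).-integrable B (EFin \o pwfun pt w).
  apply: measurable_bounded_integrable => //.
    exact: measurable_funS (measurable_pwfun w).
  exists K; split; first exact: num_real.
  by move=> N KN x Bx /=; rewrite (le_trans (hK x))// ltW.
rewrite integrable_mkcond//.
rewrite (_ : (EFin \o pwfun pt w) \_ B = EFin \o pwfun pt w)//.
apply/funext => x; rewrite patchE; case: ifPn => //= /negP xB.
by rewrite pwfun_out// => /hM/BP; rewrite -in_setE.
Qed.

(** The whole plane can serve as domain because [pwfun] vanishes off [Omega]; the inner products of
    piecewise polynomials reduce to this functional. *)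
Definition pw_int w : R := \int[@mu2 R]_x pwfun pt w x.

Lemma int_Omega_pwfun w : \int[@mu2 R]_(x in Omega) pwfun pt w x = pw_int w.
Proof.
rewrite /pw_int /Rintegral integral_mkcond; congr (fine _); apply: eq_integral => x _.
by rewrite patchE; case: ifPn => // /negP; rewrite in_setE => nO; rewrite pwfun_out.
Qed.

Lemma ip_scaE u v : ip_sca pt Omega u v = pw_int (pwmul u v).
Proof.
rewrite /ip_sca /ip -int_Omega_pwfun; apply: eq_Rintegral => x _.
by rewrite pwfun_mul.
Qed.

Lemma pw_intD u v : pw_int (u + v) = pw_int u + pw_int v.
Proof.
rewrite /pw_int -RintegralD//; try exact: integrable_pwfun.
by apply: eq_Rintegral => x _; rewrite pwfunD.
Qed.

Lemma pw_intZ c u : pw_int (pwmul (pwcst c) u) = c * pw_int u.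
Proof.
rewrite /pw_int -RintegralZl//; try exact: integrable_pwfun.
by apply: eq_Rintegral => x _; rewrite pwfunZ.
Qed.

Lemma pw_int_sqr_ge0 u : 0 <= pw_int (pwmul u u).
Proof.
by apply: Rintegral_ge0 => x _; rewrite pwfun_mul -expr2 sqr_ge0.
Qed.

Lemma mu2_near_gt0 (A : set (R * R)) x : (\forall y \near x, A y) ->
  ~ (@mu2 R).-negligible A.
Proof.
move=> /nbhs_ballP[e /= e0 he] [N [mN N0 AN]].
pose B : set (R * R) := ball x.1 e `*` ball x.2 e.
have mB : measurable B by apply: measurableX; exact: measurable_ball.
have BN : B `<=` N by move=> y [y1 y2]; apply/AN/he.
have : (@mu2 R B <= @mu2 R N)%E by apply: le_measure; rewrite ?inE.
rewrite N0 leNgt => /negP; apply.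
rewrite /mu2 product_measure1E//; try exact: measurable_ball.
have hb a : @lebesgue_measure R (ball a e) = (e *+ 2)%:E.
  by apply: lebesgue_measure_ball; exact: ltW.
rewrite [X in (X * _)%E]hb [X in (_ * X)%E]hb -EFinM lte_fin.
by rewrite mulr_gt0// mulrn_wgt0.
Qed.

(** The square vanishes almost everywhere. By continuity a nonzero value inside a cell would persist
    on a ball, which is not negligible; and a polynomial that vanishes near a point is 0. *)
Lemma pw_int_definite u : pw_int (pwmul u u) = 0 -> u = 0.
Proof.
move=> h.
pose f := pwfun pt (pwmul u u).
have f0 x : 0 <= f x by rewrite /f pwfun_mul -expr2 sqr_ge0.
have mf : measurable_fun [set: R * R] (EFin \o f).
  by apply/measurable_EFinP; exact: measurable_pwfun.
have f_int0 : (\int[@mu2 R]_x `|(EFin \o f) x|)%E = 0%E.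
  transitivity (\int[@mu2 R]_x (EFin \o f) x)%E.
    by apply: eq_integral => x _ /=; rewrite ger0_norm.
  rewrite -[LHS]fineK; first by congr (_%:E).
  exact: integrable_fin_num (integrable_pwfun _).
have ae := (ae_eq_integral_abs (@mu2 R) measurableT mf).1 f_int0.
apply/ffunP => T; rewrite ffunE.
have [m Tm] := inner_ex T.
have Tnear y : inner T y -> \forall z \near y, inner T z.
  by move=> Ty; apply: open_nbhs_nbhs; split => //; exact: open_interior.
apply: (eval2_eq0 (x := m)); have := Tnear _ Tm; apply: filterS => y Ty.
apply: contrapT => /eqP ny; apply: (mu2_near_gt0 _ ae (x := y)).
have nn : \forall z \near y, eval2 (u T) z != 0.
  have nr : \forall r \near eval2 (u T) y, r != 0.
    by apply: open_nbhs_nbhs; split => //; exact: open_neq.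
  exact: (@continuous_eval2 _ (u T) y _ nr).
near=> z => /= /(_ I) /=.
have Tz : inner T z by near: z; exact: Tnear.
have uz : eval2 (u T) z != 0 by near: z.
by rewrite /f (pwfun_inner _ Tz) ffunE eval2M => -[/eqP]; rewrite mulf_eq0 (negPf uz).
Unshelve. all: by end_near. Qed.

End Integrals.

(** * The finite element spaces *)

Section EdgeConditions.
Variables (R : realType) (V : finType) (pt : V -> R * R).
Variables (Th : {set {set V}}) (Omega : set (R * R)).
Hypothesis tri : triangulation pt Th Omega.
Implicit Types (T : cell Th) (a b c : V) (w : pwpoly R Th) (psi : pwvec R Th).
Implicit Types (P Q q : {poly {poly R}}).
Notation iedge := (interior_edge pt Th Omega).
Notation bedge := (boundary_edge pt Th Omega).
Notation moment a b := (edge_moment (pt a) (pt b)).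

Lemma vertices_neq T a b : a \in val T -> b \in val T -> a != b -> pt a != pt b.
Proof.
move=> aT bT ab; apply/eqP => E; have := bary_pt0 tri aT bT ab.
by rewrite E (bary_pt tri bT) => /eqP; rewrite oner_eq0.
Qed.

Lemma enorm_neq0 (u v : R * R) : u != v -> enorm (v - u) != 0.
Proof.
move=> uv; rewrite /enorm sqrtr_eq0 -ltNge /dot -!expr2 /=.
rewrite lt_neqAle addr_ge0 ?sqr_ge0// andbT eq_sym paddr_eq0 ?sqr_ge0//.
rewrite !sqrf_eq0 !subr_eq0; apply: contra uv => /andP[/eqP e /eqP f].
by rewrite (surjective_pairing u) (surjective_pairing v) e f.
Qed.

Lemma edge_int_eval2 a b (g : R * R -> R) P : (forall x, g x = eval2 P x) ->
  edge_int pt a b g = enorm (pt b - pt a) * moment a b P.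
Proof.
move=> gP; rewrite /edge_int /edge_moment /poly_int; congr (_ * _).
by apply: eq_Rintegral => t _; rewrite gP restrE.
Qed.

(** The length factor of the edge integral cancels the normalization of the tangent, leaving an
    expression polynomial in the coordinates. *)
Lemma edge_int_tangent a b P Q q (g : R * R -> R) : pt a != pt b ->
  (forall x, g x = eval2 q x * dot (eval2 P x, eval2 Q x) (tangent pt a b)) ->
  edge_int pt a b g = ((pt b).1 - (pt a).1) * moment a b (q * P) +
                      ((pt b).2 - (pt a).2) * moment a b (q * Q).
Proof.
move=> /enorm_neq0 n0 gE; pose n := (enorm (pt b - pt a))^-1.
rewrite (@edge_int_eval2 _ _ _ (cst2 (n * ((pt b).1 - (pt a).1)) * (q * P) +
  cst2 (n * ((pt b).2 - (pt a).2)) * (q * Q))).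
  rewrite edge_momentD !edge_momentZ mulrDr !mulrA mulfV// !mul1r.
  by [].
move=> x; rewrite gE eval2D !eval2M !eval2_cst /dot /tangent /= /GRing.scale /= -/n.
ring.
Qed.

Lemma edge_int_normal a b P Q q (g : R * R -> R) : pt a != pt b ->
  (forall x, g x = eval2 q x * dot (eval2 P x, eval2 Q x) (normal pt a b)) ->
  edge_int pt a b g = ((pt b).2 - (pt a).2) * moment a b (q * P) -
                      ((pt b).1 - (pt a).1) * moment a b (q * Q).
Proof.
move=> /enorm_neq0 n0 gE; pose n := (enorm (pt b - pt a))^-1.
rewrite (@edge_int_eval2 _ _ _ (cst2 (n * ((pt b).2 - (pt a).2)) * (q * P) -
  cst2 (n * ((pt b).1 - (pt a).1)) * (q * Q))).
  rewrite edge_momentB !edge_momentZ mulrBr !mulrA mulfV// !mul1r.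
  by [].
move=> x; rewrite gE eval2B !eval2M !eval2_cst /dot /normal /tangent /= /GRing.scale /= -/n.
ring.
Qed.

Lemma jump_valP k w : jump_moments pt Omega k (tr_val w) <->
  forall a b T T' q, iedge a b -> T != T' -> a \in val T -> b \in val T ->
    a \in val T' -> b \in val T' -> total_degree_le k q ->
    moment a b (q * (w T - w T')) = 0.
Proof.
have E a b T T' q : edge_int pt a b (fun x => eval2 q x * (tr_val w a b T x - tr_val w a b T' x)) =
    enorm (pt b - pt a) * moment a b (q * (w T - w T')).
  by apply: edge_int_eval2 => x; rewrite eval2M eval2B.
split => h a b T T' q ie TT' aT bT aT' bT' qk.
  have := h a b T T' q ie TT' aT bT aT' bT' qk; rewrite E => /eqP.
  have [ab _] := ie.1.
  by rewrite mulf_eq0 (negPf (enorm_neq0 (vertices_neq aT bT ab))) => /eqP.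
by rewrite E h// mulr0.
Qed.

Lemma jump_dnP w : jump_moments pt Omega 1 (tr_dn pt w) <->
  forall a b T T' q, iedge a b -> T != T' -> a \in val T -> b \in val T ->
    a \in val T' -> b \in val T' -> total_degree_le 1 q ->
    ((pt b).2 - (pt a).2) * moment a b (q * dx (w T - w T')) -
    ((pt b).1 - (pt a).1) * moment a b (q * dy (w T - w T')) = 0.
Proof.
have E a b T T' q : pt a != pt b ->
    edge_int pt a b (fun x => eval2 q x * (tr_dn pt w a b T x - tr_dn pt w a b T' x)) =
    ((pt b).2 - (pt a).2) * moment a b (q * dx (w T - w T')) -
    ((pt b).1 - (pt a).1) * moment a b (q * dy (w T - w T')).
  move=> ab; apply: edge_int_normal => // x.
  by rewrite dxB dyB !eval2B /tr_dn /dot /=; ring.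
split => h a b T T' q ie TT' aT bT aT' bT' qk; have [ab _] := ie.1.
  by rewrite -E ?h//; exact: vertices_neq aT bT ab.
by rewrite E ?h//; exact: vertices_neq aT bT ab.
Qed.

Lemma boundary_valP w : boundary_moments pt Omega 0 (tr_val w) <->
  forall a b T, bedge a b -> a \in val T -> b \in val T -> moment a b (w T) = 0.
Proof.
have E a b T q : edge_int pt a b (fun x => eval2 q x * tr_val w a b T x) =
    enorm (pt b - pt a) * moment a b (q * w T).
  by apply: edge_int_eval2 => x; rewrite eval2M.
split => h a b T; last first.
  move=> q be aT bT /degree0->.
  by rewrite E edge_momentZ h// !mulr0.
move=> be aT bT; have := h a b T (cst2 1) be aT bT (degree_cst 1).
have [ab _] := be.1.
rewrite E edge_momentZ mul1r => /eqP.
by rewrite mulf_eq0 (negPf (enorm_neq0 (vertices_neq aT bT ab))) => /eqP.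
Qed.

Lemma boundary_tanP psi : boundary_moments pt Omega 1 (tr_tan pt psi) <->
  forall a b T q, bedge a b -> a \in val T -> b \in val T -> total_degree_le 1 q ->
    ((pt b).1 - (pt a).1) * moment a b (q * psi.1 T) +
    ((pt b).2 - (pt a).2) * moment a b (q * psi.2 T) = 0.
Proof.
have E a b T q : pt a != pt b ->
    edge_int pt a b (fun x => eval2 q x * tr_tan pt psi a b T x) =
    ((pt b).1 - (pt a).1) * moment a b (q * psi.1 T) +
    ((pt b).2 - (pt a).2) * moment a b (q * psi.2 T).
  by move=> ab; apply: edge_int_tangent.
split => h a b T q be aT bT qk; have [ab _] := be.1.
  by rewrite -E ?h//; exact: vertices_neq aT bT ab.
by rewrite E ?h//; exact: vertices_neq aT bT ab.
Qed.

Lemma boundary_edge_vertices a b : bedge a b ->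
  boundary_vertex pt Omega a /\ boundary_vertex pt Omega b.
Proof.
move=> [_ sub]; split; apply: sub.
  by exists 0; rewrite ?seg_point0 //= in_itv /= lexx ler01.
by exists 1; rewrite ?seg_point1 //= in_itv /= lexx ler01.
Qed.

Lemma mean_jump k w a b T T' : jump_moments pt Omega k (tr_val w) -> iedge a b -> T != T' ->
  a \in val T -> b \in val T -> a \in val T' -> b \in val T' ->
  moment a b (w T - w T') = 0.
Proof.
move=> /jump_valP h ie TT' aT bT aT' bT'.
have := h a b T T' (cst2 1) ie TT' aT bT aT' bT' (degree_cst 1).
by rewrite edge_momentZ mul1r.
Qed.

(** The normal part of the jump of the gradient is controlled by the definition of B^3, the
    tangential part by matching vertex values and means. *)
Lemma gradh_B3ht_G2ht w : B3ht pt Omega w -> G2ht pt Omega (gradh w).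
Proof.
move=> [[w3 wc wj wn] wz wb].
have key a b T T' q : iedge a b -> T != T' -> a \in val T -> b \in val T ->
    a \in val T' -> b \in val T' -> total_degree_le 1 q ->
    moment a b (q * (dx (w T) - dx (w T'))) = 0 /\
    moment a b (q * (dy (w T) - dy (w T'))) = 0.
  move=> ie TT' aT bT aT' bT' q1; rewrite -dxB -dyB; have [ab _] := ie.1.
  apply: rotated_system_eq0; first exact: vertices_neq aT bT ab.
    apply: edge_tangential_eq0 => //.
    - by rewrite eval2B (wc a T T')// subrr.
    - by rewrite eval2B (wc b T T')// subrr.
    - exact: (mean_jump wj).
  exact: ((jump_dnP w).1 wn).
split.
- by move=> T; rewrite ffunE; exact: degree_dx.
- by move=> T; rewrite ffunE; exact: degree_dy.
- apply/jump_valP => a b T T' q ie TT' aT bT aT' bT' q1; rewrite !ffunE.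
  by have [] := key a b T T' q ie TT' aT bT aT' bT' q1.
- apply/jump_valP => a b T T' q ie TT' aT bT aT' bT' q1; rewrite !ffunE.
  by have [] := key a b T T' q ie TT' aT bT aT' bT' q1.
apply/boundary_tanP => a b T q be aT bT q1; rewrite !ffunE.
have [fa fb] := boundary_edge_vertices be.
apply: edge_tangential_eq0 => //; [exact: wz|exact: wz|].
exact: ((boundary_valP w).1 wb).
Qed.

(** Once the vertex values match, vanishing affine moments of the tangential derivative force the
    mean of the jump, or of the boundary trace, to vanish. *)
Lemma gradh_G2ht_B3ht w : P_ 3 w -> vertex_continuous pt w -> vertex_zero pt Omega w ->
  G2ht pt Omega (gradh w) -> B3ht pt Omega w.
Proof.
move=> w3 wc wz [_ _ /jump_valP jx /jump_valP jy /boundary_tanP bt].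
have kx a b T T' q : iedge a b -> T != T' -> a \in val T -> b \in val T ->
    a \in val T' -> b \in val T' -> total_degree_le 1 q ->
    moment a b (q * dx (w T - w T')) = 0.
  move=> ie TT' aT bT aT' bT' q1.
  by have := jx a b T T' q ie TT' aT bT aT' bT' q1; rewrite !ffunE -dxB.
have ky a b T T' q : iedge a b -> T != T' -> a \in val T -> b \in val T ->
    a \in val T' -> b \in val T' -> total_degree_le 1 q ->
    moment a b (q * dy (w T - w T')) = 0.
  move=> ie TT' aT bT aT' bT' q1.
  by have := jy a b T T' q ie TT' aT bT aT' bT' q1; rewrite !ffunE -dyB.
split => //; first split => //.
- apply/jump_valP => a b T T' q ie TT' aT bT aT' bT' /degree0->.
  have [ab _] := ie.1.
  rewrite edge_momentZ (@edge_mean_eq0 _ (pt a) (pt b)) ?mulr0//.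
  + exact: vertices_neq aT bT ab.
  + by rewrite eval2B (wc a T T')// subrr.
  + by rewrite eval2B (wc b T T')// subrr.
  + by move=> r r1; rewrite (kx a b T T')// (ky a b T T')// !mulr0 addr0.
- apply/jump_dnP => a b T T' q ie TT' aT bT aT' bT' q1.
  by rewrite (kx a b T T')// (ky a b T T')// !mulr0 subr0.
apply/boundary_valP => a b T be aT bT; have [fa fb] := boundary_edge_vertices be.
have [ab _] := be.1.
apply: edge_mean_eq0; [exact: vertices_neq aT bT ab|exact: wz|exact: wz|].
by move=> q q1; have := bt a b T q be aT bT q1; rewrite !ffunE.
Qed.

Lemma A3h0B v w : A3h0 pt Omega v -> A3h0 pt Omega w -> A3h0 pt Omega (v - w).
Proof.
move=> [v3 vc vz] [w3 wc wz]; split.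
- by move=> T; rewrite !ffunE; exact: degreeB.
- by move=> a T T' aT aT'; rewrite !ffunE !eval2B (vc a T T')// (wc a T T').
- by move=> a T fa aT; rewrite !ffunE eval2B vz// wz// subrr.
Qed.

Lemma gradhB v w : gradh (v - w) = (dxh v - dxh w, dyh v - dyh w).
Proof.
by rewrite /gradh; congr (_, _); apply/ffunP => T; rewrite !ffunE ?dxB ?dyB.
Qed.

Lemma G2htB (phi psi : pwvec R Th) : G2ht pt Omega phi -> G2ht pt Omega psi ->
  G2ht pt Omega (phi.1 - psi.1, phi.2 - psi.2).
Proof.
move=> [p1 p2 /jump_valP pj1 /jump_valP pj2 /boundary_tanP pb].
move=> [s1 s2 /jump_valP sj1 /jump_valP sj2 /boundary_tanP sb].
have sw (A B C D : {poly {poly R}}) : A - B - (C - D) = (A - C) - (B - D) by ring.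
split.
- by move=> T; rewrite !ffunE; exact: degreeB.
- by move=> T; rewrite !ffunE; exact: degreeB.
- apply/jump_valP => a b T T' q ie TT' aT bT aT' bT' q1; rewrite !ffunE sw mulrBr.
  by rewrite edge_momentB pj1// sj1// subrr.
- apply/jump_valP => a b T T' q ie TT' aT bT aT' bT' q1; rewrite !ffunE sw mulrBr.
  by rewrite edge_momentB pj2// sj2// subrr.
apply/boundary_tanP => a b T q be aT bT q1; rewrite !ffunE !mulrBr !edge_momentB.
by have := pb a b T q be aT bT q1; have := sb a b T q be aT bT q1; lra.
Qed.

Lemma B3ht_A3h0 w : B3ht pt Omega w -> A3h0 pt Omega w.
Proof. by move=> [[]]. Qed.

(** Read off from A^3_h0 and G^2_ht through the characterization of B^3_ht by gradients. *)
Lemma B3htB v w : B3ht pt Omega v -> B3ht pt Omega w -> B3ht pt Omega (v - w).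
Proof.
move=> hv hw; have [d3 dc dz] := A3h0B (B3ht_A3h0 hv) (B3ht_A3h0 hw).
apply: gradh_G2ht_B3ht => //; rewrite gradhB.
exact: (G2htB (gradh_B3ht_G2ht hv) (gradh_B3ht_G2ht hw)).
Qed.

End EdgeConditions.

Section Reversal.
Variable R : realType.

Lemma poly_int_affine (c k : R) : poly_int (c%:P + k *: 'X) = c + k / 2.
Proof.
have -> : c%:P + k *: 'X = (c *: 'X + (k / 2) *: 'X^2)^`() :> {poly R}.
  rewrite derivD !derivZ derivX derivXn expr1 alg_polyC; congr (_ + _).
  by rewrite mulr2n scalerDr -scalerDl -splitr.
by rewrite poly_int_deriv !hornerE /= !mulr1 !mulr0 subr0.
Qed.

(** The substitution [t -> 1 - t], carried out on a primitive. The two restrictions are identified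
    as polynomials because they agree at all natural numbers. *)
Lemma edge_momentC (u v : R * R) P : edge_moment v u P = edge_moment u v P.
Proof.
rewrite /edge_moment.
have -> : restr v u P = restr u v P \Po (1 - 'X).
  apply/eqP; rewrite -subr_eq0; apply/eqP.
  apply: (@many_roots _ _ (fun n => n%:R)) => [n m /eqP|n].
    by rewrite eqr_nat => /eqP.
  have sw : seg_point u v (1 - n%:R) = seg_point v u n%:R.
    by rewrite /seg_point subKr addrC.
  by apply/rootP; rewrite hornerD hornerN horner_comp !restrE !hornerE sw subrr.
have [Q <-] := poly_primitive (restr u v P).
have -> : Q^`() \Po (1 - 'X) = - (Q \Po (1 - 'X))^`().
  by rewrite deriv_comp derivB derivX (_ : 1 = 1%:P :> {poly R})// derivC sub0r mulrN1 opprK.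
rewrite -scaleN1r poly_intZ !poly_int_deriv !horner_comp !hornerE subrr subr0; ring.
Qed.

End Reversal.

(** * Green's formulas on the mesh, circulations, and the potential of a rot-free field *)

Section Cells.
Variables (R : realType) (V : finType) (pt : V -> R * R).
Variables (Th : {set {set V}}) (Omega : set (R * R)).
Hypothesis tri : triangulation pt Th Omega.
Hypotheses (Oopen : open Omega) (Oreg : regopen Omega).
Implicit Types (T : cell Th) (a b c : V) (w d : pwpoly R Th) (psi phi : pwvec R Th).
Notation tric := (tric pt).
Notation lin := (lin pt).
Notation iedge := (interior_edge pt Th Omega).
Notation bedge := (boundary_edge pt Th Omega).
Notation moment a b := (edge_moment (pt a) (pt b)).

Lemma boundary_edgeP T a b c : tric T a b c -> ~ iedge a b -> bedge a b.
Proof.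
move=> t ne; have [aT bT _] := tric_mem t; have [ab _ _] := tric_neq t.
have e : is_edge Th a b by split => //; exists T; rewrite aT bT.
by split => //; apply: contrapT => nf; apply: ne.
Qed.

Lemma tric_cells_neq T T' a b c c' : tric T a b c -> tric T' b a c' -> T != T'.
Proof. by move=> t t'; apply/eqP => E; subst T'; exact: tric_noflip t t'. Qed.

(* Twice the area. *)
Definition area T : R := \sum_a \sum_b \sum_(c | tric T a b c) cross (pt a) (pt b).

Lemma areaE T a b c : tric T a b c -> area T = lin a b (pt c).
Proof.
move=> t; rewrite /area (sum_cell_edges (fun a b => cross (pt a) (pt b)) t).
by rewrite /lin /cross /=; ring.
Qed.

Lemma area_gt0 T : 0 < area T.
Proof. by have [a [b [c t]]] := tric_ex tri T; rewrite (areaE t) (tric_gt0 t). Qed.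

Lemma weighted_area_eq0 (k : cell Th -> R) : (forall T, 0 <= k T) ->
  \sum_T k T * area T = 0 -> forall T, k T = 0.
Proof.
move=> k0 s0 T; have h : forall T, true -> 0 <= k T * area T.
  by move=> T' _; rewrite mulr_ge0// ltW// area_gt0.
have := psumr_eq0P h s0 (i := T) isT => /eqP.
by rewrite mulf_eq0 (gt_eqF (area_gt0 T)) orbF => /eqP.
Qed.

(* On a function constant on each cell, the sum over the cells of the integrals
   of k^2 x dy along their boundaries vanishes, as neighbours cancel. *)
Lemma grad_eq0 d : A3h0 pt Omega d -> dxh d = 0 -> dyh d = 0 -> d = 0.
Proof.
move=> [_ dc dz] dx0 dy0.
pose k T := (d T)`_0`_0.
have dE T : d T = cst2 (k T).
  apply: grad0_cst; [have := congr1 (fun w : pwpoly R Th => w T) dx0|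
    have := congr1 (fun w : pwpoly R Th => w T) dy0]; by rewrite !ffunE.
have ev T x : eval2 (d T) x = k T by rewrite dE eval2_cst.
have k2 : \sum_T k T ^+ 2 * area T = 0.
  have := @sum_cells_cancel R V pt Th Omega tri Oopen
    (fun T a b => k T ^+ 2 * cross (pt a) (pt b)) _ _.
  move=> H; rewrite -[RHS]H.
  - apply: eq_bigr => T _; rewrite /area mulr_sumr; apply: eq_bigr => a _.
    by rewrite mulr_sumr; apply: eq_bigr => b _; rewrite mulr_sumr.
  - move=> T T' a b c c' ie t t'.
    have [aT _ _] := tric_mem t; have [_ aT' _] := tric_mem t'.
    have := dc a T T' aT aT'; rewrite !ev => ->.
    by rewrite /cross; ring.
  - move=> T a b c t ne.
    have [aT _ _] := tric_mem t.
    have [fa _] := boundary_edge_vertices (boundary_edgeP t ne).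
    by have := dz a T fa aT; rewrite ev => ->; rewrite expr0n mul0r.
apply/ffunP => T; rewrite ffunE dE.
have := weighted_area_eq0 (fun T => sqr_ge0 (k T)) k2 T => /eqP.
by rewrite sqrf_eq0 => /eqP->.
Qed.

(* The gradient g is constant on each cell and has no jump, so that the boundary
   integrals of 2 d (g . n) cancel, while they add up to the integral of 2 |g|^2. *)
Lemma hess_eq0 d : B3ht pt Omega d -> dxh (dxh d) = 0 -> dyh (dxh d) = 0 ->
  dyh (dyh d) = 0 -> d = 0.
Proof.
move=> dB h1 h2 h3; have [_ dc dz] := B3ht_A3h0 dB.
have [_ _ /(jump_valP tri) jx /(jump_valP tri) jy _] := gradh_B3ht_G2ht tri dB.
pose g1 T := (d T)`_1`_0; pose g2 T := (d T)`_0`_1.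
have aff T : total_degree_le 1 (d T).
  have e w : w = 0 -> w T = 0 by move=> ->; rewrite ffunE.
  by apply: hess0_affine; [move: (e _ h1)|move: (e _ h2)|move: (e _ h3)]; rewrite !ffunE.
have ev T x : eval2 (d T) x = (d T)`_0`_0 + g1 T * x.1 + g2 T * x.2 by exact: eval2_affine.
have ge T T' a b c c' : iedge a b -> tric T a b c -> tric T' b a c' ->
    g1 T = g1 T' /\ g2 T = g2 T'.
  move=> ie t t'; have [aT bT _] := tric_mem t; have [bT' aT' _] := tric_mem t'.
  have := jx a b T T' (cst2 1) ie (tric_cells_neq t t') aT bT aT' bT' (degree_cst 1).
  have := jy a b T T' (cst2 1) ie (tric_cells_neq t t') aT bT aT' bT' (degree_cst 1).
  rewrite !ffunE !edge_momentZ !edge_momentB !(degree1_dx (aff _)) !(degree1_dy (aff _)).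
  rewrite !edge_moment_cst !mul1r => /eqP + /eqP; rewrite !subr_eq0.
  by move=> /eqP e2 /eqP e1; split; [exact: e1|exact: e2].
(* [n T a b] is the outward flux of the gradient through the edge. The trapezoidal rule is exact for
   the affine [d], so [G T a b] is twice the edge integral of [d] times its normal derivative. *)
pose n T a b := g1 T * ((pt b).2 - (pt a).2) - g2 T * ((pt b).1 - (pt a).1).
pose G T a b := (eval2 (d T) (pt a) + eval2 (d T) (pt b)) * n T a b.
have s : \sum_T (g1 T ^+ 2 + g2 T ^+ 2) * area T = 0.
  have := @sum_cells_cancel R V pt Th Omega tri Oopen G _ _.
  move=> H; rewrite -[RHS]H.
  - apply: eq_bigr => T _; have [a [b [c t]]] := tric_ex tri T.
    rewrite (sum_cell_edges (G T) t) (areaE t) /G /n !ev /lin /cross /=; ring.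
  - move=> T T' a b c c' ie t t'.
    have [aT bT _] := tric_mem t; have [bT' aT' _] := tric_mem t'.
    rewrite /G (dc a T T')// (dc b T T')// /n.
    by have [-> ->] := ge _ _ _ _ _ _ ie t t'; ring.
  - move=> T a b c t ne; have [aT bT _] := tric_mem t.
    have [fa fb] := boundary_edge_vertices (boundary_edgeP t ne).
    by rewrite /G dz// dz// addr0 mul0r.
have g0 T : g1 T = 0 /\ g2 T = 0.
  have := weighted_area_eq0 (fun T => addr_ge0 (sqr_ge0 (g1 T)) (sqr_ge0 (g2 T))) s T.
  by move/eqP; rewrite paddr_eq0 ?sqr_ge0// !sqrf_eq0 => /andP[/eqP-> /eqP->].
apply: grad_eq0; first exact: B3ht_A3h0 dB.
  apply/ffunP => T; rewrite !ffunE (degree1_dx (aff T)).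
  by have [+ _] := g0 T; rewrite /g1 => ->.
apply/ffunP => T; rewrite !ffunE (degree1_dy (aff T)).
by have [_ +] := g0 T; rewrite /g2 => ->.
Qed.

Definition circulation phi T a b : R :=
  ((pt b).1 - (pt a).1) * moment a b (phi.1 T) +
  ((pt b).2 - (pt a).2) * moment a b (phi.2 T).

Lemma circulation_opposite phi T T' a b c c' : G2ht pt Omega phi -> iedge a b ->
  tric T a b c -> tric T' b a c' -> circulation phi T a b + circulation phi T' b a = 0.
Proof.
move=> [_ _ j1 j2 _] ie t t'.
have [aT bT _] := tric_mem t; have [bT' aT' _] := tric_mem t'.
have := mean_jump tri j1 ie (tric_cells_neq t t') aT bT aT' bT'.
have := mean_jump tri j2 ie (tric_cells_neq t t') aT bT aT' bT'.
rewrite !edge_momentB => /eqP + /eqP; rewrite !subr_eq0 => /eqP e1 /eqP e2.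
by rewrite /circulation e1 e2 !(edge_momentC (pt a) (pt b)); ring.
Qed.

Lemma circulation_boundary phi T a b c : G2ht pt Omega phi -> ~ iedge a b ->
  tric T a b c -> circulation phi T a b = 0.
Proof.
move=> [_ _ _ _ /(boundary_tanP tri) bt] ne t; have [aT bT _] := tric_mem t.
have := bt a b T (cst2 1) (boundary_edgeP t ne) aT bT (degree_cst 1).
by rewrite !edge_momentZ !mul1r.
Qed.

(** Subtracting the field with components 0 and [m x], whose rot is [m], leaves a gradient, which
    has no circulation around the cell. The subtracted field has circulation [m] times the area of
    the triangle, which is half of [area T]. *)
Lemma circulation_cst_rot phi T a b c (m : R) : P_ 2 phi.1 -> P_ 2 phi.2 ->
  tric T a b c -> dx (phi.2 T) - dy (phi.1 T) = cst2 m ->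
  circulation phi T a b + circulation phi T b c + circulation phi T c a = m * area T / 2.
Proof.
move=> p1 p2 t rm.
pose X : {poly {poly R}} := cst2 m * 'X + (0 : {poly R})%:P.
have XE i j : X`_i`_j = if (i == 1%N) && (j == 0%N) then m else 0.
  rewrite /X polyC0 addr0 coefMX; case: i => [|[|i]] /=; rewrite ?coef0// cst2E //=.
  by case: eqP.
have X2 : total_degree_le 2 X by move=> [|[|i]] [|[|j]] // _; rewrite XE.
have dxX : dx X = cst2 m.
  by apply: eq_poly2 => -[|i] [|j]; rewrite dxE XE cst2E /= ?mul0rn.
have [||| W [_ Wx Wy]] := @gradient_potential R 2 (phi.1 T) (phi.2 T - X).
- exact: p1.
- exact: degreeB (p2 T) X2.
- by rewrite dxB dxX -rm opprB addrC subrK.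
have mX p q : moment p q X = m * (((pt p).1 + (pt q).1) / 2).
  rewrite /edge_moment restr_ind restr_cst comp_polyC addr0 mul_polyC poly_intZ.
  by rewrite poly_int_affine; congr (_ * _); field.
have C p q : circulation phi T p q = eval2 W (pt q) - eval2 W (pt p) +
    m * (((pt q).2 - (pt p).2) * (((pt p).1 + (pt q).1) / 2)).
  rewrite -edge_moment_grad Wx Wy edge_momentB mX /circulation; ring.
by rewrite !C (areaE t) /lin /cross /=; field.
Qed.

(** Cancellation between neighbours leaves [m / 2] times the total of [area], which is positive
    thanks to the cell [T0]. *)
Lemma cst_rot_eq0 phi (m : R) T0 : G2ht pt Omega phi ->
  (forall T, dx (phi.2 T) - dy (phi.1 T) = cst2 m) -> m = 0.
Proof.
move=> phiG rm; have [p1 p2 _ _ _] := phiG.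
have := @sum_cells_cancel R V pt Th Omega tri Oopen (circulation phi) _ _.
have e T : \sum_a \sum_b \sum_(c | tric T a b c) circulation phi T a b = m / 2 * area T.
  have [a [b [c t]]] := tric_ex tri T.
  by rewrite (sum_cell_edges (circulation phi T) t) (circulation_cst_rot p1 p2 t (rm T)); ring.
under eq_bigr do rewrite e.
move=> H; have {H} : \sum_T m / 2 * area T = 0.
  apply: H => [T T' a b c c' ie t t'|T a b c t ne].
    exact: circulation_opposite t t'.
  exact: circulation_boundary t.
rewrite -mulr_sumr => /eqP; rewrite !mulf_eq0 invr_eq0 pnatr_eq0 orbF.
have s0 : 0 < \sum_T area T.
  by rewrite (bigD1 T0)//= ltr_pwDl ?area_gt0// sumr_ge0// => T _; rewrite ltW ?area_gt0.
by rewrite (gt_eqF s0) orbF => /eqP.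
Qed.

(** Each cell has a polynomial potential [W T], whose increments between vertices are the
    circulations. These form a relative cocycle, exactness yields common vertex values [U], and one
    constant per cell adjusts [W T] to them; [gradh_G2ht_B3ht] recovers the remaining conditions. *)
Lemma rot_free_potential phi : simply_connected Omega -> G2ht pt Omega phi ->
  (forall T, dx (phi.2 T) - dy (phi.1 T) = 0) ->
  exists w, B3ht pt Omega w /\ gradh w = phi.
Proof.
move=> Osc phiG rot0; have [p1 p2 _ _ _] := phiG.
have ext (P : cell Th -> {poly {poly R}} -> Prop) : (forall T, exists p, P T p) ->
    exists w : cell Th -> {poly {poly R}}, forall T, P T (w T).
  by move=> ex; exists (fun T => sval (cid (ex T))) => T; case: cid.
have [W WP] : exists W : cell Th -> {poly {poly R}}, forall T,
    [/\ total_degree_le 3 (W T), dx (W T) = phi.1 T & dy (W T) = phi.2 T].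
  apply: (ext (fun T W => [/\ total_degree_le 3 W, dx W = phi.1 T & dy W = phi.2 T])) => T.
  apply: gradient_potential; [exact: p1|exact: p2|].
  by apply/eqP; rewrite eq_sym -subr_eq0 rot0.
have C T a b : circulation phi T a b = eval2 (W T) (pt b) - eval2 (W T) (pt a).
  by have [_ hx hy] := WP T; rewrite -edge_moment_grad hx hy.
pose c a b : R := if `[< iedge a b >] then
  \sum_T \sum_(r | tric T a b r) circulation phi T a b else 0.
have ce T a b r : tric T a b r -> c a b = circulation phi T a b.
  move=> t; rewrite /c; case: asboolP => ie.
    exact: (sum_left_cell tri (fun T => circulation phi T a b) t).
  by rewrite (circulation_boundary phiG ie t).
have c_edge a b : ~ iedge a b -> c a b = 0 by rewrite /c; case: asboolP.
have c_anti a b : c a b = - c b a.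
  have [ie|ne] := pselect (iedge a b); last first.
    by rewrite !c_edge ?oppr0// => /interior_edgeC.
  have [[T [r t]] [T' [r' t']]] := interior_edge_sides tri Oopen ie.
  rewrite (ce _ _ _ _ t) (ce _ _ _ _ t').
  by apply/eqP; rewrite -addr_eq0 (circulation_opposite phiG ie t t').
have [|U [Ub Uc]] := relative_cocycle_exact tri Oopen Oreg Osc c_anti c_edge.
  move=> T a b r t; rewrite (ce _ _ _ _ t) (ce _ _ _ _ (tric_rot t)).
  by rewrite (ce _ _ _ _ (tric_rot (tric_rot t))) !C; ring.
have [w wP] : exists w : cell Th -> {poly {poly R}}, forall T,
    [/\ total_degree_le 3 (w T), dx (w T) = phi.1 T, dy (w T) = phi.2 T &
     forall a, a \in val T -> eval2 (w T) (pt a) = U a].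
  apply: (ext (fun T Q => [/\ total_degree_le 3 Q, dx Q = phi.1 T, dy Q = phi.2 T &
    forall a, a \in val T -> eval2 Q (pt a) = U a])) => T.
  have [a0 [b0 [c0 t0]]] := tric_ex tri T.
  have [a0T _ _] := tric_mem t0; have [W3 Wx Wy] := WP T.
  (* The constant is fixed at [a0]; at the other vertices the value is right because [W T] and [U]
     have the same increments. *)
  exists (W T - cst2 (eval2 (W T) (pt a0) - U a0)); split.
  - exact: degreeB W3 (degree_cst _).
  - by rewrite dxB Wx (degree1_dx (degree_cst _)) cst2E mulr0n /cst2 !polyC0 subr0.
  - by rewrite dyB Wy (degree1_dy (degree_cst _)) cst2E mulr0n /cst2 !polyC0 subr0.
  move=> a aT; rewrite eval2B eval2_cst.
  suff : eval2 (W T) (pt a) - eval2 (W T) (pt a0) = U a - U a0 by lra.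
  rewrite -(Uc T)//; have [->|aa0] := eqVneq a a0.
    by have := c_anti a0 a0; rewrite subrr; lra.
  have [r [t|t]] := tric_edge tri aT a0T aa0; last by rewrite (ce _ _ _ _ t) C.
  by rewrite c_anti (ce _ _ _ _ t) C opprB.
have gw : gradh [ffun T => w T] = phi.
  rewrite (surjective_pairing phi); congr (_, _); apply/ffunP => T; rewrite !ffunE.
    by have [] := wP T.
  by have [] := wP T.
exists [ffun T => w T]; split => //; apply: (gradh_G2ht_B3ht tri); last by rewrite gw.
- by move=> T; rewrite ffunE; have [] := wP T.
- move=> a T T' aT aT'; rewrite !ffunE.
  by have [_ _ _ ->] := wP T => //; have [_ _ _ ->] := wP T'.
- by move=> a T fa aT; rewrite ffunE; have [_ _ _ ->] := wP T => //; exact: Ub.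
Qed.

End Cells.

(** * Definiteness of the bilinear forms and the constraint on the rot *)

Section Stokes.
Variables (R : realType) (V : finType) (pt : V -> R * R).
Variables (Th : {set {set V}}) (Omega : set (R * R)).
Hypothesis tri : triangulation pt Th Omega.
Hypotheses (Oopen : open Omega) (Oreg : regopen Omega) (Obd : bounded_set Omega).
Implicit Types (T : cell Th) (u v w d q : pwpoly R Th) (phi psi chi : pwvec R Th).
Notation ip_sca := (ip_sca pt Omega).
Notation ip_vec := (ip_vec pt Omega).
Notation ip_gradvec := (ip_gradvec pt Omega).

Lemma pwmulDl u v w : pwmul (u + v) w = pwmul u w + pwmul v w.
Proof. by apply/ffunP => T; rewrite !ffunE mulrDl. Qed.

Lemma pwmulC u v : pwmul u v = pwmul v u.
Proof. by apply/ffunP => T; rewrite !ffunE mulrC. Qed.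

Lemma ip_scaDl u v w : ip_sca (u + v) w = ip_sca u w + ip_sca v w.
Proof. by rewrite !(ip_scaE tri Oreg) pwmulDl (pw_intD tri Oreg Obd). Qed.

Lemma ip_scaBl u v w : ip_sca (u - v) w = ip_sca u w - ip_sca v w.
Proof. by have := ip_scaDl (u - v) v w; rewrite subrK => ->; rewrite addrK. Qed.

Lemma ip_sca0r u : ip_sca u 0 = 0.
Proof.
have e : pwmul u 0 = pwmul (pwcst Th 0) 0.
  by apply/ffunP => T; rewrite !ffunE !mulr0.
by rewrite (ip_scaE tri Oreg) e (pw_intZ tri Oreg Obd) mul0r.
Qed.

Lemma ip_sca_ge0 u : 0 <= ip_sca u u.
Proof. by rewrite (ip_scaE tri Oreg); exact: (pw_int_sqr_ge0 tri). Qed.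

Lemma ip_sca_definite u : ip_sca u u = 0 -> u = 0.
Proof. by rewrite (ip_scaE tri Oreg); exact: (pw_int_definite tri Oreg Obd). Qed.

Lemma ip_vec_ge0 phi : 0 <= ip_vec phi phi.
Proof. by rewrite addr_ge0 ?ip_sca_ge0. Qed.

Lemma ip_vec_definite phi : ip_vec phi phi = 0 -> phi.1 = 0 /\ phi.2 = 0.
Proof.
move/eqP; rewrite paddr_eq0 ?ip_sca_ge0// => /andP[/eqP h1 /eqP h2].
by split; exact: ip_sca_definite.
Qed.

Lemma ip_vecBl phi psi chi : ip_vec (phi.1 - psi.1, phi.2 - psi.2) chi =
  ip_vec phi chi - ip_vec psi chi.
Proof. by rewrite /Defs.ip_vec !ip_scaBl; ring. Qed.

Lemma ip_gradvecBl phi psi chi : ip_gradvec (phi.1 - psi.1, phi.2 - psi.2) chi =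
  ip_gradvec phi chi - ip_gradvec psi chi.
Proof.
rewrite /Defs.ip_gradvec /= !gradhB (ip_vecBl (gradh phi.1) (gradh psi.1)).
by rewrite (ip_vecBl (gradh phi.2) (gradh psi.2)); ring.
Qed.

Lemma ip_hess_eq0 d : B3ht pt Omega d -> ip_hess pt Omega d d = 0 -> d = 0.
Proof.
move=> dB /eqP; rewrite paddr_eq0 ?ip_vec_ge0//.
move=> /andP[/eqP/ip_vec_definite[h1 h2] /eqP/ip_vec_definite[_ h3]].
exact: (hess_eq0 tri Oopen dB).
Qed.

Lemma ip_grad_eq0 d : A3h0 pt Omega d -> ip_vec (gradh d) (gradh d) = 0 -> d = 0.
Proof.
by move=> dA /ip_vec_definite[h1 h2]; exact: (grad_eq0 tri Oopen dA).
Qed.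

Lemma rot_orthogonal_eq0 phi : G2ht pt Omega phi ->
  (forall q, P0_ pt Omega 1 q -> ip_sca q (roth phi) = 0) -> roth phi = 0.
Proof.
move=> phiG orth; have [p1 p2 _ _ _] := phiG.
have rotE T : roth phi T = dx (phi.2 T) - dy (phi.1 T) by rewrite !ffunE.
have [T0 _|noT] := pickP (fun _ : cell Th => true); last first.
  by apply/ffunP => T; have := noT T.
pose one := pwcst Th (1 : R).
have one0 : pw_int pt one != 0.
  apply/eqP => h; have : one = 0.
    apply: (pw_int_definite tri Oreg Obd).
    by rewrite (pw_intZ tri Oreg Obd) h mulr0.
  move=> /(congr1 (fun w : pwpoly R Th => (w T0)`_0`_0)).
  by rewrite !ffunE cst2E /= !coef0 => /eqP; rewrite oner_eq0.
pose m := pw_int pt (roth phi) / pw_int pt one.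
pose q := roth phi - pwmul (pwcst Th m) one.
have q_int : pw_int pt q = 0.
  have := pw_intD tri Oreg Obd q (pwmul (pwcst Th m) one).
  by rewrite subrK (pw_intZ tri Oreg Obd) divfK//; lra.
have qP : P0_ pt Omega 1 q.
  split; last by rewrite (int_Omega_pwfun tri Oreg).
  move=> T; rewrite !ffunE; apply: degreeB.
    by apply: degreeB; [exact: degree_dx|exact: degree_dy].
  have -> : cst2 m * cst2 1 = cst2 m by rewrite /cst2 !polyC1 mulr1.
  exact: degree_cst.
have q0 : q = 0.
  apply: (pw_int_definite tri Oreg Obd).
  (* The product of [q] with [roth phi] is that of [q] with itself plus [m] times the integral of
     [q], which is 0. *)
  have := orth q qP; rewrite (ip_scaE tri Oreg) -(subrK (pwmul (pwcst Th m) one) (roth phi)).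
  rewrite -/q pwmulC pwmulDl (pw_intD tri Oreg Obd).
  have -> : pwmul (pwmul (pwcst Th m) one) q = pwmul (pwcst Th m) q.
    by apply/ffunP => T; rewrite !ffunE /cst2 !polyC1 mulr1.
  by rewrite (pw_intZ tri Oreg Obd) q_int mulr0 addr0.
have rm T : dx (phi.2 T) - dy (phi.1 T) = cst2 m.
  have := congr1 (fun w : pwpoly R Th => w T) q0; rewrite !ffunE => /eqP.
  by rewrite subr_eq0 => /eqP ->; rewrite /cst2 !polyC1 mulr1.
apply/ffunP => T; rewrite rotE rm (cst_rot_eq0 tri Oopen T0 phiG rm).
by rewrite /cst2 !polyC0 ffunE.
Qed.

Lemma roth_gradh w : roth (gradh w) = 0.
Proof. by apply/ffunP => T; rewrite !ffunE dxdy subrr. Qed.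

End Stokes.

Theorem lemma31 (R : realType) (Omega : set (R * R))
  (V : finType) (pt : V -> R * R) (Th : {set {set V}}) (sigma : R)
  (Omega_poly : polygonal_domain Omega)
  (Omega_sc : simply_connected Omega)
  (Th_tri : triangulation pt Th Omega)
  (Th_reg : shape_regular pt Th sigma)
  (f : R * R -> R) (f_L2 : in_L2 Omega f)
  (r : pwpoly R Th) (r_A : A3h0 pt Omega r)
  (r_sol : forall s, A3h0 pt Omega s ->
     ip_vec pt Omega (gradh r) (gradh s) = ip_fct pt Omega f s)
  (phi : pwvec R Th) (p : pwpoly R Th)
  (phi_G : G2ht pt Omega phi) (p_P : P0_ pt Omega 1 p)
  (phi_sol1 : forall psi, G2ht pt Omega psi ->
     ip_gradvec pt Omega phi psi + ip_sca pt Omega p (roth psi) =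
     ip_vec pt Omega (gradh r) psi)
  (phi_sol2 : forall q, P0_ pt Omega 1 q -> ip_sca pt Omega q (roth phi) = 0)
  (zstar : pwpoly R Th) (zstar_A : A3h0 pt Omega zstar)
  (zstar_sol : forall v, A3h0 pt Omega v ->
     ip_vec pt Omega (gradh zstar) (gradh v) = ip_vec pt Omega phi (gradh v))
  (z : pwpoly R Th) (z_B : B3ht pt Omega z)
  (z_sol : forall v, B3ht pt Omega v ->
     ip_hess pt Omega z v = ip_fct pt Omega f v) :
  zstar = z.
Proof.
have [[Oopen _ _ Obd Oreg] _] := Omega_poly.
have rot0 := rot_orthogonal_eq0 Th_tri Oopen Oreg Obd phi_G phi_sol2.
have [w [wB wphi]] : exists w, B3ht pt Omega w /\ gradh w = phi.
  apply: (rot_free_potential Th_tri Oopen Oreg Omega_sc phi_G) => T.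
  by have := congr1 (fun v : pwpoly R Th => v T) rot0; rewrite !ffunE.
have wz : w = z.
  apply/eqP; rewrite -subr_eq0; apply/eqP.
  have dB := B3htB Th_tri wB z_B.
  apply: (ip_hess_eq0 Th_tri Oopen Oreg Obd dB).
  have -> : ip_hess pt Omega (w - z) (w - z) =
      ip_hess pt Omega w (w - z) - ip_hess pt Omega z (w - z).
    have split_diff chi : ip_gradvec pt Omega (gradh (w - z)) chi =
        ip_gradvec pt Omega (gradh w) chi - ip_gradvec pt Omega (gradh z) chi.
      by rewrite gradhB (ip_gradvecBl Th_tri Oreg Obd (gradh w) (gradh z)).
    exact: split_diff.
  (* As a member of A^3_h0, [w - z] is also a test function of step (1), which replaces the load by
     the gradient of [r]. Its gradient is then tested in step (2), where the pressure term
     vanishes. *)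
  rewrite z_sol// -r_sol; last exact: B3ht_A3h0.
  have := phi_sol1 _ (gradh_B3ht_G2ht Th_tri dB).
  by rewrite roth_gradh (ip_sca0r Th_tri Oreg Obd) addr0 /ip_hess wphi => ->; rewrite subrr.
(* The difference [zstar - w] is itself a test function of step (3), in which [phi] is the gradient
   of [w]. *)
rewrite -wz; apply/eqP; rewrite -subr_eq0; apply/eqP.
have dA := A3h0B zstar_A (B3ht_A3h0 wB).
apply: (ip_grad_eq0 Th_tri Oopen Oreg Obd dA).
rewrite [X in ip_vec _ _ X _]gradhB.
rewrite (ip_vecBl Th_tri Oreg Obd (gradh zstar) (gradh w)) zstar_sol//.
by rewrite wphi subrr.
Qed.
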